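(* Let $A$ be a regular domain containing a perfect field $k$ of characteristic $\neq 2$. Let $n\geq 2$ and let $v=(\alpha_1,\dots,\alpha_n,\beta_1,\dots,\beta_n,\gamma)\in Q'_{2n}(A[T])$. Suppose that there is a monic polynomial $f\in A[T]$ such that (the image of) $v$ and $(0,\dots,0,1)$ lie in the same $EO_{2n+1}(A[T]_f)$-orbit of $Q'_{2n}(A[T]_f)$. Then $v$ and $(0,\dots,0,1)$ lie in the same $EO_{2n+1}(A[T])$-orbit of $Q'_{2n}(A[T])$.
   Context: For a commutative ring $R$ with $2R=R$ and $n\ge 2$, put $$Q'_{2n}(R)=\{(x_1,\dots,x_n,y_1,\dots,y_n,z)\in R^{2n+1}\mid \textstyle\sum_{i=1}^n x_iy_i+z^2=1\},$$ with base point $(0,\dots,0,1)$. $EO_{2n+1}(R)$ is the elementary subgroup of the special orthogonal group $SO_{2n+1}(R)$ of the quadratic form $\sum_{i=1}^n X_iY_i+Z^2$. It is the subgroup generated by the following linear maps, acting on vectors $(x_1,\dots,x_n,y_1,\dots,y_n,z)$ (for $1\le i,j\le n$, $i\neq j$, $\lambda\in R$; all coordinates not mentioned are unchanged): (1) $x_i\mapsto x_i+\lambda x_j$, $y_j\mapsto y_j-\lambda y_i$; (2) $x_i\mapsto x_i+\lambda y_j$, $x_j\mapsto x_j-\lambda y_i$; (3) $y_i\mapsto y_i+\lambda x_j$, $y_j\mapsto y_j-\lambda x_i$; (4) $x_i\mapsto x_i+2\lambda z-\lambda^2y_i$, $z\mapsto z-\lambda y_i$; (5) $y_i\mapsto y_i+2\lambda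 z-\lambda^2x_i$, $z\mapsto z-\lambda x_i$. This group acts on $Q'_{2n}(R)$. $A[T]_f$ is the localization of $A[T]$ at the powers of $f$. *)

(* Defs.v *)
From HB Require Import structures.
From mathcomp Require Import all_boot all_algebra separable boolp ring.

Set Implicit Arguments.
Unset Strict Implicit.
Unset Printing Implicit Defensive.

Import GRing.Theory.
Local Open Scope ring_scope.
Local Open Scope quotient_scope.

(* S^-1 R for an arbitrary commutative ring R, as a quotient of R * S; it is
   the zero ring when 0 \in S. *)
Module Localization.
Section Localization.
Variables (R : comPzRingType) (S : mulrClosed R).

Definition frac : Type := R * {s : R | s \in S}.
HB.instance Definition _ := Choice.on frac.

Implicit Types (x y z : frac).

Definition num x : R := x.1.
Definition den x : R := val x.2.

Lemma den_in x : den x \in S. Proof. exact: valP x.2. Qed.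

Definition mkfrac (a s : R) (hs : s \in S) : frac := (a, exist _ s hs).

Lemma num_mk a s hs : num (@mkfrac a s hs) = a. Proof. by []. Qed.
Lemma den_mk a s hs : den (@mkfrac a s hs) = s. Proof. by []. Qed.

Definition equiv x y : bool :=
  `[< exists2 u, u \in S & u * (num x * den y) = u * (num y * den x) >].

Lemma equiv_refl : reflexive equiv.
Proof. by move=> x; apply/asboolP; exists 1; rewrite ?rpred1. Qed.

Lemma equiv_sym : symmetric equiv.
Proof. by move=> x y; apply/asboolP/asboolP => -[u uS e]; exists u. Qed.

Lemma equiv_trans : transitive equiv.
Proof.
move=> y x z /asboolP[u uS e] /asboolP[w wS e']; apply/asboolP.
exists (u * w * den y); first by rewrite !rpredM ?den_in.
transitivity (w * den z * (u * (num x * den y))); first by ring.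
rewrite e; transitivity (u * den x * (w * (num y * den z))); first by ring.
by rewrite e'; ring.
Qed.

Canonical equiv_equiv := EquivRel equiv equiv_refl equiv_sym equiv_trans.

Definition type := {eq_quot equiv}.
HB.instance Definition _ : EqQuotient _ equiv type := EqQuotient.on type.
HB.instance Definition _ := Choice.on type.

Lemma eq_loc x y u : u \in S -> u * (num x * den y) = u * (num y * den x) ->
  \pi_type x = \pi_type y.
Proof. by move=> uS e; apply/eqmodP/asboolP; exists u. Qed.

Lemma eq_loc1 x y : num x * den y = num y * den x -> \pi_type x = \pi_type y.
Proof. by move=> e; apply: (@eq_loc _ _ 1); rewrite ?rpred1 ?e. Qed.

Lemma repr_loc x : exists2 u, u \in S &
  u * (num (repr (\pi_type x)) * den x) = u * (num x * den (repr (\pi_type x))).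
Proof.
by have /eqmodP/asboolP : repr (\pi_type x) = x %[mod type] by rewrite reprK.
Qed.

Definition addf x y : frac :=
  mkfrac (num x * den y + num y * den x) (rpredM (den_in x) (den_in y)).
Definition oppf x : frac := mkfrac (- num x) (den_in x).
Definition mulf x y : frac :=
  mkfrac (num x * num y) (rpredM (den_in x) (den_in y)).
Definition embf (a : R) : frac := mkfrac a (rpred1 S).

Definition add := lift_op2 type addf.
Definition opp := lift_op1 type oppf.
Definition mul := lift_op2 type mulf.
Definition emb := lift_embed type embf.
Canonical emb_pi_morph := PiEmbed emb.

Lemma pi_add : {morph \pi : x y / addf x y >-> add x y}.
Proof.
move=> x y; unlock add.
have [u uS] := repr_loc x; have [w wS] := repr_loc y.
move: (repr _) (repr _) => x' y' ew eu.
apply/esym/(@eq_loc _ _ (u * w)); first exact: rpredM.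
rewrite !num_mk !den_mk.
transitivity (u * (num x' * den x) * (w * den y * den y')
            + w * (num y' * den y) * (u * den x * den x')); first by ring.
by rewrite eu ew; ring.
Qed.
Canonical pi_add_morph := PiMorph2 pi_add.

Lemma pi_opp : {morph \pi : x / oppf x >-> opp x}.
Proof.
move=> x; unlock opp; have [u uS] := repr_loc x; move: (repr _) => x' eu.
apply/esym/(@eq_loc _ _ u) => //; rewrite !num_mk !den_mk.
by rewrite !mulNr !mulrN eu.
Qed.
Canonical pi_opp_morph := PiMorph1 pi_opp.

Lemma pi_mul : {morph \pi : x y / mulf x y >-> mul x y}.
Proof.
move=> x y; unlock mul.
have [u uS] := repr_loc x; have [w wS] := repr_loc y.
move: (repr _) (repr _) => x' y' ew eu.
apply/esym/(@eq_loc _ _ (u * w)); first exact: rpredM.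
rewrite !num_mk !den_mk.
transitivity (u * (num x' * den x) * (w * (num y' * den y))); first by ring.
by rewrite eu ew; ring.
Qed.
Canonical pi_mul_morph := PiMorph2 pi_mul.

Lemma addA : associative add.
Proof.
elim/quotW=> x; elim/quotW=> y; elim/quotW=> z; rewrite !piE.
by apply: eq_loc1; rewrite !(num_mk, den_mk); ring.
Qed.

Lemma addC : commutative add.
Proof.
elim/quotW=> x; elim/quotW=> y; rewrite !piE.
by apply: eq_loc1; rewrite !(num_mk, den_mk); ring.
Qed.

Lemma add0 : left_id (emb 0) add.
Proof.
elim/quotW=> x; rewrite !piE.
by apply: eq_loc1; rewrite !(num_mk, den_mk); ring.
Qed.

Lemma addN : left_inverse (emb 0) opp add.
Proof.
elim/quotW=> x; rewrite !piE.
by apply: eq_loc1; rewrite !(num_mk, den_mk); ring.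
Qed.

HB.instance Definition _ := GRing.isZmodule.Build type addA addC add0 addN.

Lemma mulA : associative mul.
Proof.
elim/quotW=> x; elim/quotW=> y; elim/quotW=> z; rewrite !piE.
by apply: eq_loc1; rewrite !(num_mk, den_mk); ring.
Qed.

Lemma mulC : commutative mul.
Proof.
elim/quotW=> x; elim/quotW=> y; rewrite !piE.
by apply: eq_loc1; rewrite !(num_mk, den_mk); ring.
Qed.

Lemma mul1 : left_id (emb 1) mul.
Proof.
elim/quotW=> x; rewrite !piE.
by apply: eq_loc1; rewrite !(num_mk, den_mk); ring.
Qed.

Lemma mulDl : left_distributive mul add.
Proof.
elim/quotW=> x; elim/quotW=> y; elim/quotW=> z; rewrite !piE.
by apply: eq_loc1; rewrite !(num_mk, den_mk); ring.
Qed.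

HB.instance Definition _ :=
  GRing.Zmodule_isComPzRing.Build type mulA mulC mul1 mulDl.

Lemma emb_is_zmod_morphism : zmod_morphism emb.
Proof.
move=> a b; rewrite -[RHS]/(add (emb a) (opp (emb b))) !piE.
by apply: eq_loc1; rewrite !(num_mk, den_mk); ring.
Qed.

Lemma emb_is_monoid_morphism : monoid_morphism emb.
Proof.
split=> // a b; rewrite -[RHS]/(mul (emb a) (emb b)) !piE.
by apply: eq_loc1; rewrite !(num_mk, den_mk); ring.
Qed.

HB.instance Definition _ :=
  GRing.isZmodMorphism.Build R type emb emb_is_zmod_morphism.
HB.instance Definition _ :=
  GRing.isMonoidMorphism.Build R type emb emb_is_monoid_morphism.

Lemma one_neq0 : 0 \notin S -> 1 != 0 :> type.
Proof.
move=> S0; apply/negP => /eqP; rewrite -[1]/(emb 1) -[0]/(emb 0).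
rewrite !piE => /eqmodP /asboolP[u uS].
rewrite !(num_mk, den_mk) !mulr1 mulr0 => u0.
by rewrite u0 (negPf S0) in uS.
Qed.

End Localization.
End Localization.
HB.export Localization.

Definition localization (R : comPzRingType) (S : mulrClosed R) : Type :=
  Localization.type S.
HB.instance Definition _ (R : comPzRingType) (S : mulrClosed R) :=
  GRing.ComPzRing.on (localization S).

Definition loc_map (R : comPzRingType) (S : mulrClosed R) :
  {rmorphism R -> localization S} := @Localization.emb R S.

Section PowersOf.
Variables (R : comPzRingType) (f : R).

Definition powers_of : {pred R} := [pred g | `[< exists k : nat, g = f ^+ k >]].

Lemma powers_of_closed : mulr_closed powers_of.
Proof.
split=> [|g h /asboolP[k ->] /asboolP[l ->]]; apply/asboolP.
  by exists 0%N.
by exists (k + l)%N; rewrite exprD.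
Qed.

HB.instance Definition _ := GRing.isMulClosed.Build R powers_of powers_of_closed.
End PowersOf.

Definition loc_away (R : comPzRingType) (f : R) : comPzRingType :=
  localization (powers_of f).

Definition loc_away_map (R : comPzRingType) (f : R) :
  {rmorphism R -> loc_away f} := loc_map (powers_of f).

Section AtPrime.
Variables (R : comNzRingType) (P : prime_idealr R).

Definition prime_compl : {pred R} := [pred s | s \notin P].

Lemma prime_compl_closed : mulr_closed prime_compl.
Proof.
split=> [|s t]; rewrite !inE ?idealr1 // => sP tP.
by rewrite prime_idealrM negb_or sP.
Qed.

HB.instance Definition _ :=
  GRing.isMulClosed.Build R prime_compl prime_compl_closed.

Definition loc_at_prime : Type := localization prime_compl.

HB.instance Definition _ := GRing.ComPzRing.on loc_at_prime.

Lemma loc_at_prime_neq0 : 1 != 0 :> loc_at_prime.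
Proof. by apply: Localization.one_neq0; rewrite !inE negbK idealr0. Qed.

HB.instance Definition _ :=
  GRing.PzSemiRing_isNonZero.Build loc_at_prime loc_at_prime_neq0.
End AtPrime.

Section RegularRings.
Implicit Types R : comNzRingType.

Definition ideal_gen R (s : seq R) (x : R) : Prop :=
  exists c : 'I_(size s) -> R, x = \sum_i c i * s`_i.

(* [idealr R] is the type of proper ideals; the improper one is generated by 1. *)
Definition noetherian R : Prop :=
  forall I : idealr R, exists s : seq R, forall x, x \in I <-> ideal_gen s x.

Definition maximal_ideal R (M : idealr R) : Prop :=
  forall I : idealr R, {subset M <= I} -> {subset I <= M}.

Definition prime_chain R (d : nat) (P : 'I_d.+1 -> prime_idealr R) : Prop :=
  forall i j : 'I_d.+1, (i < j)%N ->
    {subset P i <= P j} /\ ~ {subset P j <= P i}.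

Definition krull_dim R (d : nat) : Prop :=
  (exists P : 'I_d.+1 -> prime_idealr R, prime_chain P) /\
  (forall e (P : 'I_e.+1 -> prime_idealr R), prime_chain P -> (e <= d)%N).

(* local Noetherian, with maximal ideal generated by dim R elements *)
Definition regular_local_ring R : Prop :=
  noetherian R /\
  exists M : idealr R,
    [/\ maximal_ideal M,
        forall N : idealr R, maximal_ideal N -> N =i M &
        exists s : seq R,
          krull_dim R (size s) /\ forall x, x \in M <-> ideal_gen s x].

Definition regular_ring R : Prop :=
  noetherian R /\ forall P : prime_idealr R, regular_local_ring (loc_at_prime P).

End RegularRings.

Definition perfect_field (k : fieldType) : Prop :=
  forall p : {poly k}, irreducible_poly p -> separable_poly p.

Section Orthogonal.
Variables (n : nat) (R : comPzRingType).

(* positions of x_i, y_i and z in a column (x_1, ..., x_n, y_1, ..., y_n, z) *)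
Definition xc (i : 'I_n) : 'I_(n + n + 1) := lshift 1 (lshift n i).
Definition yc (i : 'I_n) : 'I_(n + n + 1) := lshift 1 (rshift n i).
Definition zc : 'I_(n + n + 1) := rshift (n + n) ord0.

Definition Qprime (v : 'cV[R]_(n + n + 1)) : Prop :=
  \sum_(i < n) v (xc i) 0 * v (yc i) 0 + v zc 0 ^+ 2 = 1.

Definition Qbase : 'cV[R]_(n + n + 1) := delta_mx zc 0.

(* Matrices act on columns by g *m v, so a summand l *: delta_mx a b is the
   contribution l * v_b to the new a-th coordinate. *)
Inductive EO_generator : 'M[R]_(n + n + 1) -> Prop :=
| EO_gen1 (i j : 'I_n) (l : R) of i != j :
    EO_generator (1%:M + l *: delta_mx (xc i) (xc j)
                       - l *: delta_mx (yc j) (yc i))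
| EO_gen2 (i j : 'I_n) (l : R) of i != j :
    EO_generator (1%:M + l *: delta_mx (xc i) (yc j)
                       - l *: delta_mx (xc j) (yc i))
| EO_gen3 (i j : 'I_n) (l : R) of i != j :
    EO_generator (1%:M + l *: delta_mx (yc i) (xc j)
                       - l *: delta_mx (yc j) (xc i))
| EO_gen4 (i : 'I_n) (l : R) :
    EO_generator (1%:M + (2%:R * l) *: delta_mx (xc i) zc
                       - l ^+ 2 *: delta_mx (xc i) (yc i)
                       - l *: delta_mx zc (yc i))
| EO_gen5 (i : 'I_n) (l : R) :
    EO_generator (1%:M + (2%:R * l) *: delta_mx (yc i) zc
                       - l ^+ 2 *: delta_mx (yc i) (xc i)
                       - l *: delta_mx zc (xc i)).

(* The generators are invertible, so closing under two-sided inverse matrices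
   gives the generated subgroup of GL. *)
Inductive EO : 'M[R]_(n + n + 1) -> Prop :=
| EO_base g of EO_generator g : EO g
| EO_one : EO 1%:M
| EO_mul g h of EO g & EO h : EO (g *m h)
| EO_inv g h of EO g & g *m h = 1%:M & h *m g = 1%:M : EO h.

Definition EO_same_orbit (v w : 'cV[R]_(n + n + 1)) : Prop :=
  exists2 g, EO g & g *m v = w.

End Orthogonal.

Arguments Qbase n R : clear implicits.

(* Main.v *)
Require Import Defs.
From HB Require Import structures.
From mathcomp Require Import all_boot all_order all_algebra fraction ring zify boolp classical_sets.

Set Implicit Arguments.
Unset Strict Implicit.
Unset Printing Implicit Defensive.

Import Order.TTheory GRing.Theory Num.Theory.
Local Open Scope ring_scope.

(**
  Write S = 1/T.  As f is monic of degree d, A[T]_f is contained in A[S]_(Sf'), where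
  f' = S^d f has constant term 1.  The ideals (S) and (f') of A[S] are comaximal,
  so an element of E(A[T]_f) carrying v to e = (0,...,0,1) splits, and v = a w with
  a in E(A[T, S]) and w in Q'(A[S]).

  Over a local ring A with maximal ideal m, such a v is in the E(A[T])-orbit of e.
  There is a Birkhoff decomposition E(A[T, S]) = E(A[T]) N D E(A[S]), where D is a group of
  diagonal matrices with powers of T as entries and N is the normal closure of the
  generators with parameters in m.  After multiplying v and w by elements of E(A[T]) and
  E(A[S]) both are congruent to e or -e modulo m, the matrix of D can be absorbed, and
  N is contained in E(A[T]) E(A[S]).  So v is equivalent to a vector with entries in the
  intersection of A[T] and A[S], that is in A, and over a local ring it is
  equivalent to e.

  For general A, Quillen's local-global principle turns this into v ~ v(0), and by the
  symmetry between T and S into w ~ w(0).  The specialization S = 1 gives v(1) ~ w(1),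
  the specialization S = 0 of the second factor gives w(0) ~ e, so
  v ~ v(0) ~ v(1) ~ w(1) ~ w(0) ~ e.
*)

(** * The quadratic form and Eichler transvections *)

(** All rings in play are realised as predicates on one field containing [T], so an elementary group
    is just given by a set of parameters, and intersections such as that of [A[T]] and [A[S]] make
    sense. Two obstacles shape the argument. A root element conjugated by its opposite is not
    covered by the commutator formulas; a further index, available since [n >= 2], and the fact that
    a commutator of short root elements is long, up to a factor 2 that is invertible, resolve this.
    Conjugation by [D] introduces denominators; it is done by cocharacters under which every root
    has weight -1, 0 or 1, so one factor [T] pays for it, and the constant terms left over are
    handled by elimination over the local ring. The signs come from the form: modulo [m] the last
    coordinate has square 1 once the isotropic part is harmless. [D] fixes [e], and this is why it
    can be absorbed: when [w] is congruent to [e] or [-e], it is carried there by matrices which,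
    apart from a fixed constant one, have parameters in [m] over a localization of [A[S]].
    Conjugated by [D] their parameters stay in [m], up to powers of [T], and the comaximal splitting
    separates the denominators. *)

Section Form.
Variables (n : nat) (R : comNzRingType).
Local Notation V := 'cV[R]_(n + n + 1).
Implicit Types (u v w x : V) (b : bool * 'I_n) (c : R).

(* [(true, i)] stands for the coordinate x_i and [(false, i)] for y_i. *)
Definition pos b : 'I_(n + n + 1) := if b.1 then xc b.2 else yc b.2.
Definition star b : bool * 'I_n := (~~ b.1, b.2).
Definition co b v : R := v (pos b) 0.
Definition cz v : R := v (zc n) 0.
Definition bas b : V := delta_mx (pos b) 0.
Definition ev : V := Qbase n R.

Lemma starK : involutive star.
Proof. by case=> -[] i. Qed.

Lemma star_neq b : star b != b.
Proof. by case: b => -[] i; rewrite xpair_eqE. Qed.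

Lemma pos_eq b b' : (pos b == pos b') = (b == b').
Proof.
case: b b' => [[] i] [[] j]; rewrite /pos /xc /yc /= xpair_eqE /=;
by rewrite ?(eq_lshift, eq_rshift, eq_lrshift, eq_rlshift).
Qed.

Lemma pos_z b : (pos b == zc n) = false.
Proof. by case: b => [[] i]; rewrite /pos /zc /= eq_lrshift. Qed.

Lemma z_pos b : (zc n == pos b) = false.
Proof. by rewrite eq_sym pos_z. Qed.

Lemma colext u v : (forall b, co b u = co b v) -> cz u = cz v -> u = v.
Proof.
move=> h hz; apply/colP => k.
case: (split_ordP k) => [k' ->|k' ->]; last by rewrite (ord1 k').
case: (split_ordP k') => [i ->|i ->]; first exact: (h (true, i)).
exact: (h (false, i)).
Qed.

Lemma coD b u v : co b (u + v) = co b u + co b v. Proof. by rewrite /co mxE. Qed.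
Lemma coN b u : co b (- u) = - co b u. Proof. by rewrite /co mxE. Qed.
Lemma coZ b c u : co b (c *: u) = c * co b u. Proof. by rewrite /co mxE. Qed.
Lemma co0 b : co b 0 = 0. Proof. by rewrite /co mxE. Qed.
Lemma co_bas b b' : co b (bas b') = (b == b')%:R.
Proof. by rewrite /co mxE pos_eq andbT. Qed.
Lemma co_ev b : co b ev = 0. Proof. by rewrite /co mxE pos_z. Qed.
Lemma czD u v : cz (u + v) = cz u + cz v. Proof. by rewrite /cz mxE. Qed.
Lemma czN u : cz (- u) = - cz u. Proof. by rewrite /cz mxE. Qed.
Lemma czZ c u : cz (c *: u) = c * cz u. Proof. by rewrite /cz mxE. Qed.
Lemma cz0 : cz 0 = 0. Proof. by rewrite /cz mxE. Qed.
Lemma cz_bas b : cz (bas b) = 0. Proof. by rewrite /cz mxE z_pos. Qed.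
Lemma cz_ev : cz ev = 1. Proof. by rewrite /cz mxE !eqxx. Qed.

Lemma co_sum b (I : finType) (P : pred I) (f : I -> V) :
  co b (\sum_(i | P i) f i) = \sum_(i | P i) co b (f i).
Proof. by rewrite /co summxE. Qed.

Lemma cz_sum (I : finType) (P : pred I) (f : I -> V) :
  cz (\sum_(i | P i) f i) = \sum_(i | P i) cz (f i).
Proof. by rewrite /cz summxE. Qed.

Definition coE := (coD, coN, coZ, co0, co_bas, co_ev).
Definition czE := (czD, czN, czZ, cz0, cz_bas, cz_ev).

Lemma co_comb b (P : pred (bool * 'I_n)) (f : bool * 'I_n -> R) :
  co b (\sum_(b' | P b') f b' *: bas b') = if P b then f b else 0.
Proof.
rewrite co_sum; case: ifP => Pb.
  rewrite (bigD1 b) //= big1 => [|b' /andP[_ /negPf ne]].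
    by rewrite !coE eqxx mulr1 addr0.
  by rewrite !coE eq_sym ne mulr0.
rewrite big1 // => b' Pb'; rewrite !coE; case: eqP => [e|_]; last by rewrite mulr0.
by rewrite e Pb' in Pb.
Qed.

Lemma cz_comb (P : pred (bool * 'I_n)) (f : bool * 'I_n -> R) :
  cz (\sum_(b' | P b') f b' *: bas b') = 0.
Proof. by rewrite cz_sum big1 // => b' _; rewrite !czE mulr0. Qed.

Lemma vec_decomp v : v = \sum_b co b v *: bas b + cz v *: ev.
Proof.
apply: colext => [b|]; first by rewrite coD coZ co_comb co_ev mulr0 addr0.
by rewrite czD czZ cz_comb cz_ev mulr1 add0r.
Qed.

Definition qf v : R := \sum_(i < n) v (xc i) 0 * v (yc i) 0 + cz v ^+ 2.
Definition bf u v : R := \sum_b co b u * co (star b) v + (cz u * cz v) *+ 2.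

Lemma big_idx (f : bool * 'I_n -> R) :
  \sum_b f b = \sum_(i < n) (f (true, i) + f (false, i)).
Proof.
transitivity (\sum_(c : bool) \sum_(i < n) f (c, i)).
  by rewrite pair_bigA; apply: eq_bigr => -[].
by rewrite big_bool /= -big_split.
Qed.

Lemma bfC u v : bf u v = bf v u.
Proof.
rewrite /bf (mulrC (cz u)); congr (_ + _).
rewrite !big_idx; apply: eq_bigr => i _; rewrite /star /=; ring.
Qed.

Lemma bfDl u v w : bf (u + v) w = bf u w + bf v w.
Proof.
rewrite /bf czD addrACA -big_split /=; congr (_ + _); last by ring.
by apply: eq_bigr => b _; rewrite coD mulrDl.
Qed.

Lemma bfZl c u w : bf (c *: u) w = c * bf u w.
Proof.
rewrite /bf czZ mulrDr mulr_sumr; congr (_ + _); last by ring.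
by apply: eq_bigr => b _; rewrite coZ mulrA.
Qed.

Lemma bfNl u w : bf (- u) w = - bf u w.
Proof. by rewrite -scaleN1r bfZl mulN1r. Qed.
Lemma bf0l w : bf 0 w = 0.
Proof. by rewrite -(scale0r 0) bfZl mul0r. Qed.
Lemma bfDr u v w : bf w (u + v) = bf w u + bf w v.
Proof. by rewrite !(bfC w) bfDl. Qed.
Lemma bfZr c u w : bf w (c *: u) = c * bf w u.
Proof. by rewrite !(bfC w) bfZl. Qed.
Lemma bfNr u w : bf w (- u) = - bf w u.
Proof. by rewrite !(bfC w) bfNl. Qed.
Lemma bf0r w : bf w 0 = 0. Proof. by rewrite bfC bf0l. Qed.

Lemma bf_basl b v : bf (bas b) v = co (star b) v.
Proof.
rewrite /bf cz_bas mul0r mul0rn addr0 (bigD1 b) //= big1 => [|b' ne].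
  by rewrite co_bas eqxx mul1r addr0.
by rewrite co_bas (negPf ne) mul0r.
Qed.

Lemma bf_basr b v : bf v (bas b) = co (star b) v.
Proof. by rewrite bfC bf_basl. Qed.

Lemma bf_evl v : bf ev v = 2 * cz v.
Proof.
by rewrite /bf cz_ev big1 => [|b _]; rewrite ?co_ev ?mul0r // add0r mul1r mulr_natl.
Qed.

Lemma bf_evr v : bf v ev = 2 * cz v.
Proof. by rewrite bfC bf_evl. Qed.

Definition bfE := (bfDl, bfDr, bfNl, bfNr, bfZl, bfZr, bf0l, bf0r,
  bf_basl, bf_basr, bf_evl, bf_evr).

Lemma qfD u v : qf (u + v) = qf u + qf v + bf u v.
Proof.
rewrite /qf /bf czD big_idx /co /pos /star /=.
under eq_bigr do rewrite !mxE.
transitivity (\sum_(i < n) (u (xc i) 0 * u (yc i) 0 + v (xc i) 0 * v (yc i) 0 +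
   (u (xc i) 0 * v (yc i) 0 + u (yc i) 0 * v (xc i) 0)) + (cz u + cz v) ^+ 2).
  by congr (_ + _); apply: eq_bigr => i _; ring.
by rewrite !big_split /=; ring.
Qed.

Lemma qfZ c u : qf (c *: u) = c ^+ 2 * qf u.
Proof.
rewrite /qf czZ mulrDr mulr_sumr exprMn; congr (_ + _).
by apply: eq_bigr => i _; rewrite !mxE; ring.
Qed.

Lemma qfN u : qf (- u) = qf u.
Proof. by rewrite -scaleN1r qfZ sqrrN expr1n mul1r. Qed.
Lemma qf0 : qf 0 = 0. Proof. by rewrite -(scale0r 0) qfZ expr0n mul0r. Qed.

Lemma bf_diag u : bf u u = 2 * qf u.
Proof.
have := qfD u u; rewrite -mulr2n -scaler_nat qfZ => h.
have -> : bf u u = 2%:R ^+ 2 * qf u - (qf u + qf u) by rewrite h; ring.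
ring.
Qed.

Lemma qf_bas b : qf (bas b) = 0.
Proof.
rewrite /qf cz_bas expr0n addr0 big1 // => i _.
rewrite -[bas b (xc i) 0]/(co (true, i) (bas b)).
rewrite -[bas b (yc i) 0]/(co (false, i) (bas b)) !co_bas -natrM mulnb.
by case: b => -[] j; rewrite !xpair_eqE ?andbF.
Qed.

Lemma qf_ev : qf ev = 1.
Proof.
rewrite /qf cz_ev expr1n big1 ?add0r // => i _.
by rewrite -[ev (xc i) 0]/(co (true, i) ev) co_ev mul0r.
Qed.

Definition qfE := (qfD, qfN, qfZ, qf0, qf_bas, qf_ev).

Lemma QprimeE v : Qprime v <-> qf v = 1. Proof. by []. Qed.

Lemma qf_split b v : qf v = co b v * co (star b) v
   + qf (v - co b v *: bas b - co (star b) v *: bas (star b)).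
Proof.
have sb := negPf (star_neq b); have bs : (b == star b) = false by rewrite eq_sym.
by rewrite !(qfE, bfE, coE, starK) !eqxx ?sb ?bs /=; ring.
Qed.

Definition flat u : 'rV[R]_(n + n + 1) := \row_j bf u (delta_mx j 0).

Lemma flatE u x : flat u *m x = (bf u x)%:M.
Proof.
apply/matrixP => i j; rewrite !ord1 !mxE eqxx mulr1n.
have -> : x = \sum_k x k 0 *: delta_mx k 0.
  rewrite [LHS](matrix_sum_delta x); apply: eq_bigr => k _; rewrite big_ord1 //.
have bfs (f : 'I_(n + n + 1) -> R) (r : seq 'I_(n + n + 1)) :
    bf u (\sum_(k <- r) f k *: delta_mx k 0) =
    \sum_(k <- r) f k * bf u (delta_mx k 0).
  elim: r => [|k r IH]; first by rewrite !big_nil bf0r.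
  by rewrite !big_cons bfDr bfZr IH.
rewrite bfs; apply: eq_bigr => k _; rewrite mxE mulrC; congr (_ * _).
rewrite summxE (bigD1 k) //= big1 => [|l ne]; first by rewrite !mxE !eqxx mulr1 addr0.
by rewrite !mxE eq_sym (negPf ne) mulr0.
Qed.

(* The Eichler transvection along the isotropic vector [u], for [w] orthogonal to [u]. *)
Definition tr u w : 'M[R]_(n + n + 1) :=
  1%:M + w *m flat u - u *m flat w - qf w *: (u *m flat u).

Lemma trE u w x :
  tr u w *m x = x + bf u x *: w - bf w x *: u - (qf w * bf u x) *: u.
Proof.
rewrite /tr !(mulmxDl, mulNmx) mul1mx -!scalemxAl -!mulmxA !flatE !mul_mx_scalar.
by rewrite scalerA.
Qed.

Lemma mx_ext (g h : 'M[R]_(n + n + 1)) : (forall x, g *m x = h *m x) -> g = h.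
Proof.
move=> e; apply/matrixP => i j.
have := e (delta_mx j 0); move/colP/(_ i); rewrite -!colE !mxE.
by [].
Qed.

Definition isom (g : 'M[R]_(n + n + 1)) := forall x, qf (g *m x) = qf x.

Lemma isom_bf g u v : isom g -> bf (g *m u) (g *m v) = bf u v.
Proof.
move=> hg; have := qfD (g *m u) (g *m v); rewrite -mulmxDr !hg qfD => e.
have : qf u + qf v + (bf (g *m u) (g *m v) - bf u v) = qf u + qf v + 0.
  by rewrite addrA -e addrK addr0.
by move/addrI/subr0_eq.
Qed.

Lemma isom1 : isom 1%:M. Proof. by move=> x; rewrite mul1mx. Qed.
Lemma isomM g h : isom g -> isom h -> isom (g *m h).
Proof. by move=> hg hh x; rewrite -mulmxA hg hh. Qed.

Lemma tr_isom u w : qf u = 0 -> bf u w = 0 -> isom (tr u w).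
Proof.
move=> qu buw x; rewrite trE !(qfE, bfE) ?bf_diag qu.
rewrite ?(bfC w u) ?buw ?(bfC x w) ?(bfC x u); ring.
Qed.

(** A transvection is defined from the form alone, so an isometry carries its two vectors along.
    Writing this as a commutation keeps it available in rings without an inverse operation. *)
Lemma tr_conj g u w : isom g -> g *m tr u w = tr (g *m u) (g *m w) *m g.
Proof.
move=> hg; apply: mx_ext => x; rewrite -!mulmxA !trE !isom_bf // hg.
by rewrite !(mulmxDr, mulmxN) -!scalemxAr.
Qed.

Lemma trD u w w' : qf u = 0 -> bf u w = 0 -> bf u w' = 0 ->
  tr u w *m tr u w' = tr u (w + w').
Proof.
move=> qu b1 b2; apply: mx_ext => x; rewrite -mulmxA !trE !(qfE, bfE).
rewrite ?bf_diag qu b2 (bfC w u) b1; apply/matrixP => i j; rewrite !mxE; ring.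
Qed.

Lemma tr0 u : tr u 0 = 1%:M.
Proof.
apply: mx_ext => x; rewrite trE bf0l qf0 mul1mx.
by apply/matrixP => i j; rewrite !mxE; ring.
Qed.

Lemma trZ c u w : tr (c *: u) w = tr u (c *: w).
Proof.
apply: mx_ext => x; rewrite !trE !(bfZl, qfZ).
by apply/matrixP => i j; rewrite !mxE; ring.
Qed.

(** For two isotropic vectors the quadratic term vanishes and the rest is antisymmetric. Thus when
    only one of the two is a basis vector, it can be made the axis. *)
Lemma tr_swap u w : qf u = 0 -> qf w = 0 -> tr u w = tr w (- u).
Proof.
move=> qu qw; apply: mx_ext => x; rewrite !trE !(bfNl, qfN) qu qw.
by apply/matrixP => i j; rewrite !mxE; ring.
Qed.

(** Along a fixed axis [u] the second vector matters only modulo [u]. *)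
Lemma tr_self c u w : qf u = 0 -> bf u w = 0 -> tr u (w + c *: u) = tr u w.
Proof.
move=> qu b0; apply: mx_ext => x; rewrite !trE !(bfE, qfE) qu (bfC w u) b0.
by apply/matrixP => i j; rewrite !mxE; ring.
Qed.

(** The axis is additive only up to a third factor, quadratic in [w], which is itself a transvection
    between two isotropic vectors. *)
Lemma tr_sumvec a a' w : qf a = 0 -> qf a' = 0 -> bf a a' = 0 ->
  bf a w = 0 -> bf a' w = 0 ->
  tr (a + a') w = tr a w *m tr a' w *m tr a (- qf w *: a').
Proof.
move=> qa qa' baa' baw baw'; apply: mx_ext => x; rewrite -!mulmxA !trE.
rewrite !(bfE, qfE) !bf_diag (bfC a' a) (bfC w a) (bfC w a') baa' baw baw' qa qa'.
by apply/matrixP => i j; rewrite !mxE; ring.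
Qed.

End Form.

Arguments ev n R : clear implicits.
Arguments bas {n R}.

(** * Elementary groups with restricted parameters *)

Section Elementary.
Variables (n : nat) (R : comNzRingType).
Implicit Types (P : R -> Prop) (b : bool * 'I_n) (g h t : 'M[R]_(n + n + 1)).

(** Root elements of type B: a pair of orthogonal isotropic basis vectors gives a long root, an
    isotropic basis vector together with [ev] a short one. *)
Inductive egen P : 'M[R]_(n + n + 1) -> Prop :=
| egen_long b b' p of P p & b' != b & b' != star b :
    egen P (tr (bas b) (p *: bas b'))
| egen_short b p of P p : egen P (tr (bas b) (p *: ev n R)).

(* [P] is any set of parameters: a subring, an ideal, a fractional ideal.  Inverses are
   not included, since they are automatic when [P] is closed under opposite. *)
Inductive EP P : 'M[R]_(n + n + 1) -> Prop :=
| EP1 : EP P 1%:M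
| EPS t g of egen P t & EP P g : EP P (t *m g).

Lemma EP_mul P g h : EP P g -> EP P h -> EP P (g *m h).
Proof. by elim=> [|t g' ht _ IH] hh; rewrite ?mul1mx -?mulmxA //; apply: EPS; auto. Qed.

Lemma EP_egen P t : egen P t -> EP P t.
Proof. by move=> ht; rewrite -(mulmx1 t); apply: EPS ht (EP1 _). Qed.

Lemma egen_mono P P' t : (forall p, P p -> P' p) -> egen P t -> egen P' t.
Proof.
by move=> h [b b' p /h hp h1 h2|b p /h hp]; [apply: egen_long|apply: egen_short].
Qed.

Lemma EP_mono P P' g : (forall p, P p -> P' p) -> EP P g -> EP P' g.
Proof.
by move=> h; elim=> [|t g' /(egen_mono h) ht _ IH]; [apply: EP1|apply: EPS].
Qed.

Lemma star_eqC b b' : (star b == b') = (star b' == b).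
Proof. by rewrite -(inj_eq (inv_inj (@starK n))) starK eq_sym. Qed.

Lemma idx_neq b b' : b' != b -> b' != star b ->
  (((b == b') = false) * ((b' == b) = false) * ((star b == b') = false)
  * ((b' == star b) = false) * ((b == star b') = false) * ((star b' == b) = false)
  * ((star b == star b') = false) * ((star b' == star b) = false)
  * ((star b == b) = false) * ((b == star b) = false)
  * ((star b' == b') = false) * ((b' == star b') = false))%type.
Proof.
move=> h h'; have K := inj_eq (inv_inj (@starK n)).
have h1 : (b == b') = false by rewrite eq_sym (negPf h).
have h2 : (star b == b') = false by rewrite eq_sym (negPf h').
have h3 : (star b' == b) = false by rewrite star_eqC.
have h4 : (b == star b') = false by rewrite eq_sym.
have S b0 : ((star b0 == b0) = false) * ((b0 == star b0) = false).
  by rewrite (eq_sym b0) (negPf (star_neq b0)).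
by rewrite !K !S h1 h2 h3 h4 (negPf h) (negPf h').
Qed.

Lemma tr_coef (u w : 'cV[R]_(n + n + 1)) (c c' : R) :
  c = c' -> tr u (c *: w) = tr u (c' *: w).
Proof. by move->. Qed.

Lemma long_orth b b' p : b' != star b -> bf (bas b) (p *: bas b') = 0 :> R.
Proof. by move=> h; rewrite bf_basl !coE eq_sym (negPf h) mulr0. Qed.

Lemma short_orth b p : bf (bas b) (p *: ev n R) = 0.
Proof. by rewrite bf_basl !coE mulr0. Qed.

Lemma egen_isom P t : egen P t -> isom t.
Proof.
case=> [b b' p _ _ h|b p _]; apply: tr_isom; rewrite ?qf_bas ?short_orth //.
exact: long_orth.
Qed.

Lemma EP_isom P g : EP P g -> isom g.
Proof. by elim=> [|t h /egen_isom ht _ hh]; [apply: isom1|apply: isomM]. Qed.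

(** Transvections with a common axis add up in [w], so [w] splits into coordinates: the one at [b]
    acts trivially, the one at [star b] is zero by orthogonality, and each of the others is a
    generator. *)
Lemma EP_tr P b w : (forall b', P (co b' w)) -> P (cz w) -> co (star b) w = 0 ->
  EP P (tr (bas b) w).
Proof.
move=> Pw Pz w0; rewrite (vec_decomp w) big_seq_cond.
have main (r : seq (bool * 'I_n)) :
    bf (bas b) (\sum_(i <- r) co i w *: bas i) = 0
    /\ EP P (tr (bas b) (\sum_(i <- r) co i w *: bas i)).
  elim: r => [|b' r [IH0 IH]]; first by rewrite big_nil bf0r tr0; split=> //; apply: EP1.
  have b'0 : bf (bas b) (co b' w *: bas b') = 0.
    have [->|ne] := eqVneq b' (star b); first by rewrite w0 scale0r bf0r.
    exact: long_orth.
  rewrite !big_cons bfDr b'0 IH0 addr0; split=> //.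
  rewrite -trD ?qf_bas //; apply: EP_mul => //.
  have [->|ne] := eqVneq b' (star b); first by rewrite w0 scale0r tr0; apply: EP1.
  have [->|ne'] := eqVneq b' b; last by apply: EP_egen; apply: egen_long.
  by rewrite -[co b w *: _]add0r tr_self ?qf_bas ?bf0r ?tr0 //; apply: EP1.
rewrite -big_seq_cond; case: (main (index_enum _)) => h1 h2.
rewrite -trD ?qf_bas ?short_orth //; apply: EP_mul => //.
by apply: EP_egen; apply: egen_short.
Qed.

End Elementary.

(** * Functoriality of elementary matrices under ring homomorphisms *)

Section Maps.
Variables (n : nat) (R R' : comNzRingType) (phi : {rmorphism R -> R'}).

Local Notation mp := (map_mx phi).

Lemma co_map b (v : 'cV[R]_(n + n + 1)) : co b (mp v) = phi (co b v).
Proof. by rewrite /co mxE. Qed.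
Lemma cz_map (v : 'cV[R]_(n + n + 1)) : cz (mp v) = phi (cz v).
Proof. by rewrite /cz mxE. Qed.

Lemma bf_map (u v : 'cV[R]_(n + n + 1)) : bf (mp u) (mp v) = phi (bf u v).
Proof.
rewrite /bf rmorphD rmorphMn rmorphM rmorph_sum !cz_map; congr (_ + _).
by apply: eq_bigr => b _; rewrite !co_map rmorphM.
Qed.

Lemma qf_map (v : 'cV[R]_(n + n + 1)) : qf (mp v) = phi (qf v).
Proof.
rewrite /qf rmorphD rmorphXn rmorph_sum cz_map; congr (_ + _).
by apply: eq_bigr => i _; rewrite !mxE rmorphM.
Qed.

Lemma map_bas b : mp (bas b : 'cV[R]_(n + n + 1)) = bas b.
Proof. exact: map_delta_mx. Qed.
Lemma map_ev : mp (ev n R) = ev n R'.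
Proof. exact: map_delta_mx. Qed.

Lemma map_tr (u w : 'cV[R]_(n + n + 1)) : mp (tr u w) = tr (mp u) (mp w).
Proof.
have flat_map (v : 'cV[R]_(n + n + 1)) : mp (flat v) = flat (mp v).
  by apply/rowP => j; rewrite !mxE -bf_map map_delta_mx.
by rewrite /tr !(map_mxB, map_mxD, map_mxZ, map_mxM, map_mx1, flat_map) qf_map.
Qed.

Lemma egen_map (P : R -> Prop) (P' : R' -> Prop) (t : 'M[R]_(n + n + 1)) :
  (forall p, P p -> P' (phi p)) -> egen P t -> egen P' (mp t).
Proof.
move=> h [b b' p /h hp h1 h2|b p /h hp].
  by rewrite map_tr map_mxZ !map_bas; apply: egen_long.
by rewrite map_tr map_mxZ map_bas map_ev; apply: egen_short.
Qed.

Lemma EP_map (P : R -> Prop) (P' : R' -> Prop) (g : 'M[R]_(n + n + 1)) :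
  (forall p, P p -> P' (phi p)) -> EP P g -> EP P' (mp g).
Proof.
move=> h; elim=> [|t g' ht _ IH]; first by rewrite map_mx1; apply: EP1.
by rewrite map_mxM; apply: EPS => //; apply: egen_map ht.
Qed.

(** An elementary matrix is a word in parameters, so lifting every parameter lifts the matrix. This
    is the way back from the big field to polynomial matrices. *)
Lemma EP_lift (P : R -> Prop) (P' : R' -> Prop) (g : 'M[R']_(n + n + 1)) :
  (forall p, P' p -> exists2 p', P p' & phi p' = p) -> EP P' g ->
  exists2 g', EP P g' & mp g' = g.
Proof.
move=> h; elim=> [|t g' ht _ [g1 Eg1 <-]]; first by exists 1%:M; rewrite ?map_mx1 //; apply: EP1.
have [t' et' <-] : exists2 t', egen P t' & mp t' = t.
  case: ht => [b b' p /h[p' hp' <-] h1 h2|b p /h[p' hp' <-]].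
    exists (tr (bas b) (p' *: bas b')); first exact: egen_long.
    by rewrite map_tr map_mxZ !map_bas.
  exists (tr (bas b) (p' *: ev n R)); first exact: egen_short.
  by rewrite map_tr map_mxZ map_bas map_ev.
by exists (t' *m g1); rewrite ?map_mxM //; apply: EPS.
Qed.

End Maps.

(** * Inverses and conjugation in elementary groups *)

Section Group.
Variables (n : nat) (R : comUnitRingType).
Implicit Types (P : R -> Prop) (b : bool * 'I_n) (g h t x : 'M[R]_(n + n + 1)).
Implicit Types (u v w : 'cV[R]_(n + n + 1)).

Definition oppc P := forall p, P p -> P (- p).

Lemma invmx_eq g h : g *m h = 1%:M -> invmx g = h.
Proof.
move=> e; have [ug _] := mulmx1_unit e.
by rewrite -[RHS](mulKmx ug) e mulmx1.
Qed.

Lemma invmx_mul g h : g \in unitmx -> h \in unitmx ->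
  invmx (g *m h) = invmx h *m invmx g.
Proof.
by move=> ug uh; apply: invmx_eq; rewrite mulmxA mulmxK // mulmxV.
Qed.

Lemma tr_inv u w : qf u = 0 -> bf u w = 0 -> tr u w *m tr u (- w) = 1%:M.
Proof. by move=> qu b0; rewrite trD ?bfNr ?b0 ?oppr0 // subrr tr0. Qed.

Lemma tr_unit u w : qf u = 0 -> bf u w = 0 -> tr u w \in unitmx.
Proof. by move=> qu /(tr_inv qu)/mulmx1_unit[]. Qed.

Lemma invmx_tr u w : qf u = 0 -> bf u w = 0 -> invmx (tr u w) = tr u (- w).
Proof. by move=> qu /(tr_inv qu)/invmx_eq. Qed.

Lemma egen_inv P t : oppc P -> egen P t ->
  [/\ t \in unitmx & egen P (invmx t)].
Proof.
move=> oP [b b' p hp h1 h2|b p hp].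
  rewrite tr_unit ?invmx_tr ?qf_bas ?long_orth //; split=> //.
  by rewrite -scaleNr; apply: egen_long; auto.
rewrite tr_unit ?invmx_tr ?qf_bas ?short_orth //; split=> //.
by rewrite -scaleNr; apply: egen_short; auto.
Qed.

Lemma egen_unit P t : egen P t -> t \in unitmx.
Proof. by case=> [b b' p hp h1 h2|b p hp]; rewrite tr_unit ?qf_bas ?long_orth ?short_orth. Qed.

Lemma EP_unit P g : EP P g -> g \in unitmx.
Proof.
elim=> [|t h /egen_unit ht _ hh]; first exact: unitmx1.
by rewrite unitmx_mul ht.
Qed.

Lemma EP_inv P g : oppc P -> EP P g -> EP P (invmx g).
Proof.
move=> oP; elim=> [|t h ht hh IH]; first by rewrite invmx1; apply: EP1.
have [ut et] := egen_inv oP ht.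
rewrite invmx_mul ?(EP_unit hh) //; apply: EP_mul => //; exact: EP_egen.
Qed.

Definition cj g x := g *m x *m invmx g.

Lemma cj_tr g u w : isom g -> g \in unitmx -> cj g (tr u w) = tr (g *m u) (g *m w).
Proof. by move=> hg ug; rewrite /cj tr_conj // mulmxK. Qed.

Lemma cjM g x y : g \in unitmx -> cj g (x *m y) = cj g x *m cj g y.
Proof. by move=> ug; rewrite /cj !mulmxA mulmxKV. Qed.

Lemma cj1 g : g \in unitmx -> cj g 1%:M = 1%:M.
Proof. by move=> ug; rewrite /cj mulmx1 mulmxV. Qed.

Lemma cj_mul g h x : g \in unitmx -> h \in unitmx -> cj (g *m h) x = cj g (cj h x).
Proof. by move=> ug uh; rewrite /cj invmx_mul // !mulmxA. Qed.

Lemma cjVK g x : g \in unitmx -> cj g (cj (invmx g) x) = x.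
Proof. by move=> ug; rewrite /cj invmxK !mulmxA mulmxV // mul1mx mulmxK. Qed.

Lemma cj_mulE g x : g \in unitmx -> g *m x = cj g x *m g.
Proof. by move=> ug; rewrite /cj mulmxKV. Qed.

Lemma cj_inv g x : g \in unitmx -> x \in unitmx -> invmx (cj g x) = cj g (invmx x).
Proof. by move=> ug ux; apply: invmx_eq; rewrite -cjM // mulmxV // cj1. Qed.

Lemma cj_cj g h x : g \in unitmx -> h \in unitmx ->
  cj g (cj h x) = cj (cj g h) (cj g x).
Proof. by move=> ug uh; rewrite [RHS]/cj cj_inv // -!cjM. Qed.

Lemma cj_id x : cj 1%:M x = x.
Proof. by rewrite /cj invmx1 mul1mx mulmx1. Qed.

Lemma cj_EP P g x : oppc P -> EP P g -> EP P x -> EP P (cj g x).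
Proof. by move=> oP hg hx; rewrite /cj; do !apply: EP_mul => //; apply: EP_inv. Qed.

Lemma EP_cj_gens P P' g x : g \in unitmx -> (forall t, egen P t -> EP P' (cj g t)) ->
  EP P x -> EP P' (cj g x).
Proof.
move=> ug h; elim=> [|t y ht _ IH]; first by rewrite cj1 //; apply: EP1.
by rewrite cjM //; apply: EP_mul; auto.
Qed.

(* [tr_sumvec] makes a transvection along a sum of two orthogonal basis
   vectors elementary. *)
Lemma EP_tr2 P b1 b2 (c1 c2 : R) w : oppc P -> b2 != b1 -> b2 != star b1 ->
  co (star b1) w = 0 -> co (star b2) w = 0 ->
  (forall b, P (c1 * co b w)) -> P (c1 * cz w) ->
  (forall b, P (c2 * co b w)) -> P (c2 * cz w) -> P (c1 * (qf w * c2)) ->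
  EP P (tr (c1 *: bas b1 + c2 *: bas b2) w).
Proof.
move=> oP ne1 ne2 w1 w2 P1 P1z P2 P2z Pq.
rewrite tr_sumvec; first last.
- by rewrite !bfE w2 mulr0.
- by rewrite !bfE w1 mulr0.
- by rewrite !bfE !coE eq_sym (negPf ne2) !mulr0.
- by rewrite !qfE mulr0.
- by rewrite !qfE mulr0.
rewrite !(trZ c1) (trZ c2) !scalerA; do !apply: EP_mul.
- by apply: EP_tr => [b'||]; rewrite ?coE ?czE // w1 mulr0.
- by apply: EP_tr => [b'||]; rewrite ?coE ?czE // w2 mulr0.
- by apply/EP_egen/egen_long => //; rewrite mulrN mulNr -mulrA; apply: oP.
Qed.

(* The commutator of two short transvections is a long one; this is how
   opposite long roots are handled. *)
Lemma EP_short_comm P U W (c d : R) : oppc P ->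
  qf U = 0 -> qf W = 0 -> bf U W = 0 -> cz U = 0 -> cz W = 0 ->
  EP P (tr U (c *: ev n R)) -> EP P (tr W (d *: ev n R)) ->
  EP P (tr W ((- 2 * c * d) *: U)).
Proof.
move=> oP qU qW bUW zU zW hU hW.
have bUe (z : R) : bf U (z *: ev n R) = 0 by rewrite bfZr bf_evr zU !mulr0.
have bWe (z : R) : bf W (z *: ev n R) = 0 by rewrite bfZr bf_evr zW !mulr0.
have gW : tr U (c *: ev n R) *m W = W.
  by rewrite trE bUW bfC bWe !(mulr0, scale0r, oppr0, addr0).
have ge : tr U (c *: ev n R) *m ev n R = ev n R - (2 * c) *: U.
  rewrite trE bf_evr zU !(mulr0, scale0r, oppr0, addr0) bfZl bf_evl cz_ev.
  by congr (_ - _ *: _); ring.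
have -> : tr W ((- 2 * c * d) *: U) =
    tr W (- (d *: ev n R)) *m cj (tr U (c *: ev n R)) (tr W (d *: ev n R)).
  rewrite cj_tr; [|exact: tr_isom|exact: tr_unit].
  rewrite gW -scalemxAr ge scalerBr scalerA trD ?bfNr ?bfDr ?bWe ?oppr0 //.
    congr tr; rewrite addrA addNr add0r -scaleNr; congr (_ *: _); ring.
  by rewrite bfNr bfZr (bfC W) bUW mulr0 subr0.
apply: EP_mul; last exact: cj_EP.
by rewrite -invmx_tr //; apply: EP_inv.
Qed.

End Group.

(** * Dilation and splitting over comaximal denominators *)

Section Subrings.
Variable (R : comNzRingType).

Definition subrg (P : R -> Prop) :=
  [/\ P 1, forall x y, P x -> P y -> P (x - y) & forall x y, P x -> P y -> P (x * y)].

Variable P : R -> Prop.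
Hypothesis sP : subrg P.

Lemma subrg1 : P 1. Proof. by case: sP. Qed.
Lemma subrgB x y : P x -> P y -> P (x - y). Proof. by case: sP => _ h _; apply: h. Qed.
Lemma subrgM x y : P x -> P y -> P (x * y). Proof. by case: sP => _ _; apply. Qed.
Lemma subrg0 : P 0. Proof. by rewrite -(subrr 1); apply: subrgB subrg1 subrg1. Qed.
Lemma subrgN x : P x -> P (- x). Proof. by rewrite -sub0r; apply: subrgB subrg0. Qed.
Lemma subrgD x y : P x -> P y -> P (x + y).
Proof. by move=> hx hy; rewrite -(opprK y); apply: subrgB hx (subrgN hy). Qed.
Lemma subrgX x k : P x -> P (x ^+ k).
Proof. by move=> hx; elim: k => [|k IH]; [apply: subrg1|rewrite exprS; apply: subrgM]. Qed.
Lemma subrg_nat k : P k%:R.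
Proof.
by elim: k => [|k IH]; [apply: subrg0|rewrite -natr1; apply: subrgD IH subrg1].
Qed.
Lemma subrg_sum (I : Type) (r : seq I) (Q : pred I) (f : I -> R) :
  (forall i, Q i -> P (f i)) -> P (\sum_(i <- r | Q i) f i).
Proof. by move=> h; apply: big_ind => //; [apply: subrg0|apply: subrgD]. Qed.

End Subrings.

Section Dilation.
Variables (n : nat) (R : comUnitRingType) (P : R -> Prop) (s h2 : R).
Hypotheses (n_ge2 : (2 <= n)%N) (sP : subrg P) (Ps : P s).
Hypotheses (Ph2 : P h2) (h22 : h2 * 2 = 1).
Implicit Types (b d : bool * 'I_n) (g t x : 'M[R]_(n + n + 1)) (c p : R) (k N M : nat).

(* [s^N P], [s^-k P] and [P[1/s]], as subsets of the ambient ring. *)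
Definition scl N p := exists2 y, P y & p = s ^+ N * y.
Definition lk k c := P (s ^+ k * c).
Definition loc c := exists k, lk k c.

Lemma scl0 N : scl N 0. Proof. by exists 0; rewrite ?mulr0 //; apply: subrg0. Qed.
Lemma sclN N : oppc (scl N).
Proof. by move=> p [y hy ->]; exists (- y); rewrite ?mulrN //; apply: subrgN. Qed.
Lemma scl_P N p : scl N p -> P p.
Proof. by move=> [y hy ->]; apply: subrgM => //; apply: subrgX. Qed.
Lemma sclM N M k p c : scl M p -> lk k c -> (N + k <= M)%N -> scl N (p * c).
Proof.
move=> [y hy ->] hc le; exists (s ^+ (M - (N + k)) * y * (s ^+ k * c)).
  by do !apply: subrgM => //; apply: subrgX.
rewrite -{1}(subnKC le) !exprD; ring.
Qed.
Lemma scl_le N M p : (N <= M)%N -> scl M p -> scl N p.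
Proof.
move=> le hp; rewrite -(mulr1 p); apply: (@sclM N M 0) => //; last by rewrite addn0.
by rewrite /lk mulr1 expr0; apply: subrg1.
Qed.
Lemma lk_P k c : P c -> lk k c. Proof. by move=> hc; apply: subrgM => //; apply: subrgX. Qed.
Lemma lkD k c c' : lk k c -> lk k c' -> lk k (c + c').
Proof. by rewrite /lk mulrDr; apply: subrgD. Qed.
Lemma lkN k c : lk k c -> lk k (- c). Proof. by rewrite /lk mulrN; apply: subrgN. Qed.
Lemma lkM k l c c' : lk k c -> lk l c' -> lk (k + l) (c * c').
Proof. by rewrite /lk exprD mulrACA; apply: subrgM. Qed.
Lemma lk_le k l c : (k <= l)%N -> lk k c -> lk l c.
Proof.
move=> le; rewrite /lk -(subnK le) exprD -mulrA; apply: subrgM => //; exact: subrgX.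
Qed.
Lemma loc_P c : P c -> loc c. Proof. by exists 0%N; rewrite /lk mul1r. Qed.
Lemma loc_subrg : subrg loc.
Proof.
split=> [|c c' [k hk] [l hl]|c c' [k hk] [l hl]]; first by apply: loc_P; apply: subrg1 sP.
  exists (k + l)%N; apply: lkD; first exact: lk_le (leq_addr _ _) hk.
  by apply/lkN/(lk_le _ hl)/leq_addl.
by exists (k + l)%N; apply: lkM.
Qed.

Lemma P_bool (c : bool) : P c%:R. Proof. exact: subrg_nat. Qed.

Lemma long_bas d d' c b : tr (bas d) (c *: bas d') *m bas b =
  bas b + ((star d == b)%:R * c) *: bas d' - ((star d' == b)%:R * c) *: bas d.
Proof.
rewrite trE !(qfE, bfE, coE) mulr0 mul0r scale0r subr0 scalerA.
by rewrite (star_eqC b) (mulrC c).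
Qed.

Lemma long_ev d d' c : tr (bas d) (c *: bas d') *m ev n R = ev n R.
Proof.
by rewrite trE !(qfE, bfE, coE, czE) !(mulr0, mul0r) !scale0r !subr0 addr0.
Qed.

Lemma short_bas d c b : tr (bas d) (c *: ev n R) *m bas b =
  bas b + ((star d == b)%:R * c) *: ev n R - ((star d == b)%:R * c ^+ 2) *: bas d.
Proof.
rewrite trE !(qfE, bfE, coE, czE) !mulr0 scale0r subr0 scalerA mulr1.
by congr (_ - _ *: _); rewrite mulrC.
Qed.

Lemma short_ev d c : tr (bas d) (c *: ev n R) *m ev n R = ev n R - (2 * c) *: bas d.
Proof.
rewrite trE !(qfE, bfE, coE, czE) !mulr0 !scale0r addr0 subr0 mulr1.
by congr (_ - _ *: _); rewrite mulrC.
Qed.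

Section OneGenerator.
Variables (k : nat) (t : 'M[R]_(n + n + 1)).
Hypothesis ht : egen (lk k) t.

Let ut : t \in unitmx. Proof. exact: egen_unit ht. Qed.
Let it : isom t. Proof. exact: egen_isom ht. Qed.

(** Short generators are quadratic in their parameter, whence the doubled exponent. *)
Lemma gen_coef b i : lk (k + k) (co i (t *m bas b)) /\ lk (k + k) (cz (t *m bas b)).
Proof.
have lkb (f : bool) : lk (k + k) f%:R by apply/lk_P/P_bool.
have lkc (f : bool) c : lk k c -> lk (k + k) (f%:R * c).
  by move=> hc; apply: lkM => //; apply/lk_P/P_bool.
have lkc2 (f : bool) c : lk k c -> lk (k + k) (f%:R * c ^+ 2).
  move=> hc; rewrite -[(k + k)%N]add0n; apply: lkM; last by rewrite expr2; apply: lkM.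
  by apply/lk_P/P_bool.
case: ht => [d d' c hc _ _|d c hc].
  rewrite long_bas !(coE, czE) !mulr0 !addr0 subr0; split; last exact: (lkb false).
  by apply/lkD/lkN; [apply: lkD => //|]; rewrite mulrAC -natrM mulnb; apply: lkc.
rewrite short_bas !(coE, czE) !mulr0 addr0 mulr1 subr0 add0r; split; last exact: lkc.
by apply/lkD/lkN=> //; rewrite mulrAC -natrM mulnb; apply: lkc2.
Qed.

(** A basis vector fixed by [t] can serve as the axis of the conjugate, after [tr_swap] if
    necessary, and [EP_tr] then splits the image of the other one. *)
Lemma gen_conj_fix N M b b' p : (N + (k + k) <= M)%N -> scl M p -> b' != b -> b' != star b ->
  t *m bas b' = bas b' \/ t *m bas b = bas b ->
  EP (scl N) (cj t (tr (bas b) (p *: bas b'))).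
Proof.
move=> le hp ne ne'; rewrite cj_tr // -scalemxAr.
have orth : bf (t *m bas b) (t *m bas b') = 0.
  by rewrite isom_bf // -[bas b']scale1r; apply: long_orth.
case=> e.
  rewrite tr_swap ?qfZ ?it ?qf_bas ?mulr0 // e trZ scalerN -scaleNr; apply: EP_tr => [i||].
  - by rewrite coZ mulNr; apply: sclN; apply: sclM hp _ le; case: (gen_coef b i).
  - by rewrite czZ mulNr; apply: sclN; apply: sclM hp _ le; case: (gen_coef b b).
  - by rewrite coZ -bf_basr -e orth mulr0.
rewrite e; apply: EP_tr => [i||].
- by rewrite coZ; apply: sclM hp _ le; case: (gen_coef b' i).
- by rewrite czZ; apply: sclM hp _ le; case: (gen_coef b' b).
- by rewrite coZ -bf_basl -e orth mulr0.
Qed.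

End OneGenerator.

(* For opposite long roots both arguments are scaled by [s ^+ k] and
   [EP_short_comm] applies. *)
Lemma gen_conj_opp k N M b b' c p : (N + N + (k + k) <= M)%N -> scl M p ->
  b' != b -> b' != star b -> lk k c ->
  EP (scl N) (tr (bas b + c *: bas (star b')) (p *: (bas b' - c *: bas (star b)))).
Proof.
move=> le [y0 hy0 ->] ne ne' hc.
(* Of the power [s ^+ M], one factor [s ^+ N] goes to each of the two short parameters of the
   commutator and one factor [s ^+ k] to each of the vectors [U] and [W], where it clears [c]. The
   constant [h2] compensates the 2 of [EP_short_comm]. *)
pose y := s ^+ (M - (N + N + (k + k))) * y0.
have Py : P y by apply: subrgM => //; apply: subrgX.
have -> : s ^+ M * y0 = s ^+ N * s ^+ N * (s ^+ k * s ^+ k) * y.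
  by rewrite /y -{1}(subnKC le) !exprD; ring.
set a := bas b + _; set a' := bas b' - _.
pose U := s ^+ k *: bas b + (s ^+ k * c) *: bas (star b').
pose W := s ^+ k *: bas b' + (- (s ^+ k * c)) *: bas (star b).
have eU : U = s ^+ k *: a by rewrite /a scalerDr scalerA.
have eW : W = s ^+ k *: a' by rewrite /W scaleNr /a' scalerBr scalerA.
have E := idx_neq ne ne'.
have qa : qf a = 0 by rewrite !(qfE, bfE, coE, starK) !E /=; ring.
have qa' : qf a' = 0 by rewrite !(qfE, bfE, coE, starK) !E /=; ring.
have baa' : bf a a' = 0 by rewrite !(bfE, coE, starK) !eqxx !E /=; ring.
have -> : tr a ((s ^+ N * s ^+ N * (s ^+ k * s ^+ k) * y) *: a') =
    tr W ((- 2 * (h2 * s ^+ N) * (s ^+ N * y)) *: U).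
  rewrite eU eW trZ !scalerA tr_swap ?qfZ ?qa' ?mulr0 // trZ scalerN -scaleNr.
  set lhs := - _; set rhs := _ * _ * _; suff -> : lhs = rhs by [].
  rewrite /lhs /rhs.
  transitivity (- (h2 * 2) * (s ^+ N * s ^+ N * (s ^+ k * s ^+ k) * y)); last by ring.
  by rewrite h22; ring.
have sclh (z z' : R) : P z -> P z' -> scl N (z * (s ^+ N * z')).
  by move=> hz hz'; exists (z * z'); [apply: subrgM | ring].
have Psk : P (s ^+ k) by apply: subrgX.
apply: EP_short_comm; first exact: sclN.
- by rewrite eU qfZ qa mulr0.
- by rewrite eW qfZ qa' mulr0.
- by rewrite eU eW bfZl bfZr baa' !mulr0.
- by rewrite /U !czE !mulr0 addr0.
- by rewrite /W !czE !mulr0 addr0.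
- apply: EP_tr2 => [|||||i||i||]; rewrite ?coE ?czE ?starK ?mulr0 ?mulr1 //; try exact: sclN;
    try exact: scl0.
  + by rewrite E.
  + by rewrite E.
  + by rewrite (mulrC h2); apply: sclh.
  + by rewrite (mulrC h2); apply: sclh.
  rewrite qfZ qf_ev mulr1.
  have -> : s ^+ k * ((h2 * s ^+ N) ^+ 2 * (s ^+ k * c))
     = s ^+ k * h2 ^+ 2 * (s ^+ k * c) * (s ^+ N * s ^+ N) by ring.
  by apply: sclh; do ?apply: subrgM => //; do ?apply: subrgX.
- apply: EP_tr2 => [|||||i||i||]; rewrite ?coE ?czE ?starK ?mulr0 ?mulr1 //; try exact: sclN;
    try exact: scl0.
  + by rewrite E.
  + by rewrite E.
  + exact: sclh.
  + by apply: sclh => //; apply: subrgN.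
  rewrite qfZ qf_ev mulr1.
  have -> : s ^+ k * ((s ^+ N * y) ^+ 2 * - (s ^+ k * c))
     = - (s ^+ k * (s ^+ k * c) * y ^+ 2) * (s ^+ N * s ^+ N) by ring.
  apply: sclh; last exact: subrgX.
  by apply: subrgN => //; do ?apply: subrgM => //; do ?apply: subrgX.
Qed.

Lemma third_idx b : exists2 b1 : bool * 'I_n, b1 != b & b1 != star b.
Proof.
have lt0 : (0 < n)%N by case: (n) n_ge2.
pose i0 : 'I_n := Ordinal lt0; pose i1 : 'I_n := Ordinal n_ge2.
have ne01 : i0 != i1 by [].
case: b => f i; have [e|ne] := eqVneq i i0.
  by exists (f, i1); rewrite /star xpair_eqE /= e (eq_sym i1) (negPf ne01) andbF.
by exists (f, i0); rewrite /star xpair_eqE /= (eq_sym i0) (negPf ne) andbF.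
Qed.

(* A short transvection with parameter [c * d] is a product of long ones with
   parameters divisible by [c] and of conjugates of such by a short one. *)
Lemma short_from_long b b1 (c d : R) : b1 != b -> b1 != star b ->
  tr (bas b) ((c * d) *: ev n R) =
  tr (bas b) (- c *: bas b1)
    *m cj (tr (bas (star b1)) (d *: ev n R)) (tr (bas b) (c *: bas b1))
    *m tr (bas b) ((c * d ^+ 2) *: bas (star b1)).
Proof.
move=> ne ne'; have E := idx_neq ne ne'.
have o1 (z : R) : bf (bas b) (z *: bas b1) = 0 by apply: long_orth.
have o2 (z : R) : bf (bas b) (z *: bas (star b1)) = 0 by apply: long_orth; rewrite E.
have o3 (z : R) := @short_orth n R b z.
rewrite cj_tr; [|by apply: tr_isom; rewrite ?qf_bas ?short_orth|
  by apply: tr_unit; rewrite ?qf_bas ?short_orth].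
rewrite -scalemxAr !short_bas starK eqxx E !mul0r !scale0r addr0 subr0 !mul1r.
rewrite !(scalerDr, scalerN) !scalerA -scaleNr.
rewrite !trD ?qf_bas ?bfDr ?o1 ?o2 ?o3 ?addr0 //.
congr tr; apply/matrixP => i j; rewrite !mxE; ring.
Qed.

Lemma gen_conj_long k N M t b b' p : egen (lk k) t -> (N + N + (k + k) <= M)%N ->
  scl M p -> b' != b -> b' != star b ->
  EP (scl N) (cj t (tr (bas b) (p *: bas b'))).
Proof.
move=> ht le hp ne ne'; have E := idx_neq ne ne'.
have le' : (N + (k + k) <= M)%N by apply: leq_trans le; rewrite -addnA leq_addl.
have ht' := ht; case: t / ht' ht => [d d' c hc h1 h2' ht|d c hc ht]; last first.
  apply: (gen_conj_fix ht le') => //; rewrite !short_bas.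
  have [e|ed] := eqVneq (star d) b; last by right; rewrite !mul0r !scale0r addr0 subr0.
  by left; rewrite e E !mul0r !scale0r addr0 subr0.
have [fb|mb] := boolP ((star d != b) && (star d' != b)).
  apply: (gen_conj_fix ht le') => //; right; case/andP: fb => /negPf f1 /negPf f2.
  by rewrite long_bas f1 f2 !mul0r !scale0r addr0 subr0.
have [fb'|mb'] := boolP ((star d != b') && (star d' != b')).
  apply: (gen_conj_fix ht le') => //; left; case/andP: fb' => /negPf f1 /negPf f2.
  by rewrite long_bas f1 f2 !mul0r !scale0r addr0 subr0.
rewrite cj_tr; [|exact: egen_isom ht|exact: egen_unit ht].
rewrite -scalemxAr !long_bas.
(* Both basis vectors move, so [d] and [d'] are the duals of [b] and [b'] in one of the two orders:
   [t] belongs to the opposite long root. *)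
case/nandP: mb => /negPn/eqP e1; case/nandP: mb' => /negPn/eqP e2; first by rewrite -e1 -e2 eqxx in ne.
- rewrite e1 e2 !eqxx !E !mul0r !scale0r !mul1r subr0 addr0.
  by have := gen_conj_opp le hp ne ne' hc; rewrite -e1 -e2 !starK.
- rewrite e1 e2 !eqxx !E !mul0r !scale0r !mul1r subr0 addr0.
  have := gen_conj_opp le hp ne ne' (lkN hc).
  by rewrite -e1 -e2 !starK !scaleNr opprK.
by rewrite -e1 -e2 eqxx in ne.
Qed.

Lemma gen_conj_short_long k N M d d' c b p : lk k c -> d' != d -> d' != star d ->
  (N + k <= M)%N -> scl M p ->
  EP (scl N) (cj (tr (bas d) (c *: bas d')) (tr (bas b) (p *: ev n R))).
Proof.
move=> hc h1 h2' le hp; have le0 : (N <= M)%N := leq_trans (leq_addr _ _) le.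
have hp0 := scl_le le0 hp.
have two (d1 : bool * 'I_n) c1 : lk k c1 -> d1 != b -> d1 != star b ->
    EP (scl N) (tr (bas b + c1 *: bas d1) (p *: ev n R)).
  move=> hc' ne ne'; rewrite -{1}(scale1r (bas b)).
  have hcp : scl N (c1 * p) by rewrite mulrC; apply: sclM hp hc' le.
  apply: EP_tr2 => [|||||i||i||] //; rewrite ?coE ?czE ?mulr0 ?mulr1 ?mul1r //; try exact: sclN;
    try exact: scl0.
  rewrite qfZ qf_ev mulr1 expr2 -mulrA (mulrC p) (mulrC p).
  by apply: (@sclM N N 0) => //; [apply: lk_P (scl_P hp)|rewrite addn0].
rewrite cj_tr; [|by apply: tr_isom; rewrite ?qf_bas ?long_orth|
  by apply: tr_unit; rewrite ?qf_bas ?long_orth].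
rewrite -scalemxAr long_ev long_bas; have E' := idx_neq h1 h2'.
have [e|ne] := eqVneq (star d) b.
  rewrite -e E' mul0r scale0r subr0 mul1r e; apply: two => //.
    by rewrite -e E'.
  by rewrite -e starK.
have [e|ne'] := eqVneq (star d') b; rewrite !mul0r scale0r addr0; last first.
  rewrite scale0r subr0; apply: EP_tr => [i||]; rewrite ?coE ?czE ?mulr0 ?mulr1 //; exact: scl0.
rewrite mul1r -scaleNr; apply: two; [exact: lkN| |].
  by rewrite -e E'.
by rewrite -e starK eq_sym.
Qed.

Lemma gen_conj_short_short k N M d c b p : lk k c -> star d != b ->
  (N + k <= M)%N -> scl M p ->
  EP (scl N) (cj (tr (bas d) (c *: ev n R)) (tr (bas b) (p *: ev n R))).
Proof.
move=> hc ne le hp; have le0 : (N <= M)%N := leq_trans (leq_addr _ _) le.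
have hp0 := scl_le le0 hp.
rewrite cj_tr; [|by apply: tr_isom; rewrite ?qf_bas ?short_orth|
  by apply: tr_unit; rewrite ?qf_bas ?short_orth].
rewrite -scalemxAr short_ev short_bas (negPf ne) !mul0r !scale0r addr0 subr0.
apply: EP_tr => [i||]; rewrite !(coE, czE) ?mulr0 ?subr0 ?mulr1 ?sub0r //.
  rewrite !mulrN; apply: sclN; apply: (@sclM N M k) => //.
  rewrite -[k in lk k]add0n -mulrA (mulrC c) mulrA; apply: lkM => //.
  by apply: lk_P; apply: subrgM => //; apply: subrg_nat.
by rewrite star_eqC (negPf ne) mulr0 oppr0 mulr0.
Qed.

(* The remaining case, a short transvection against its opposite, reduces to
   the previous ones through [short_from_long]. *)
Lemma gen_conj k N : exists M, forall t x, egen (lk k) t -> EP (scl M) x ->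
  EP (scl N) (cj t x).
Proof.
(* In the opposite short case the parameter is factored into two elements of [scl M0], which are
   conjugated separately; hence the doubled exponent. *)
pose M0 := (N + N + (k + k))%N; exists (M0 + M0)%N => t x ht.
have ut := egen_unit ht.
have leM : (N + N + (k + k) <= M0 + M0)%N by rewrite leq_addr.
have leM1 : (N + k <= M0)%N by rewrite leq_add ?leq_addr.
have leM2 : (N + k <= M0 + M0)%N by apply: leq_trans leM1 _; rewrite leq_addr.
apply: EP_cj_gens => // _ [b b' p hp ne ne'|b p hp].
  exact: (gen_conj_long ht leM).
have ht' := ht; case: t / ht' ht ut => [d d' c hc h1 h2' ht ut|d c hc ht ut].
  exact: (gen_conj_short_long _ hc h1 h2' leM2).
have [e|ne] := eqVneq (star d) b; last exact: (gen_conj_short_short hc ne leM2).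
have [b1 ne ne'] := third_idx b; have E := idx_neq ne ne'.
case: hp => y hy ->.
rewrite (_ : _ * y = (s ^+ M0 * y) * s ^+ M0); last by rewrite exprD; ring.
have sy : scl M0 (s ^+ M0 * y) by exists y.
have s1 : scl M0 (s ^+ M0) by exists 1; rewrite ?mulr1 //; apply: subrg1.
have ug (z : R) : tr (bas (star b1)) (z *: ev n R) \in unitmx.
  by apply: tr_unit; rewrite ?qf_bas ?short_orth.
rewrite (short_from_long _ _ ne ne') cjM // cjM //.
apply: EP_mul; first apply: EP_mul.
- by apply: (gen_conj_long ht (leqnn _)) => //; apply: sclN.
- rewrite cj_cj //; apply: cj_EP; first exact: sclN.
    by apply: (gen_conj_short_short hc _ leM1 s1); rewrite e E.
  exact: (gen_conj_long ht (leqnn _)).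
- apply: (gen_conj_long ht (leqnn _)); rewrite ?E //.
  by exists (y * (s ^+ M0) ^+ 2); [do ?apply: subrgM => //; do ?apply: subrgX | ring].
Qed.

(** The bounds of [gen_conj] compose along a word for [g]. The resulting exponent depends on [g] and
    [N] only and serves all [x] at once. *)
Lemma dilation g N : EP loc g -> exists M, forall x, EP (scl M) x -> EP (scl N) (cj g x).
Proof.
move=> hg; elim: hg N => [|t g' ht hg' IH] N; first by exists N => x; rewrite cj_id.
have [k htk] : exists k, egen (lk k) t.
  case: ht => [b b' p [k hk] h1 h2'|b p [k hk]]; exists k; first exact: egen_long.
  exact: egen_short.
have [M1 h1] := gen_conj k N; have [M h] := IH M1; exists M => x hx.
rewrite cj_mul ?(EP_unit hg') ?(egen_unit htk) //; apply: h1 => //; exact: h.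
Qed.

End Dilation.

Lemma egen_split (n : nat) (R : comNzRingType) (Q Q' Q'' : R -> Prop)
    (t : 'M[R]_(n + n + 1)) :
  (forall p, Q p -> exists p' p'', [/\ Q' p', Q'' p'' & p = p' + p'']) ->
  egen Q t -> exists t' t'', [/\ egen Q' t', egen Q'' t'' & t = t' *m t''].
Proof.
move=> h [b b' p /h[p' [p'' [h1 h2 ->]]] ne ne'|b p /h[p' [p'' [h1 h2 ->]]]].
  exists (tr (bas b) (p' *: bas b')), (tr (bas b) (p'' *: bas b')).
  split; [exact: egen_long|exact: egen_long|].
  by rewrite trD ?qf_bas ?long_orth // scalerDl.
exists (tr (bas b) (p' *: ev n R)), (tr (bas b) (p'' *: ev n R)).
split; [exact: egen_short|exact: egen_short|].
by rewrite trD ?qf_bas ?short_orth // scalerDl.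
Qed.

Section Coprime.
Variables (n : nat) (R : comUnitRingType) (P I : R -> Prop) (s t u w h2 : R).
Hypotheses (n_ge2 : (2 <= n)%N) (sP : subrg P) (Ps : P s) (Pt : P t).
Hypotheses (Ph2 : P h2) (h22 : h2 * 2 = 1).
Hypotheses (Pu : P u) (Pw : P w) (bez : u * s + w * t = 1).
Hypotheses (IP : forall y, I y -> P y) (IM : forall c y, P c -> I y -> I (c * y)).

Lemma bezout_pow i j : exists U W, [/\ P U, P W & U * s ^+ i + W * t ^+ j = 1].
Proof.
have [U [W [hU hW e]]] : exists U W, [/\ P U, P W & U * s + W * t ^+ j = 1].
  elim: j => [|j [U [W [hU hW e]]]].
    by exists 0, 1; rewrite mul0r add0r mul1r; split=> //; [apply: subrg0 sP|apply: subrg1 sP].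
  exists (U * (u * s + w * t) + W * t ^+ j * u), (W * w); split.
  - by rewrite bez mulr1; apply: subrgD => //; do ?apply: subrgM => //; apply: subrgX.
  - exact: subrgM.
  by rewrite exprS -[RHS](mulr1 1) -{1}e -[X in _ = _ * X]bez; ring.
elim: i => [|i [U' [W' [hU' hW' e']]]].
  by exists 1, 0; rewrite mul0r addr0 mul1r; split=> //; [apply: subrg1 sP|apply: subrg0 sP].
exists (U * U'), (U * s * W' + W); split.
- exact: subrgM.
- by apply: subrgD => //; do ?apply: subrgM.
rewrite exprS -e -[X in _ = X + _]mulr1 -e'; ring.
Qed.

(** Partial fractions, from multiplying [p] by [U * s ^+ (k + M) + W * t ^+ k = 1]. The surplus
    power [M] of [s] is there to be consumed by [dilation]; membership in [I] is recorded for the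
    summand with denominators in [s]. *)
Lemma loc_split M p : loc I (s * t) p ->
  exists p' p'', [/\ loc I s p', scl (loc P t) s M p'' & p = p' + p''].
Proof.
move=> [k hk]; have [U [W [hU hW e]]] := bezout_pow (k + M) k.
have hk' : I (s ^+ k * t ^+ k * p) by rewrite -exprMn.
exists (W * t ^+ k * p), (U * s ^+ (k + M) * p); split.
- exists k; rewrite /lk (_ : _ * _ = W * (s ^+ k * t ^+ k * p)); last by ring.
  exact: IM.
- exists (U * s ^+ k * p); last by rewrite exprD; ring.
  exists k; rewrite /lk (_ : _ * _ = U * (s ^+ k * t ^+ k * p)); last by ring.
  by apply: subrgM => //; apply: IP.
by rewrite -mulrDl addrC e mul1r.
Qed.

(** A new factor on the left splits as [x' *m x''], and [x''] has to cross [a]. The matrix [a] has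
    denominators in [s], so over [loc P t] dilation makes this possible once [x''] is divisible by a
    power of [s] that is chosen after [a]. *)
Lemma coprime_split N (g : 'M[R]_(n + n + 1)) : EP (loc I (s * t)) g ->
  exists a b, [/\ EP (loc I s) a, EP (scl (loc P t) s N) b & g = a *m b].
Proof.
have sPt : subrg (loc P t) := loc_subrg sP Pt.
elim=> [|x g' hx _ [a [b [ha hb ->]]]].
  by exists 1%:M, 1%:M; rewrite mulmx1; split=> //; apply: EP1.
have ua := EP_unit ha.
have ha' : EP (loc (loc P t) s) (invmx a).
  apply: EP_inv; first by move=> p; apply: subrgN; apply: loc_subrg => //; apply: loc_P.
  apply: EP_mono ha => p [k hk]; exists k; apply: loc_P; exact: IP.
have lPh2 : loc P t h2 by apply: loc_P.
have lPs : loc P t s by apply: loc_P.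
have [M hM] := dilation n_ge2 sPt lPs lPh2 h22 N ha'.
have [x' [x'' [hx' hx'' ->]]] := egen_split (loc_split M) hx.
exists (x' *m a), (cj (invmx a) x'' *m b); split.
- exact: EPS.
- by apply: EP_mul => //; apply: hM; apply: EP_egen.
rewrite /cj invmxK !mulmxA; congr (_ *m _); rewrite -!mulmxA; congr (_ *m _).
by rewrite mulmxA mulmxV // mul1mx.
Qed.

End Coprime.

(** * Weyl elements and diagonal matrices *)

Section Entries.
Variables (n : nat) (R : comNzRingType) (P : R -> Prop).
Hypothesis sP : subrg P.

Definition vin (v : 'cV[R]_(n + n + 1)) := forall i, P (v i 0).
Definition mxin (g : 'M[R]_(n + n + 1)) := forall i j, P (g i j).

Lemma vinP v : (forall b, P (co b v)) -> P (cz v) -> vin v.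
Proof.
move=> h hz k; case: (split_ordP k) => [k' ->|k' ->]; last by rewrite (ord1 k').
by case: (split_ordP k') => [i ->|i ->]; [apply: (h (true, i))|apply: (h (false, i))].
Qed.

Lemma vinD u v : vin u -> vin v -> vin (u + v).
Proof. by move=> hu hv i; rewrite mxE; apply: subrgD. Qed.
Lemma vinN u : vin u -> vin (- u).
Proof. by move=> hu i; rewrite mxE; apply: subrgN. Qed.
Lemma vinZ c u : P c -> vin u -> vin (c *: u).
Proof. by move=> hc hu i; rewrite mxE; apply: subrgM. Qed.
Lemma vin_bas b : vin (bas b).
Proof. by move=> i; rewrite mxE; apply: subrg_nat. Qed.
Lemma vin_ev : vin (ev n R).
Proof. by move=> i; rewrite mxE; apply: subrg_nat. Qed.

Lemma vin_bf u v : vin u -> vin v -> P (bf u v).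
Proof.
move=> hu hv; rewrite /bf mulr2n; do ?apply: subrgD => //; do ?apply: subrgM => //;
  try exact: hu; try exact: hv.
by apply: subrg_sum => // b _; apply: subrgM => //; [apply: hu|apply: hv].
Qed.

Lemma vin_qf v : vin v -> P (qf v).
Proof.
move=> hv; apply: subrgD => //; last by apply: subrgX => //; apply: hv.
by apply: subrg_sum => // i _; apply: subrgM.
Qed.

Lemma mxin_mul g h : mxin g -> mxin h -> mxin (g *m h).
Proof. by move=> hg hh i j; rewrite mxE; apply: subrg_sum => // k _; apply: subrgM. Qed.

Lemma mxin_vin g v : mxin g -> vin v -> vin (g *m v).
Proof. by move=> hg hv i; rewrite mxE; apply: subrg_sum => // k _; apply: subrgM. Qed.

Lemma mxin_cols g : (forall v, vin v -> vin (g *m v)) -> mxin g.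
Proof.
move=> h i j; have := h (delta_mx j 0); rewrite -colE => /(_ _ i); rewrite mxE; apply.
by move=> k; rewrite mxE; apply: subrg_nat.
Qed.

Lemma egen_mxin t : egen P t -> mxin t.
Proof.
move=> ht; apply: mxin_cols => v hv; case: ht => [b b' p hp _ _|b p hp].
  have hw : vin (p *: bas b') by apply: vinZ => //; apply: vin_bas.
  have hb := vin_bas b.
  rewrite trE; do ?apply: vinD => //; do ?apply: vinN => //; apply: vinZ => //; do ?apply: subrgM => //;
    by [apply: vin_bf|apply: vin_qf].
have hw : vin (p *: ev n R) by apply: vinZ => //; apply: vin_ev.
have hb := vin_bas b.
rewrite trE; do ?apply: vinD => //; do ?apply: vinN => //; apply: vinZ => //; do ?apply: subrgM => //;
  by [apply: vin_bf|apply: vin_qf].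
Qed.

Lemma EP_mxin g : EP P g -> mxin g.
Proof.
elim=> [i j|t g' /egen_mxin ht _]; last exact: mxin_mul.
by rewrite mxE; apply: subrg_nat.
Qed.

Lemma EP_vin g v : EP P g -> vin v -> vin (g *m v).
Proof. by move/EP_mxin; apply: mxin_vin. Qed.

Lemma EP_tr_vin b w : vin w -> co (star b) w = 0 -> EP P (tr (bas b) w).
Proof. by move=> hw h0; apply: EP_tr => // [b'|]; apply: hw. Qed.

End Entries.

Lemma pair_neq (n : nat) (b b' : bool * 'I_n) :
  (b == b') = (b.1 == b'.1) && (b.2 == b'.2).
Proof. by case: b b' => [? ?] [? ?]. Qed.

Section Weyl.
Variables (n : nat) (R : comUnitRingType) (P : R -> Prop).
Hypotheses (n_ge2 : (2 <= n)%N) (sP : subrg P).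

Definition mono (g : 'M[R]_(n + n + 1)) :=
  forall b, exists b' (e : bool), g *m bas b = (-1) ^+ e *: bas b'.

Lemma monoM g h : mono g -> mono h -> mono (g *m h).
Proof.
move=> hg hh b; have [b1 [e1 E1]] := hh b; have [b2 [e2 E2]] := hg b1.
exists b2, (e2 (+) e1); rewrite -mulmxA E1 -scalemxAr E2 scalerA -signr_addb.
by rewrite addbC.
Qed.

(** The classical product [X *m Y *m X] of a long root element and one of the opposite root, which
    permutes the basis vectors up to sign. *)
Lemma weyl_step b b' : b' != b -> b' != star b ->
  exists g, [/\ EP P g, mono g, g *m bas b = bas b' & g *m bas (star b) = bas (star b')].
Proof.
move=> ne ne'; have E := idx_neq ne ne'.
pose X : 'M[R]_(n + n + 1) := tr (bas (star b)) (1 *: bas b').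
pose Y : 'M[R]_(n + n + 1) := tr (bas (star b')) (-1 *: bas b).
have Xb d : X *m bas d = bas d + (b == d)%:R *: bas b' - (star b' == d)%:R *: bas (star b).
  by rewrite /X long_bas starK !mulr1.
have Yb d : Y *m bas d = bas d - (b' == d)%:R *: bas b + (star b == d)%:R *: bas (star b').
  by rewrite /Y long_bas starK !mulrN1 !scaleNr opprK.
have gb d : X *m Y *m X *m bas d =
    if d == b then bas b' else if d == b' then - bas b
    else if d == star b then bas (star b') else if d == star b' then - bas (star b)
    else bas d.
  rewrite -!mulmxA; pose simp := (scale1r, scale0r, addr0, subr0, add0r).
  have [->|n1] := eqVneq d b.
    rewrite Xb eqxx E !simp mulmxDr !Yb eqxx !E !simp addrC subrK.
    by rewrite Xb !E !simp.
  have [->|n2] := eqVneq d b'.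
    rewrite Xb !E !simp Yb eqxx !E !simp mulmxBr !Xb eqxx !E !simp.
    by rewrite opprD addrCA subrr addr0.
  have [->|n3] := eqVneq d (star b).
    rewrite Xb !E !simp Yb eqxx !E !simp mulmxDr !Xb eqxx !E !simp.
    by rewrite addrC subrK.
  have [->|n4] := eqVneq d (star b').
    rewrite Xb eqxx !E !simp mulmxBr !Yb eqxx !E !simp.
    by rewrite opprD addrCA subrr addr0 mulmxN Xb !E !simp.
  rewrite Xb (eq_sym b) (eq_sym (star b')) (negPf n1) (negPf n4) !scale0r addr0 subr0.
  rewrite Yb (eq_sym b') (eq_sym (star b)) (negPf n2) (negPf n3) !scale0r addr0 subr0.
  by rewrite Xb (eq_sym b) (eq_sym (star b')) (negPf n1) (negPf n4) !scale0r addr0 subr0.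
exists (X *m Y *m X); split.
- have hX : egen P X by apply: egen_long; rewrite ?starK ?E //; apply: subrg1.
  have hY : egen P Y.
    by apply: egen_long; rewrite ?starK ?E //; apply: subrgN => //; apply: subrg1.
  by apply: EP_mul; [apply: EP_mul|]; apply: EP_egen.
- move=> d; rewrite gb; case: ifP => _; first by exists b', false; rewrite scale1r.
  case: ifP => _; first by exists b, true; rewrite scaleN1r.
  case: ifP => _; first by exists (star b'), false; rewrite scale1r.
  case: ifP => _; first by exists (star b), true; rewrite scaleN1r.
  by exists d, false; rewrite scale1r.
- by rewrite gb eqxx.
by rewrite gb !E !eqxx.
Qed.

(** The passage from [b] to its dual is not a single long reflection of the above kind; it takes
    two, through a third index. *)
Lemma weyl b b' : exists g : 'M[R]_(n + n + 1),
  [/\ EP P g, mono g, g *m bas b = bas b' & g *m bas (star b) = bas (star b')].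
Proof.
have [->|ne] := eqVneq b' b.
  exists 1%:M; rewrite !mul1mx; split=> // [|d]; first exact: EP1.
  by exists d, false; rewrite mul1mx scale1r.
have [->|ne'] := eqVneq b' (star b); last exact: weyl_step.
have [b1 n1 n2] := third_idx n_ge2 b; have E := idx_neq n1 n2.
have [g [hg mg g1 g2]] := weyl_step n1 n2.
have [h [hh mh h1 h2]] : exists g, [/\ EP P g, mono g, g *m bas b1 = bas (star b)
    & g *m bas (star b1) = bas (star (star b))] by apply: weyl_step; rewrite E.
exists (h *m g); split; [exact: EP_mul|exact: monoM| |].
  by rewrite -mulmxA g1.
by rewrite -mulmxA g2.
Qed.

Lemma mono_long g b b' p : isom g -> g \in unitmx -> mono g ->
  b' != b -> b' != star b ->
  exists d d' (e : bool), [/\ d' != d, d' != star d &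
     cj g (tr (bas b) (p *: bas b')) = tr (bas d) (((-1) ^+ e * p) *: bas d')].
Proof.
move=> ig ug mg ne ne'; have E := idx_neq ne ne'.
have [d [e eb]] := mg b; have [d' [e' eb']] := mg b'.
exists d, d', (e (+) e'); split.
- apply/eqP => dd'; move: eb'; rewrite dd'.
  have -> : bas d = (-1) ^+ e *: (g *m bas b) :> 'cV[R]_(n + n + 1).
    by rewrite eb scalerA -signr_addb addbb scale1r.
  rewrite scalerA scalemxAr => /(can_inj (mulKmx ug)).
  move=> /(congr1 (co b')); rewrite !coE eqxx E mulr0 => /eqP; rewrite oner_eq0 //.
- apply/eqP => dd'; have := isom_bf (bas b) (bas b') ig.
  rewrite eb eb' dd' !(bfE, coE) E eqxx mulr1 -signr_addb => /eqP.
  by rewrite signr_eq0.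
by rewrite cj_tr // -scalemxAr eb eb' trZ !scalerA mulrAC -signr_addb.
Qed.

End Weyl.

Section Diagonal.
Variables (n : nat) (F : fieldType).
Implicit Types (c : bool * 'I_n -> F).

Definition dgv c : 'rV[F]_(n + n + 1) := \row_k
  match split k with
  | inl k' => match split k' with inl i => c (true, i) | inr i => c (false, i) end
  | inr _ => 1
  end.
Definition dg c : 'M[F]_(n + n + 1) := diag_mx (dgv c).

Lemma dg_co c b v : co b (dg c *m v) = c b * co b v.
Proof.
rewrite /co mul_diag_mx !mxE; congr (_ * _); case: b => -[] i; rewrite /pos /xc /yc /=.
  by rewrite (unsplitK (inl _)) (unsplitK (inl _)).
by rewrite (unsplitK (inl _)) (unsplitK (inr _)).
Qed.

Lemma dg_cz c v : cz (dg c *m v) = cz v.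
Proof. by rewrite /cz mul_diag_mx !mxE /zc (unsplitK (inr _)) mul1r. Qed.

Lemma dg_bas c b : dg c *m bas b = c b *: bas b.
Proof.
apply: colext => [b'|]; last by rewrite dg_cz !czE mulr0.
by rewrite dg_co !coE; case: eqP => [->|_] //; rewrite !mulr0.
Qed.

Lemma dg_ev c : dg c *m ev n F = ev n F.
Proof. by apply: colext => [b'|]; rewrite ?dg_co ?dg_cz // !coE mulr0. Qed.

Lemma dg_mul c c' : dg c *m dg c' = dg (fun b => c b * c' b).
Proof.
by apply: mx_ext => x; apply: colext => [b|]; rewrite -mulmxA ?dg_co ?dg_cz // mulrA.
Qed.

Lemma dg_one c : (forall b, c b = 1) -> dg c = 1%:M.
Proof.
by move=> h; apply: mx_ext => x; apply: colext => [b|]; rewrite mul1mx ?dg_co ?dg_cz // h mul1r.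
Qed.

Lemma dg_isom c : (forall b, c b * c (star b) = 1) -> isom (dg c).
Proof.
move=> h x; rewrite /qf dg_cz; congr (_ + _); apply: eq_bigr => i _.
rewrite -[_ (xc i) 0]/(co (true, i) _) -[_ (yc i) 0]/(co (false, i) _) !dg_co.
by rewrite mulrACA (h (true, i)) mul1r.
Qed.

Lemma dg_unit c : (forall b, c b * c (star b) = 1) -> dg c \in unitmx.
Proof.
move=> h; suff /mulmx1_unit[] : dg c *m dg (fun b => c (star b)) = 1%:M by [].
by rewrite dg_mul dg_one.
Qed.

Variable tau : F.
Hypothesis tau0 : tau != 0.

(* [wq w] is the weight function on indices of the cocharacter [w]. *)
Definition wq (w : 'I_n -> int) (b : bool * 'I_n) : int := if b.1 then w b.2 else - w b.2.
Definition tt w : 'M[F]_(n + n + 1) := dg (fun b => tau ^ wq w b).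
(** The cocharacter of weight 1 at [b], -1 at [star b] and 0 elsewhere. Long and short roots alike
    have weight -1, 0 or 1 under it, so conjugation by [sg b] costs at most one power of [tau]. *)
Definition sgw (b : bool * 'I_n) (i : 'I_n) : int :=
  if i == b.2 then (if b.1 then 1 else -1) else 0.
Definition sg b := tt (sgw b).

Lemma wq_star w b : wq w (star b) = - wq w b.
Proof. by case: b => -[] i; rewrite /wq /= ?opprK. Qed.

Lemma tt_cond w b : tau ^ wq w b * tau ^ wq w (star b) = 1.
Proof. by rewrite wq_star -expfzDr // subrr. Qed.

Lemma tt_isom w : isom (tt w). Proof. by apply: dg_isom; apply: tt_cond. Qed.
Lemma tt_unit w : tt w \in unitmx. Proof. by apply: dg_unit; apply: tt_cond. Qed.
Lemma tt_co w b v : co b (tt w *m v) = tau ^ wq w b * co b v. Proof. exact: dg_co. Qed.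
Lemma tt_cz w v : cz (tt w *m v) = cz v. Proof. exact: dg_cz. Qed.
Lemma tt_bas w b : tt w *m bas b = tau ^ wq w b *: bas b. Proof. exact: dg_bas. Qed.
Lemma tt_ev w : tt w *m ev n F = ev n F. Proof. exact: dg_ev. Qed.

Lemma tt_mul w w' : tt w *m tt w' = tt (fun i => w i + w' i).
Proof.
rewrite /tt dg_mul; congr dg; apply/funext => b.
by rewrite -expfzDr // /wq; case: b.1; rewrite ?opprD.
Qed.

Lemma tt0 : tt (fun=> 0) = 1%:M.
Proof. by apply: dg_one => b; rewrite /wq oppr0 if_same. Qed.

Lemma tt_inv w : invmx (tt w) = tt (fun i => - w i).
Proof.
apply: invmx_eq; rewrite tt_mul -tt0; congr tt; apply/funext => i.
by rewrite subrr.
Qed.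

Lemma wq_sgw b b' : wq (sgw b) b' = (b' == b)%:Z - (b' == star b)%:Z.
Proof.
case: b b' => [f i] [f' i']; rewrite /wq /sgw /star !xpair_eqE /=.
by case: eqP => _; case: f f' => -[] //; rewrite ?andbF ?oppr0.
Qed.

Lemma sg_inv b : invmx (sg b) = sg (star b).
Proof.
rewrite /sg tt_inv; congr tt; apply/funext => i; rewrite /sgw /star /=.
by case: eqP => _; rewrite ?oppr0 //; case: b.1; rewrite ?opprK.
Qed.

Lemma sg_self b : sg b *m bas b = tau *: bas b.
Proof. by rewrite tt_bas wq_sgw eqxx eq_sym (negPf (star_neq b)) subr0 expr1z. Qed.

Lemma sg_star b : sg b *m bas (star b) = tau^-1 *: bas (star b).
Proof. by rewrite tt_bas wq_sgw eqxx (negPf (star_neq b)) sub0r exprN1. Qed.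

Lemma sg_other b b' : b' != b -> b' != star b -> sg b *m bas b' = bas b'.
Proof.
by move=> /negPf ne /negPf ne'; rewrite tt_bas wq_sgw ne ne' subr0 expr0z scale1r.
Qed.

Lemma sgE b v : sg b *m v = v + ((tau - 1) * co b v) *: bas b
  + ((tau^-1 - 1) * co (star b) v) *: bas (star b).
Proof.
apply: colext => [b'|]; last by rewrite tt_cz !czE !mulr0 !addr0.
rewrite tt_co wq_sgw !coE.
have [->|ne] := eqVneq b' b.
  by rewrite eq_sym (negPf (star_neq b)) subr0 expr1z /=; ring.
have [->|ne'] := eqVneq b' (star b).
  by rewrite sub0r exprN1 /=; ring.
by rewrite subr0 expr0z /=; ring.
Qed.

End Diagonal.

(** The same diagonal matrix seen from the other variable: results proved for polynomials in [tau]
    apply to [T] and to [T^-1]. *)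
Lemma sgV (n : nat) (F : fieldType) (T : F) (b : bool * 'I_n) : sg T^-1 (star b) = sg T b.
Proof.
apply: mx_ext => x; apply: colext => [d|]; last by rewrite !tt_cz.
rewrite !tt_co !wq_sgw starK exprz_inv; congr (T ^ _ * _).
by rewrite opprB.
Qed.

(** * Conjugation of polynomial matrices by a cocharacter *)

Section Evaluation.
Variables (K F : fieldType) (iota : {rmorphism K -> F}).
Implicit Types (A : K -> Prop) (tau : F).

(** One evaluation map plays three roles: at [T] it embeds the polynomial ring, at [T^-1] it
    produces polynomials in the inverse variable, and at 0 it extracts constant terms. *)
Definition hev tau : {rmorphism {poly K} -> F} := horner_eval tau \o map_poly iota.

Lemma hevE tau p : hev tau p = (map_poly iota p).[tau]. Proof. by []. Qed.
Lemma hevC tau c : hev tau c%:P = iota c.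
Proof. by rewrite hevE map_polyC hornerC. Qed.
Lemma hevX tau : hev tau 'X = tau.
Proof. by rewrite hevE map_polyX hornerX. Qed.
Lemma hev0 p : hev 0 p = iota p`_0.
Proof. by rewrite hevE horner_coef0 coef_map. Qed.

Definition pA (A : K -> Prop) (p : {poly K}) := forall i, A p`_i.
Definition Pol A tau x := exists2 p, pA A p & x = hev tau p.
Definition cst (A : K -> Prop) x := exists2 a, A a & x = iota a.

Lemma pA_subrg A : subrg A -> subrg (pA A).
Proof.
move=> sA; split=> [i|p q hp hq i|p q hp hq i]; rewrite ?coef1 ?coefB ?coefM.
- exact: subrg_nat.
- exact: subrgB.
by apply: subrg_sum => // j _; apply: subrgM.
Qed.

Lemma pA_X A : subrg A -> pA A 'X.
Proof. by move=> sA i; rewrite coefX; apply: subrg_nat. Qed.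

Lemma pA_C A c : A 0 -> A c -> pA A c%:P.
Proof. by move=> A0 hc i; rewrite coefC; case: ifP. Qed.

Lemma Pol_subrg A tau : subrg A -> subrg (Pol A tau).
Proof.
move=> sA; have sp := pA_subrg sA.
split=> [|x y [p hp ->] [q hq ->]|x y [p hp ->] [q hq ->]].
- by exists 1; rewrite ?rmorph1 //; apply: (subrg1 sp).
- by exists (p - q); rewrite ?rmorphB //; apply: (subrgB sp).
by exists (p * q); rewrite ?rmorphM //; apply: (subrgM sp).
Qed.

Lemma cst_subrg A : subrg A -> subrg (cst A).
Proof.
move=> sA; split=> [|x y [p hp ->] [q hq ->]|x y [p hp ->] [q hq ->]].
- by exists 1; rewrite ?rmorph1 //; apply: subrg1.
- by exists (p - q); rewrite ?rmorphB //; apply: subrgB.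
by exists (p * q); rewrite ?rmorphM //; apply: subrgM.
Qed.

Lemma cst_Pol A tau x : subrg A -> cst A x -> Pol A tau x.
Proof.
move=> sA [a ha ->]; exists a%:P; last by rewrite hevC.
by apply: pA_C => //; apply: subrg0.
Qed.

Lemma Pol_tau A tau : subrg A -> Pol A tau tau.
Proof. by move=> sA; exists 'X; rewrite ?hevX //; apply: pA_X. Qed.

End Evaluation.

(* A local subring [A] of [K] containing 1/2, with its maximal ideal [m]. *)
Record locring (K : fieldType) (A m : K -> Prop) : Prop := LocRing {
  lr_sub : subrg A;
  lr_half : A 2^-1;
  lr_two : (2 : K) != 0;
  lr_mA : forall a, m a -> A a;
  lr_m0 : m 0;
  lr_mD : forall a b, m a -> m b -> m (a + b);
  lr_mM : forall c a, A c -> m a -> m (c * a);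
  lr_m1 : ~ m 1;
  lr_inv : forall a, A a -> m a \/ A a^-1 }.

Section LocalConstants.
Variables (n : nat) (K F : fieldType) (iota : {rmorphism K -> F}) (A m : K -> Prop).
Hypotheses (n_ge2 : (2 <= n)%N) (lr : locring A m).

Local Notation cA := (cst iota A).
Local Notation cm := (cst iota m).

Let sA := lr_sub lr.
Let scA : subrg cA := cst_subrg iota sA.

Lemma cm_cA x : cm x -> cA x.
Proof. by case=> a ha ->; exists a => //; apply: lr_mA lr _ ha. Qed.
Lemma cm0 : cm 0. Proof. by exists 0; rewrite ?rmorph0 //; apply: lr_m0 lr. Qed.
Lemma cmD x y : cm x -> cm y -> cm (x + y).
Proof.
move=> [a ha ->] [b hb ->]; exists (a + b); rewrite ?rmorphD //; exact: lr_mD lr _ _ _ _.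
Qed.
Lemma cmM x y : cA x -> cm y -> cm (x * y).
Proof.
move=> [a ha ->] [b hb ->]; exists (a * b); rewrite ?rmorphM //; exact: lr_mM lr _ _ _ _.
Qed.
Lemma cmN x : cm x -> cm (- x).
Proof.
by rewrite -mulN1r; apply: cmM; apply: subrgN => //; apply: subrg1.
Qed.
Lemma cm1 : ~ cm 1.
Proof.
by move=> [a ha /esym/eqP]; rewrite fmorph_eq1 => /eqP e; apply: (lr_m1 lr); rewrite -e.
Qed.
Lemma cm_sum (I : Type) (r : seq I) (Q : pred I) (f : I -> F) :
  (forall i, Q i -> cm (f i)) -> cm (\sum_(i <- r | Q i) f i).
Proof. by move=> h; apply: big_ind => //; [apply: cm0|apply: cmD]. Qed.

Lemma cA_cases x : cA x -> cm x \/ cA x^-1 /\ x != 0.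
Proof.
move=> [a ha ->]; have [->|a0] := eqVneq a 0; first by left; rewrite rmorph0; apply: cm0.
case: (lr_inv lr ha) => h; first by left; exists a.
by right; rewrite fmorph_eq0 a0; split=> //; exists a^-1; rewrite ?fmorphV.
Qed.

Lemma cm_sqr x : cA x -> cm (x ^+ 2) -> cm x.
Proof.
move=> hx hx2; case: (cA_cases hx) => // -[hx' x0]; case: cm1.
have -> : 1 = x^-1 ^+ 2 * x ^+ 2 by rewrite -exprMn mulVf // expr1n.
by apply: cmM => //; apply: subrgX.
Qed.

Lemma two_neq0 : (2 : F) != 0.
Proof. by rewrite -(rmorph_nat iota) fmorph_eq0; apply: lr_two lr. Qed.

Lemma cA_half : cA 2^-1.
Proof. by exists 2^-1; [apply: lr_half lr|rewrite fmorphV rmorph_nat]. Qed.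

Lemma half_two : 2^-1 * 2 = 1 :> F. Proof. by rewrite mulVf // two_neq0. Qed.

Lemma cm_half x : cm (2 * x) -> cm x.
Proof.
move=> h; rewrite -[x]mul1r -half_two -mulrA; apply: cmM => //; exact: cA_half.
Qed.

Lemma cA2 : cA 2. Proof. exact: subrg_nat. Qed.

Lemma cm_qf (v : 'cV[F]_(n + n + 1)) : vin cA v -> (forall b, cm (co b v)) ->
  cm (qf v - cz v ^+ 2).
Proof.
move=> hv hb; rewrite /qf addrK; apply: cm_sum => i _; apply: cmM; first exact: hv.
exact: (hb (false, i)).
Qed.

(** If all isotropic coordinates were in the maximal ideal, then by isotropy so would be the square
    of the last one, hence the last one itself, and finally the pairing with [nu']. *)
Lemma iso_pivot (nu nu' : 'cV[F]_(n + n + 1)) : vin cA nu -> vin cA nu' -> qf nu = 0 ->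
  bf nu nu' = 1 -> exists b, cA (co b nu)^-1 /\ co b nu != 0.
Proof.
move=> hnu hnu' q0 b1; apply: contrapT => hno.
have hb b : cm (co b nu).
  by case: (@cA_cases (co b nu)) => [|//|h]; [apply: hnu|case: hno; exists b].
have hz : cm (cz nu).
  apply: cm_sqr; first exact: hnu.
  by rewrite -[_ ^+ 2]opprK -[- _ ^+ 2]add0r -{1}q0; apply: cmN; apply: cm_qf.
case: cm1; rewrite -b1 /bf; apply: cmD.
  apply: cm_sum => b _; rewrite mulrC; apply: cmM => //; exact: hnu'.
rewrite -mulr_natl (mulrC (cz nu)) mulrA; apply: cmM => //.
by apply: subrgM => //; [apply: cA2|apply: hnu'].
Qed.

End LocalConstants.

Section CocharacterConjugation.
Variables (n : nat) (K F : fieldType) (iota : {rmorphism K -> F}) (A m : K -> Prop).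
Hypotheses (n_ge2 : (2 <= n)%N) (lr : locring A m).
Variables (tau : F).
Hypothesis tau0 : tau != 0.

Local Notation cA := (cst iota A).
Local Notation P := (Pol iota A tau).
Local Notation sg := (@sg n F tau).

Let sA := lr_sub lr.
Let scA : subrg cA := cst_subrg iota sA.
Let sP : subrg P := Pol_subrg iota tau sA.
Let cAP x : cA x -> P x. Proof. exact: cst_Pol. Qed.
Let Ptau : P tau. Proof. exact: Pol_tau. Qed.
Let oppP : oppc P. Proof. by move=> p; apply: subrgN. Qed.
Let oppcA : oppc cA. Proof. by move=> p; apply: subrgN. Qed.
Let usg b : sg b \in unitmx. Proof. exact: tt_unit. Qed.
Let isg b : isom (sg b). Proof. exact: tt_isom. Qed.

Lemma sg_fix b w : co b w = 0 -> co (star b) w = 0 -> sg b *m w = w.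
Proof. by move=> h h'; rewrite sgE // h h' !mulr0 !scale0r !addr0. Qed.

Lemma sg_levi b c g : isom g -> c != 0 -> g *m bas b = c *: bas b ->
  g *m bas (star b) = c^-1 *: bas (star b) -> cj (sg b) g = g.
Proof.
move=> ig c0 gb gs; suff e : sg b *m g = g *m sg b by rewrite /cj e mulmxK.
apply: mx_ext => x; rewrite -!mulmxA !sgE // !mulmxDr -!scalemxAr gb gs !scalerA.
have cob : co b (g *m x) = c * co b x.
  rewrite -{1}(starK b) -bf_basl -(scale1r (bas _)) -(mulfV c0) -scalerA -gs bfZl isom_bf //.
  by rewrite bf_basl starK.
have cos : co (star b) (g *m x) = c^-1 * co (star b) x.
  by rewrite -bf_basl -(scale1r (bas _)) -(mulVf c0) -scalerA -gb bfZl isom_bf // bf_basl.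
by rewrite cob cos; congr (_ + _ *: _ + _ *: _); ring.
Qed.

(* Writing [g] as a unipotent element times a Levi element [l], the latter is
   again elementary over the constants, although not presented as a word in
   Levi generators. *)
Lemma parabolic_split b c g : EP cA g -> cA c -> c != 0 -> g *m bas b = c *: bas b ->
  exists w l, [/\ vin cA w, co b w = 0 /\ co (star b) w = 0, EP cA l,
    cj (sg b) l = l & g = tr (bas b) w *m l].
Proof.
move=> hg hc c0 gb; have ig := EP_isom hg.
pose nu := c *: (g *m bas (star b)).
have hnu : vin cA nu.
  by apply: vinZ => //; apply: EP_vin => //; apply: vin_bas.
have nus : co (star b) nu = 1.
  rewrite -bf_basl /nu bfZr -bfZl -gb isom_bf // bf_basl coE eqxx //.
have qnu : qf nu = 0 by rewrite qfZ ig qf_bas mulr0.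
have gs : g *m bas (star b) = c^-1 *: nu by rewrite /nu scalerA mulVf // scale1r.
clearbody nu.
pose w := nu - bas (star b) - co b nu *: bas b.
have wb : co b w = 0.
  by rewrite !coE eqxx (eq_sym b) (negPf (star_neq b)) subr0 mulr1 subrr.
have ws : co (star b) w = 0.
  by rewrite !coE eqxx (negPf (star_neq b)) nus mulr0 subrr subr0.
have hw : vin cA w.
  apply: vinD => //; [apply: vinD => //|]; apply: vinN => //; first exact: vin_bas.
  by apply: vinZ => //; [apply: hnu|apply: vin_bas].
have qw : qf w = - co b nu.
  apply/eqP; rewrite -addr_eq0 addrC; apply/eqP; rewrite -qnu (qf_split b nu) nus mulr1.
  by congr (_ + qf _); rewrite scale1r /w addrAC.
have bbw : bf (bas b) w = 0 by rewrite bf_basl ws.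
have unu : tr (bas b) w *m bas (star b) = nu.
  rewrite trE bf_basl coE eqxx scale1r bfC bf_basl starK wb scale0r subr0 mulr1 qw.
  by rewrite /w; apply/matrixP => i j; rewrite !mxE; ring.
have hu : EP cA (tr (bas b) w) by apply: EP_tr_vin.
have uu := EP_unit hu.
have ub : tr (bas b) w *m bas b = bas b.
  rewrite trE bf_basl coE (negPf (star_neq b)) mulr0 !scale0r bfC bbw.
  by rewrite scale0r addr0 !subr0.
exists w, (invmx (tr (bas b) w) *m g); split=> //.
- by apply: EP_mul => //; apply: EP_inv.
- apply: (@sg_levi b c) => //.
  + by apply: isomM => //; apply: (@EP_isom _ _ cA); apply: EP_inv.
  + by rewrite -mulmxA gb -scalemxAr -{2}ub mulKmx.
  by rewrite -mulmxA gs -scalemxAr -unu mulKmx.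
by rewrite mulKVmx.
Qed.

(** The stabilizer of the line of [bas b] involves only the weights 0 and 1 of [sg b], so
    conjugation creates no denominator. *)
Lemma sg_parabolic b c g : EP cA g -> cA c -> c != 0 -> g *m bas b = c *: bas b ->
  EP P (cj (sg b) g).
Proof.
move=> hg hc c0 gb.
have [w [l [hw [wb ws] hl sl ->]]] := parabolic_split hg hc c0 gb.
rewrite cjM // sl; apply: EP_mul; last by apply: EP_mono hl.
rewrite cj_tr // sg_self // sg_fix // trZ.
apply: EP_tr_vin => //; last by rewrite coZ ws mulr0.
by apply: vinZ => // i; apply: cAP.
Qed.

(** * Long root elements divisible by [tau] against the opposite unipotent radical *)

Section LongCore.
Variables (b : bool * 'I_n) (w : 'cV[F]_(n + n + 1)).
Hypotheses (hw : vin cA w) (wb : co b w = 0) (ws : co (star b) w = 0).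
Local Notation y := (star b).
Local Notation u := (tr (bas y) (tau^-1 *: w)).

Let byw c : bf (bas y) (c *: w) = 0. Proof. by rewrite bf_basl starK coZ wb mulr0. Qed.
Let uu : u \in unitmx. Proof. by apply: tr_unit; rewrite ?qf_bas. Qed.
Let iu : isom u. Proof. by apply: tr_isom; rewrite ?qf_bas. Qed.

Lemma u_y : u *m bas y = bas y.
Proof.
by rewrite trE bf_basl starK coE eq_sym (negPf (star_neq b)) !(mulr0, scale0r) bfC byw scale0r addr0 !subr0.
Qed.

Lemma u_other d : d != b -> d != y ->
  u *m bas d = bas d - (tau^-1 * co (star d) w) *: bas y.
Proof.
move=> ne ne'; rewrite trE bf_basl starK coE (eq_sym b) (negPf ne).
by rewrite !(mulr0, scale0r) bf_basr coZ addr0 subr0.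
Qed.

Lemma u_b : u *m bas b = bas b + tau^-1 *: w - (tau^-1 ^+ 2 * qf w) *: bas y.
Proof.
by rewrite trE bf_basl starK coE eqxx scale1r bf_basr coZ ws mulr0 scale0r subr0 qfZ mulr1.
Qed.

Lemma core_y d p : d != b -> d != y -> P p ->
  EP P (cj u (cj (sg b) (tr (bas y) ((tau * p) *: bas d)))).
Proof.
move=> ne ne' hp; rewrite (cj_tr _ _ (isg b)) // -scalemxAr sg_star // sg_other // trZ scalerA.
rewrite mulKf // cj_tr // u_y -scalemxAr u_other // scalerBr -scaleNr scalerA.
rewrite tr_self ?qf_bas ?long_orth ?starK //.
by apply/EP_egen/egen_long; rewrite ?starK.
Qed.

Lemma core_W d d' p : d != b -> d != y -> d' != b -> d' != y -> d' != d -> d' != star d ->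
  P p -> EP P (cj u (cj (sg b) (tr (bas d) ((tau * p) *: bas d')))).
Proof.
move=> nb ny nb' ny' ne ne' hp; rewrite (cj_tr _ _ (isg b)) // -scalemxAr !sg_other //.
rewrite cj_tr // -scalemxAr !u_other //.
set c := co (star d) w; set c' := co (star d') w.
have hc : cA c by apply: hw.
have hc' : cA c' by apply: hw.
have E := idx_neq ne ne'; have Ey := idx_neq nb ny; have Ey' := idx_neq nb' ny'.
pose x := (tau * p) *: bas d' - (p * c') *: bas y.
have -> : (tau * p) *: (bas d' - (tau^-1 * c') *: bas y) = x.
  rewrite scalerBr scalerA /x; congr (_ - _ *: _).
  by rewrite mulrACA mulfV // mul1r.
have hx : vin P x.
  apply: vinD => //; last apply: vinN => //; apply: vinZ => //; try exact: vin_bas.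
    exact: subrgM.
  by apply: subrgM => //; apply: cAP.
have dx : co (star d) x = 0 by rewrite /x !coE E Ey !mulr0 subr0.
have yx : co b x = 0 by rewrite /x !coE Ey' Ey !mulr0 subr0.
have qx : qf x = 0.
  by rewrite /x !(qfE, bfE, coE) ?starK !Ey' /=; ring.
rewrite -scaleNr tr_sumvec ?qfZ ?qf_bas ?mulr0 ?qx ?oppr0 ?scale0r ?tr0 ?mulmx1 //; first last.
- by rewrite bfZl bf_basl starK yx mulr0.
- by rewrite bf_basl.
- by rewrite bfZr bf_basl coE Ey mulr0.
apply: EP_mul; first exact: EP_tr_vin.
have -> : tr (- (tau^-1 * c) *: bas y) x = tr (bas y) ((- (c * p)) *: bas d').
  rewrite trZ /x scalerBr !scalerA -scaleNr tr_self ?qf_bas ?long_orth ?starK //.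
  by apply: tr_coef; field.
apply/EP_egen/egen_long; rewrite ?starK //.
by apply: oppP; apply: subrgM => //; apply: cAP.
Qed.

(** The critical position: [sg b] multiplies the parameter by [tau], but [u] brings in [tau^-1] and
    its square. Both vectors are rescaled so that the one taken as axis, [W], has no denominator;
    the other is cut into [U], [w'] and a multiple of [bas (star b)]. The piece with [U] is an
    opposite-root situation and is obtained as a commutator of short transvections. *)
Lemma core_b d p : d != b -> d != y -> P p ->
  EP P (cj u (cj (sg b) (tr (bas b) ((tau * p) *: bas d)))).
Proof.
move=> nb ny hp; rewrite (cj_tr _ _ (isg b)) // -scalemxAr sg_self // sg_other //.
rewrite cj_tr // -!scalemxAr u_b u_other //.
set c := co (star d) w; have hc : cA c by apply: hw.
have Ey := idx_neq nb ny.
pose U := tau *: bas b + c *: bas (star d); pose W := tau *: bas d + (- c) *: bas y.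
pose w' := w - c *: bas (star d).
have w'd : co (star d) w' = 0 by rewrite /w' !coE eqxx mulr1 subrr.
have w'b : co b w' = 0 by rewrite /w' !coE wb Ey mulr0 subr0.
have hw' : vin cA w'.
  by apply: vinD => //; apply: vinN => //; apply: vinZ => //; apply: vin_bas.
have qU : qf U = 0 by rewrite /U !(qfE, bfE, coE, starK) !Ey /=; ring.
have qW : qf W = 0 by rewrite /W !(qfE, bfE, coE, starK) !Ey /=; ring.
have bUW : bf U W = 0.
  by rewrite /U /W !(bfE, coE, starK) !eqxx !Ey /=; ring.
have bWw' : bf W w' = 0.
  by rewrite /W bfDl !bfZl !bf_basl w'd starK w'b !mulr0 addr0.
have bWy : bf W (bas y) = 0 by rewrite /W !(bfE, coE, starK) !Ey /=; ring.
pose k := p * (tau^-1 * qf w).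
have ea : tau *: (bas b + tau^-1 *: w - (tau^-1 ^+ 2 * qf w) *: bas y) =
    U + w' - (tau^-1 * qf w) *: bas y.
  by rewrite /U /w'; apply/matrixP => i j; rewrite !mxE; field.
have eb : (tau * p) *: (bas d - (tau^-1 * c) *: bas y) = p *: W.
  by rewrite /W; apply/matrixP => i j; rewrite !mxE; field.
have iso_a : qf (tau *: (bas b + tau^-1 *: w - (tau^-1 ^+ 2 * qf w) *: bas y)) = 0.
  by rewrite -u_b qfZ iu qf_bas mulr0.
rewrite eb tr_swap //; last by rewrite qfZ qW mulr0.
rewrite trZ ea.
have -> : p *: - (U + w' - (tau^-1 * qf w) *: bas y) =
   (- p) *: U + ((- p) *: w' + k *: bas y).
  by rewrite /k; apply/matrixP => i j; rewrite !mxE; ring.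
have bWZ (e : F) : [/\ bf W (e *: U) = 0, bf W (e *: w') = 0 & bf W (e *: bas y) = 0].
  by rewrite !bfZr bWw' bWy (bfC W) bUW !mulr0.
have [b1 b2 _] := bWZ (- p); have [_ _ b3] := bWZ k.
rewrite -trD ?bfDr ?b2 ?b3 ?addr0 // -trD //.
have mq : P (qf w) by apply: cAP; apply: vin_qf.
have Pc : P c by apply: cAP.
have cAPw' i : P (co i w') by apply: cAP; apply: hw'.
have cAPz : P (cz w') by apply: cAP; apply: hw'.
have Ph : P 2^-1 by apply: cAP; apply: cA_half lr.
apply: EP_mul; [|apply: EP_mul].
- have -> : tr W (- p *: U) = tr W ((- 2 * (2^-1 * p) * 1) *: U).
    by apply: tr_coef; field; apply: two_neq0 iota _ _ lr.
  apply: EP_short_comm => //.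
  + by rewrite /U !czE !mulr0 addr0.
  + by rewrite /W !czE !mulr0 addr0.
  + apply: EP_tr2; rewrite ?coE ?czE ?starK ?mulr0 ?mulr1 ?Ey //.
    all: try (move=> i); rewrite ?coE ?mulr0 ?qfZ ?qf_ev ?mulr1; try exact: subrg0.
    all: do ?apply: subrgM => //; do ?apply: subrgX => //; do ?apply: subrgM => //.
  + apply: EP_tr2; rewrite ?coE ?czE ?starK ?mulr0 ?mulr1 ?Ey //.
    all: try (move=> i); rewrite ?coE ?mulr0 ?qfZ ?qf_ev ?mulr1 ?expr1n ?mul1r; try exact: subrg0.
    all: do ?apply: subrgM => //; do ?apply: oppP => //.
- apply: EP_tr2; rewrite ?starK ?coZ ?czZ ?w'd ?w'b ?mulr0 ?Ey //.
  all: try (move=> i); rewrite ?coZ ?qfZ.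
  all: do ?apply: subrgM => //; do ?apply: oppP => //; do ?apply: subrgX => //; do ?apply: oppP => //.
  by apply: cAP; apply: vin_qf.
(* With axis [bas y] the component of [W] along [bas y] drops out, and the coefficient [tau] of the
   remaining one cancels the denominator of [k]. *)
have -> : tr W (k *: bas y) = tr (bas y) ((- (p * qf w)) *: bas d).
  rewrite tr_swap ?qfZ ?qf_bas ?mulr0 // trZ scalerN -scaleNr /W scalerDr !scalerA.
  rewrite tr_self ?qf_bas ?long_orth ?starK //.
  by apply: tr_coef; rewrite /k; field.
by apply/EP_egen/egen_long; rewrite ?starK //; apply: oppP; apply: subrgM.
Qed.

Lemma core_long d d' p : d' != d -> d' != star d -> P p ->
  EP P (cj u (cj (sg b) (tr (bas d) ((tau * p) *: bas d')))).
Proof.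
move=> ne ne' hp; have E := idx_neq ne ne'.
have sw (c : F) : tr (bas d) (c *: bas d') = tr (bas d') (- c *: bas d).
  by rewrite tr_swap ?qfZ ?qf_bas ?mulr0 // trZ scalerN scaleNr.
have [e|dy] := eqVneq d y.
  by rewrite e; apply: core_y => //; [move: ne'; rewrite e starK|rewrite -e].
have [e|dy'] := eqVneq d' y.
  rewrite sw e -mulrN; apply: core_y => //; last exact: oppP.
  by rewrite -[b]starK -e E.
have [e|db] := eqVneq d b.
  by rewrite e; apply: core_b => //; rewrite -e.
have [e|db'] := eqVneq d' b; last exact: core_W.
by rewrite sw e -mulrN; apply: core_b => //; apply: oppP.
Qed.

End LongCore.

(** As [A] is local, [h] factors as [g *m invmx u *m w]: the Weyl element [w] brings a unit
    coordinate of [invmx h *m bas b] to position [b], [u] lies in the unipotent radical along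
    [star b], and [g] stabilizes the line of [bas b]. Then [w] permutes long root elements up to
    sign, [invmx u] is the case of [core_long] and [g] that of [sg_parabolic]. *)
Lemma sg_conj_long b h d d' p : EP cA h -> d' != d -> d' != star d -> P p ->
  EP P (cj (sg b) (cj h (tr (bas d) ((tau * p) *: bas d')))).
Proof.
move=> hh ne ne' hp; have uh := EP_unit hh; have ih := EP_isom hh.
have hhi : EP cA (invmx h) by apply: EP_inv.
have uhi := EP_unit hhi; have ihi := EP_isom hhi.
pose nu := invmx h *m bas b; pose nu' := invmx h *m bas (star b).
have hnu : vin cA nu by apply: EP_vin => //; apply: vin_bas.
have hnu' : vin cA nu' by apply: EP_vin => //; apply: vin_bas.
have qnu : qf nu = 0 by rewrite /nu ihi qf_bas.
have bnu : bf nu nu' = 1 by rewrite isom_bf // bf_basl coE eqxx.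
have [b' [c'A c0]] := iso_pivot lr hnu hnu' qnu bnu.
have [w [hw mw wb ws]] := weyl (R := F) n_ge2 scA b' b.
have uw := EP_unit hw; have iw := EP_isom hw.
set c := co b' nu in c'A c0.
pose x := c^-1 *: (w *m nu).
have hx : vin cA x by apply: vinZ => //; apply: EP_vin.
have xb : co b x = 1.
  rewrite coZ -[b in co b]starK -bf_basl -ws isom_bf // bf_basl starK -/c.
  by rewrite mulVf.
have qx : qf x = 0 by rewrite qfZ iw qnu mulr0.
have wnu : w *m nu = c *: x by rewrite scalerA mulfV // scale1r.
clearbody x.
pose om := x - bas b - co (star b) x *: bas (star b).
have omb : co b om = 0.
  by rewrite !coE eqxx (eq_sym b) (negPf (star_neq b)) xb mulr0 subr0 subrr.
have oms : co (star b) om = 0.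
  by rewrite !coE eqxx (negPf (star_neq b)) subr0 mulr1 subrr.
have hom : vin cA om.
  apply: vinD => //; [apply: vinD => //|]; apply: vinN => //; first exact: vin_bas.
  by apply: vinZ => //; [apply: hx|apply: vin_bas].
have qom : qf om = - co (star b) x.
  apply/eqP; rewrite -addr_eq0 addrC; apply/eqP; rewrite -qx (qf_split b x) xb mul1r.
  by rewrite scale1r.
pose u := tr (bas (star b)) om.
have hu : EP cA u by apply: EP_tr_vin; rewrite ?starK.
have uu := EP_unit hu.
have ub : u *m bas b = x.
  rewrite trE bf_basl starK coE eqxx scale1r bf_basr oms scale0r subr0 mulr1 qom.
  by rewrite /om; apply/matrixP => i j; rewrite !mxE; ring.
pose g := h *m invmx w *m u.
have hg : EP cA g.
  by apply: EP_mul => //; apply: EP_mul => //; apply: EP_inv.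
have gb : g *m bas b = c^-1 *: bas b.
  rewrite -!mulmxA ub -[x]scale1r -(mulVf c0) -scalerA -wnu -!scalemxAr mulKmx //.
  by rewrite /nu mulKVmx.
have ug := EP_unit hg.
have hui : EP cA (invmx u) by apply: EP_inv.
have eh : h = g *m (invmx u *m w) by rewrite /g -!mulmxA mulKVmx // mulVmx // mulmx1.
have uui := EP_unit hui.
clearbody g; rewrite {1}eh cj_mul ?unitmx_mul ?uui // cj_cj //; apply: cj_EP => //.
  by apply: sg_parabolic gb; rewrite ?invr_eq0.
rewrite cj_mul // cj_cj //.
have [d1 [d1' [e [ne1 ne1' ->]]]] := mono_long (tau * p) iw uw mw ne ne'.
have -> : cj (sg b) (invmx u) = tr (bas (star b)) (tau^-1 *: - om).
  rewrite /u invmx_tr ?qf_bas ?bf_basl ?starK // cj_tr // sg_star // sg_fix ?coN ?omb ?oms ?oppr0 //.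
  by rewrite trZ.
rewrite mulrCA; apply: core_long => //; rewrite ?coN ?omb ?oms ?oppr0 //.
  exact: vinN.
by apply: subrgM => //; apply: subrgX => //; apply: oppP; apply: subrg1.
Qed.

(** In [short_from_long] the second parameter is taken to be 1, so the short conjugation it
    introduces is constant and merges with [h]. *)
Lemma sg_conj_gen b h t : EP cA h -> egen (fun q => exists2 p, P p & q = tau * p) t ->
  EP P (cj (sg b) (cj h t)).
Proof.
move=> hh [d d' _ [p hp ->] ne ne'|d _ [p hp ->]]; first exact: sg_conj_long.
have [b1 n1 n2] := third_idx n_ge2 d; have E := idx_neq n1 n2.
have uh := EP_unit hh.
have hs : EP cA (tr (bas (star b1)) (1 *: ev n F)).
  by apply/EP_egen/egen_short; apply: subrg1.
rewrite -[tau * p]mulr1 (short_from_long _ _ n1 n2).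
rewrite 2!(cjM _ _ uh) 2!(cjM _ _ (usg b)).
rewrite -[cj h (cj _ _)]cj_mul ?(EP_unit hs) // -mulrN -mulrA.
apply: EP_mul; [apply: EP_mul|]; apply: sg_conj_long => //; rewrite ?E //.
- exact: oppP.
- exact: EP_mul.
by rewrite expr1n mulr1.
Qed.

(** The quotient of [g0] at [tau] by [g0] at 0 is a product of generators with parameters divisible
    by [tau], conjugated by constant matrices. The divisibility pays for the denominator due to
    [sg b]; the matrix [h] collects the constant terms of the factors already treated. *)
Lemma sg_conj_poly b h (g0 : 'M[{poly K}]_(n + n + 1)) : EP cA h -> EP (pA A) g0 ->
  EP P (cj (sg b) (cj h (map_mx (hev iota tau) g0 *m invmx (map_mx (hev iota 0) g0)))).
Proof.
move=> hh hg0; elim: hg0 h hh => [|t g ht hg IH] h hh.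
  have uh := EP_unit hh.
  by rewrite !map_mx1 invmx1 mulmx1 cj1 // cj1 //; apply: EP1.
have uh := EP_unit hh.
rewrite !map_mxM; set t1 := map_mx (hev iota tau) t; set g1 := map_mx (hev iota tau) g.
set t0 := map_mx (hev iota 0) t; set g00 := map_mx (hev iota 0) g.
have ev0 p : pA A p -> cA (hev iota 0 p) by move=> hp; rewrite hev0; exists p`_0.
have ht0 : egen cA t0 by apply: egen_map ht.
have hg0 : EP cA g00 by apply: EP_map hg.
have ut0 := egen_unit ht0; have ug0 := EP_unit hg0.
rewrite invmx_mul //.
have -> : t1 *m g1 *m (invmx g00 *m invmx t0) =
  (t1 *m invmx t0) *m cj t0 (g1 *m invmx g00).
  by rewrite /cj !mulmxA mulmxKV.
rewrite (cjM _ _ uh) (cjM _ _ (usg b)) -[cj h (cj _ _)]cj_mul //.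
apply: EP_mul; last by apply: IH; apply: EP_mul => //; apply: EP_egen.
apply: sg_conj_gen => //.
have diff p : pA A p -> exists2 q, P q & hev iota tau p - hev iota 0 p = tau * q.
  move=> hp; exists (hev iota tau (drop_poly 1 p)).
    by exists (drop_poly 1 p) => // i; rewrite coef_drop_poly.
  rewrite -{1}(poly_take_drop 1 p) rmorphD rmorphM expr1 hevX [_ * tau]mulrC.
  rewrite (_ : take_poly 1 p = (p`_0)%:P) ?hevC ?hev0; first by rewrite addrC addKr.
  by apply/polyP => -[|i]; rewrite coef_take_poly coefC.
have trsub (v w : 'cV[F]_(n + n + 1)) (c c' : F) : qf v = 0 -> bf v w = 0 ->
    tr v (c *: w) *m invmx (tr v (c' *: w)) = tr v ((c - c') *: w).
  move=> qv bv; rewrite invmx_tr ?trD ?bfNr ?bfZr ?bv ?mulr0 ?oppr0 //.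
  by rewrite -scaleNr scalerDl.
rewrite /t1 /t0; case: ht => [d d' p hp ne ne'|d p hp]; rewrite !map_tr !map_mxZ !map_bas ?map_ev.
  rewrite trsub ?qf_bas //; last by rewrite bf_basl coE eq_sym (negPf ne').
  by apply: egen_long => //; apply: diff.
rewrite trsub ?qf_bas //; last by rewrite bf_basl coE.
by apply: egen_short; apply: diff.
Qed.

End CocharacterConjugation.

(** * Birkhoff decomposition over a local ring *)

Section Laurent.
Variables (n : nat) (K F : fieldType) (iota : {rmorphism K -> F}) (A m : K -> Prop).
Hypotheses (n_ge2 : (2 <= n)%N) (lr : locring A m).
Variables (T : F).
Hypothesis T0 : T != 0.

Local Notation cA := (cst iota A).
Local Notation cm := (cst iota m).
Local Notation Pp := (Pol iota A T).
Local Notation Pm := (Pol iota A T^-1).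
Local Notation LR := (loc Pp T).
Local Notation Lm := (loc (Pol iota m T) T).
Local Notation sg := (@sg n F T).
Local Notation tt := (@tt n F T).

Let sA := lr_sub lr.
Let scA : subrg cA := cst_subrg iota sA.
Let sPp : subrg Pp := Pol_subrg iota T sA.
Let sPm : subrg Pm := Pol_subrg iota T^-1 sA.
Let Tp : Pp T. Proof. exact: Pol_tau. Qed.
Let sLR : subrg LR := loc_subrg sPp Tp.
Let opA : oppc cA. Proof. by move=> p; apply: subrgN. Qed.
Let opp' : oppc Pp. Proof. by move=> p; apply: subrgN. Qed.
Let opm' : oppc Pm. Proof. by move=> p; apply: subrgN. Qed.
Let T0' : T^-1 != 0. Proof. by rewrite invr_eq0. Qed.

Lemma Pol_mono tau (B C : K -> Prop) x : (forall a, B a -> C a) ->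
  Pol iota B tau x -> Pol iota C tau x.
Proof. by move=> h [p hp ->]; exists p => // i; apply: h. Qed.

Lemma Pol_idealD tau x y : Pol iota m tau x -> Pol iota m tau y -> Pol iota m tau (x + y).
Proof.
move=> [p hp ->] [q hq ->]; exists (p + q); last by rewrite rmorphD.
by move=> i; rewrite coefD; apply: lr_mD lr _ _ _ _.
Qed.

Lemma m_sum (I : Type) (r : seq I) (Q : pred I) (f : I -> K) :
  (forall i, Q i -> m (f i)) -> m (\sum_(i <- r | Q i) f i).
Proof.
by move=> h; apply: big_ind => //; [apply: lr_m0 lr|move=> x y; apply: lr_mD lr x y].
Qed.

Lemma Pol_idealM tau x y : Pol iota A tau x -> Pol iota m tau y -> Pol iota m tau (x * y).
Proof.
move=> [p hp ->] [q hq ->]; exists (p * q); last by rewrite rmorphM.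
by move=> i; rewrite coefM; apply: m_sum => j _; apply: lr_mM lr _ _ _ _.
Qed.

Lemma LmD x y : Lm x -> Lm y -> Lm (x + y).
Proof.
move=> [k hk] [l hl]; exists (k + l)%N; rewrite /lk mulrDr exprD; apply: Pol_idealD.
  rewrite mulrAC mulrC; apply: Pol_idealM => //; exact: subrgX.
by rewrite -mulrA; apply: Pol_idealM => //; exact: subrgX.
Qed.

Lemma LmM x y : LR x -> Lm y -> Lm (x * y).
Proof.
move=> [k hk] [l hl]; exists (k + l)%N; rewrite /lk exprD mulrACA.
exact: Pol_idealM.
Qed.

Lemma Lm0 : Lm 0.
Proof.
exists 0%N; rewrite /lk mulr0; exists 0; rewrite ?rmorph0 // => i; rewrite coef0.
exact: lr_m0 lr.
Qed.

Lemma LmN x : Lm x -> Lm (- x).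
Proof. by rewrite -mulN1r; apply: LmM; apply: subrgN => //; apply: subrg1. Qed.

Lemma LmLR x : Lm x -> LR x.
Proof. by move=> [k hk]; exists k; apply: Pol_mono hk => a; apply: lr_mA lr a. Qed.

Lemma Lm_sum (I : Type) (r : seq I) (Q : pred I) (f : I -> F) :
  (forall i, Q i -> Lm (f i)) -> Lm (\sum_(i <- r | Q i) f i).
Proof. by move=> h; apply: big_ind => //; [apply: Lm0|apply: LmD]. Qed.

Lemma cA_Pp x : cA x -> Pp x. Proof. exact: cst_Pol. Qed.
Lemma cA_Pm x : cA x -> Pm x. Proof. exact: cst_Pol. Qed.
Lemma Pp_LR x : Pp x -> LR x. Proof. exact: loc_P. Qed.

Lemma TV_LR : LR T^-1.
Proof. by exists 1%N; rewrite /lk expr1 mulfV //; apply: subrg1. Qed.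

Lemma hev_in (P : F -> Prop) (B : K -> Prop) tau p : subrg P -> (forall a, B a -> P (iota a)) ->
  P tau -> pA B p -> P (hev iota tau p).
Proof.
move=> sP hB ht hp; rewrite hevE horner_coef; apply: subrg_sum => // i _.
by apply: subrgM => //; [rewrite coef_map; apply: hB|apply: subrgX].
Qed.

Lemma Pm_LR x : Pm x -> LR x.
Proof.
move=> [p hp ->]; apply: (@hev_in LR A) => //; last exact: TV_LR.
by move=> a ha; apply: Pp_LR; apply: cA_Pp; exists a.
Qed.

Lemma TzLR (z : int) : LR (T ^ z).
Proof.
case: z => k; first by rewrite -exprnP; apply: subrgX => //; apply: Pp_LR.
by rewrite NegzE -exprnN -exprVn; apply: subrgX => //; apply: TV_LR.
Qed.

Lemma Tz_Pm (z : int) : z <= 0 -> Pm (T ^ z).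
Proof.
case: z => k; first by case: k => // _; rewrite expr0z; apply: subrg1.
by move=> _; rewrite NegzE -exprnN -exprVn; apply: subrgX => //; apply: Pol_tau.
Qed.

Lemma cm_Lm x : cm x -> Lm x.
Proof.
move=> [a ha ->]; exists 0%N; rewrite /lk mul1r; exists a%:P; last by rewrite hevC.
by apply: pA_C => //; apply: lr_m0 lr.
Qed.

Lemma Polm_Lm x : Pol iota m T^-1 x -> Lm x.
Proof.
move=> [p hp ->]; rewrite hevE horner_coef; apply: Lm_sum => i _.
rewrite mulrC coef_map; apply: LmM; first by apply: subrgX => //; apply: TV_LR.
by apply: cm_Lm; exists p`_i.
Qed.

Definition lmon (B : K -> Prop) x := exists a (z : int), B a /\ x = iota a * T ^ z.

Lemma egen_lmon (B : K -> Prop) (t : 'M[F]_(n + n + 1)) :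
  egen (loc (Pol iota B T) T) t -> EP (lmon B) t.
Proof.
have key v w q : loc (Pol iota B T) T q -> qf v = 0 -> bf v w = 0 ->
    (forall x, lmon B x -> EP (lmon B) (tr v (x *: w))) -> EP (lmon B) (tr v (q *: w)).
  move=> [k [p hp e]] qv bv hx.
  have -> : q = \sum_(i < size p) iota p`_i * T ^ (i%:Z - k%:Z).
    have -> : q = T ^- k * hev iota T p by rewrite -e mulKf // expf_neq0.
    rewrite hevE horner_coef size_map_poly mulr_sumr; apply: eq_bigr => i _.
    by rewrite coef_map expfzDr // -exprnP -exprnN mulrCA (mulrC (T ^- k)).
  elim/big_rec: _ => [|i x _ IH]; first by rewrite scale0r tr0; apply: EP1.
  rewrite scalerDl -trD ?bfZr ?bv ?mulr0 //; apply: EP_mul => //; apply: hx.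
  by exists p`_i, (i%:Z - k%:Z).
move=> [b b' q hq ne ne'|b q hq]; apply: key; rewrite ?qf_bas //.
- by rewrite -[bas b']scale1r long_orth.
- by move=> x hx; apply/EP_egen/egen_long.
- by rewrite -[ev n F]scale1r short_orth.
- by move=> x hx; apply/EP_egen/egen_short.
Qed.

(* Congruence to the identity modulo the ideal generated by [m]. *)
Definition cg (g : 'M[F]_(n + n + 1)) := mxin Lm (g - 1%:M).

Lemma mxLmD (g h : 'M[F]_(n + n + 1)) : mxin Lm g -> mxin Lm h -> mxin Lm (g + h).
Proof. by move=> hg hh i j; rewrite mxE; apply: LmD. Qed.
Lemma mxLm_mull (g h : 'M[F]_(n + n + 1)) : mxin LR g -> mxin Lm h -> mxin Lm (g *m h).
Proof. by move=> hg hh i j; rewrite mxE; apply: Lm_sum => k _; apply: LmM. Qed.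
Lemma mxLm_mulr (g h : 'M[F]_(n + n + 1)) : mxin Lm g -> mxin LR h -> mxin Lm (g *m h).
Proof. by move=> hg hh i j; rewrite mxE; apply: Lm_sum => k _; rewrite mulrC; apply: LmM. Qed.

Lemma cg1 : cg 1%:M.
Proof. by move=> i j; rewrite subrr mxE; apply: Lm0. Qed.

Lemma cg_mul g h : cg g -> mxin LR h -> cg h -> cg (g *m h).
Proof.
move=> hg hh hh'; rewrite /cg (_ : _ - _ = (g - 1%:M) *m h + (h - 1%:M)).
  by apply: mxLmD => //; apply: mxLm_mulr.
by rewrite mulmxBl mul1mx addrA subrK.
Qed.

Lemma cg_cj g h : h \in unitmx -> mxin LR h -> mxin LR (invmx h) -> cg g -> cg (cj h g).
Proof.
move=> uh hh hh' hg; rewrite /cg (_ : _ - _ = h *m (g - 1%:M) *m invmx h).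
  by apply: mxLm_mulr => //; apply: mxLm_mull.
by rewrite /cj mulmxBr mulmx1 mulmxBl mulmxV.
Qed.

Lemma cg_vin g v : cg g -> vin LR v -> vin Lm (g *m v - v).
Proof.
move=> hg hv i; rewrite -[X in _ - X]mul1mx -mulmxBl mxE; apply: Lm_sum => k _.
by rewrite mulrC; apply: LmM.
Qed.

Lemma egen_cg t : egen Lm t -> cg t.
Proof.
have hcol (g : 'M[F]_(n + n + 1)) : (forall v, vin LR v -> vin Lm (g *m v - v)) -> cg g.
  move=> h i j; have := h (delta_mx j 0) _ i.
  rewrite -[X in _ - X]mul1mx -mulmxBl -colE [col _ _ _ _]mxE; apply=> k.
  by rewrite mxE; apply: subrg_nat.
have key b w p : Lm p -> vin LR w -> cg (tr (bas b) (p *: w)).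
  move=> hp hw; apply: hcol => v hv.
  have hb : vin LR (bas b : 'cV[F]_(n + n + 1)) by apply: vin_bas.
  have -> : tr (bas b) (p *: w) *m v - v =
      p *: (bf (bas b) v *: w - bf w v *: bas b - (p * qf w * bf (bas b) v) *: bas b).
    by rewrite trE qfZ bfZl; apply/matrixP => i j; rewrite !mxE; ring.
  move=> i; rewrite mxE mulrC; apply: LmM => //.
  have hbv := vin_bf sLR hb hv; have hwv := vin_bf sLR hw hv; have hq := vin_qf sLR hw.
  apply: vinD => //; [apply: vinD => //; [exact: vinZ|]|]; apply: vinN => //; apply: vinZ => //.
  by do ?apply: subrgM => //; apply: LmLR.
by move=> [b b' p hp _ _|b p hp]; apply: key => //; [apply: vin_bas|apply: vin_ev].
Qed.

(* E(A) extended by the cocharacters; it contains E(A[T, 1/T]) by [EP_LR_Et]. *)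
Inductive Et : 'M[F]_(n + n + 1) -> Prop :=
| Et1 : Et 1%:M
| Et_gen t g of egen cA t & Et g : Et (t *m g)
| Et_sg b g of Et g : Et (sg b *m g).

Let usg b : sg b \in unitmx. Proof. exact: tt_unit. Qed.
Let isg b : isom (sg b). Proof. exact: tt_isom. Qed.

Lemma Et_mul g h : Et g -> Et h -> Et (g *m h).
Proof.
move=> hg hh; elim: hg => [|t g' ht _ IH|b g' _ IH]; first by rewrite mul1mx.
  by rewrite -mulmxA; apply: Et_gen.
by rewrite -mulmxA; apply: Et_sg.
Qed.

Lemma Et_EP g : EP cA g -> Et g.
Proof. by elim=> [|t g' ht _ IH]; [apply: Et1|apply: Et_gen]. Qed.

Lemma Et_sg1 b : Et (sg b).
Proof. by rewrite -(mulmx1 (sg b)); apply: Et_sg; apply: Et1. Qed.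

Lemma Et_unit g : Et g -> g \in unitmx.
Proof.
elim=> [|t g' ht _ IH|b g' _ IH]; first exact: unitmx1.
  by rewrite unitmx_mul (egen_unit ht).
by rewrite unitmx_mul usg.
Qed.

Lemma Et_inv g : Et g -> Et (invmx g).
Proof.
elim=> [|t g' ht hg IH|b g' hg IH]; first by rewrite invmx1; apply: Et1.
  rewrite invmx_mul ?(egen_unit ht) ?(Et_unit hg) //; apply: Et_mul => //.
  by apply: Et_EP; apply: EP_inv => //; apply: EP_egen.
rewrite invmx_mul ?(Et_unit hg) //; apply: Et_mul => //; rewrite sg_inv //.
exact: Et_sg1.
Qed.

Lemma tt_mxin w : mxin LR (tt w).
Proof.
apply: mxin_cols => // v hv; apply: vinP => [b|].
  by rewrite tt_co; apply: subrgM => //; [apply: TzLR|apply: hv].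
by rewrite tt_cz; apply: hv.
Qed.

Lemma Et_mxin g : Et g -> mxin LR g.
Proof.
elim=> [i j|t g' ht _ IH|b g' _ IH].
- by rewrite mxE; apply: subrg_nat.
- apply: mxin_mul => //; apply: egen_mxin => //; apply: egen_mono ht => p hp.
  by apply: Pp_LR; apply: cA_Pp.
by apply: mxin_mul => //; apply: tt_mxin.
Qed.

Lemma Et_ttz z b : Et (tt (fun i => z * sgw b i)).
Proof.
have pos (k : nat) b' : Et (tt (fun i => k%:Z * sgw b' i)).
  elim: k => [|k IH].
    rewrite (_ : (fun i => _) = fun=> 0) ?tt0; first exact: Et1.
    by apply/funext => i; rewrite mul0r.
  rewrite (_ : (fun i => _) = fun i => sgw b' i + k%:Z * sgw b' i); last first.
    by apply/funext => i; rewrite -[k.+1]addn1 PoszD mulrDl mul1r addrC.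
  by rewrite -tt_mul //; apply: Et_sg.
case: z => k; first exact: pos.
rewrite (_ : (fun i => _) = fun i => k.+1%:Z * sgw (star b) i); first exact: pos.
apply/funext => i; rewrite NegzE mulNr -mulrN /sgw /star /=.
by case: eqP => _; rewrite ?oppr0 //; case: b.1; rewrite ?opprK.
Qed.

(** Under [sgw b] the axis has weight 1 and the other vector weight 0, so a power of [T] in the
    parameter is a conjugation by that power of [sg b]. *)
Lemma egen_lmon_cj (B : K -> Prop) t : egen (lmon B) t ->
  exists b z t', egen (cst iota B) t' /\ t = cj (tt (fun i => z * sgw b i)) t'.
Proof.
have wz z b b' : wq (fun i => z * sgw b i) b' = z * ((b' == b)%:Z - (b' == star b)%:Z).
  by rewrite -wq_sgw /wq; case: b'.1; rewrite ?mulrN.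
have sbb b : (b == star b) = false by rewrite eq_sym (negPf (star_neq b)).
case=> [b b' _ [a [z [ha ->]]] ne ne'|b _ [a [z [ha ->]]]].
  exists b, z, (tr (bas b) (iota a *: bas b')); split.
    by apply: egen_long => //; exists a.
  rewrite cj_tr ?tt_isom ?tt_unit //; last exact: tt_isom.
  rewrite -scalemxAr !tt_bas !wz eqxx sbb (negPf ne) (negPf ne') subrr mulr0 expr0z scale1r.
  by rewrite subr0 mulr1 trZ scalerA mulrC.
exists b, z, (tr (bas b) (iota a *: ev n F)); split.
  by apply: egen_short => //; exists a.
rewrite cj_tr ?tt_isom ?tt_unit //; last exact: tt_isom.
by rewrite -scalemxAr tt_ev tt_bas wz eqxx sbb subr0 mulr1 trZ scalerA mulrC.
Qed.

Lemma EP_LR_Et g : EP LR g -> Et g.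
Proof.
elim=> [|t g' ht _ IH]; first exact: Et1.
apply: Et_mul => //; elim: (egen_lmon ht) => [|t1 g1 ht1 _ IH1]; first exact: Et1.
apply: Et_mul => //; have [b [z [t' [ht' ->]]]] := egen_lmon_cj ht1.
rewrite /cj; apply: Et_mul; last by apply: Et_inv; apply: Et_ttz.
by apply: Et_mul; [apply: Et_ttz|apply: Et_EP; apply: EP_egen].
Qed.

(* The normal closure in [Et] of the generators with parameters in [m]. *)
Inductive Nn : 'M[F]_(n + n + 1) -> Prop :=
| Nn1 : Nn 1%:M
| Nn_cons h t g of Et h & egen cm t & Nn g : Nn (cj h t *m g).

Lemma Nn_mul g h : Nn g -> Nn h -> Nn (g *m h).
Proof.
move=> hg hh; elim: hg => [|x t g' hx ht _ IH]; first by rewrite mul1mx.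
by rewrite -mulmxA; apply: Nn_cons.
Qed.

Lemma Nn_gen h t : Et h -> egen cm t -> Nn (cj h t).
Proof. by move=> hh ht; rewrite -[cj h t]mulmx1; apply: Nn_cons => //; apply: Nn1. Qed.

Lemma Nn_cj h g : Et h -> Nn g -> Nn (cj h g).
Proof.
move=> hh; have uh := Et_unit hh; elim=> [|x t g' hx ht _ IH].
  by rewrite cj1 //; apply: Nn1.
rewrite cjM // -cj_mul ?(Et_unit hx) //; apply: Nn_cons => //; exact: Et_mul.
Qed.

Lemma Nn_unit g : Nn g -> g \in unitmx.
Proof.
elim=> [|h t g' hh ht _ IH]; first exact: unitmx1.
by rewrite /cj !unitmx_mul unitmx_inv (Et_unit hh) (egen_unit ht).
Qed.

Lemma Nn_EPm g : EP Lm g -> Nn g.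
Proof.
elim=> [|t g' ht _ IH]; first exact: Nn1.
apply: Nn_mul => //; elim: (egen_lmon ht) => [|t1 g1 ht1 _ IH1]; first exact: Nn1.
apply: Nn_mul => //; have [b [z [t' [ht' ->]]]] := egen_lmon_cj ht1.
by apply: Nn_gen => //; apply: Et_ttz.
Qed.

Lemma Nn_mxin g : Nn g -> mxin LR g.
Proof.
elim=> [i j|h t g' hh ht _ IH]; first by rewrite mxE; apply: subrg_nat.
apply: mxin_mul => //; apply: mxin_mul => //; last by apply: Et_mxin; apply: Et_inv.
apply: mxin_mul => //; first exact: Et_mxin.
by apply: egen_mxin => //; apply: egen_mono ht => p hp; apply: LmLR; apply: cm_Lm.
Qed.

Lemma Nn_cg g : Nn g -> cg g.
Proof.
elim=> [|h t g' hh ht hg IH]; first exact: cg1.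
apply: cg_mul => //; last exact: Nn_mxin.
apply: cg_cj; [exact: Et_unit|exact: Et_mxin|by apply: Et_mxin; apply: Et_inv|].
by apply: egen_cg; apply: egen_mono ht => p; apply: cm_Lm.
Qed.

Lemma Nn_Et g : Nn g -> Et g.
Proof.
elim=> [|h t g' hh ht _ IH]; first exact: Et1.
apply: Et_mul => //; apply: Et_mul; last exact: Et_inv.
apply: Et_mul => //; apply: Et_EP; apply: EP_egen; apply: egen_mono ht => p.
exact: (cm_cA lr).
Qed.

Lemma Et_isom g : Et g -> isom g.
Proof.
elim=> [|t g' ht _ IH|b g' _ IH]; first exact: isom1.
  by apply: isomM => //; apply: egen_isom ht.
exact: isomM.
Qed.

(** The pivot is a unit coordinate of least weight. Coordinates of smaller weight then lie in [m]
    and are cleared by [mu]; those of at least that weight are cleared by [be], which conjugation by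
    [invmx (tt w)] turns into a matrix over [A[1/T]], since only non-positive powers of [T]
    appear. *)
Lemma pivot_weight w nu nu' : vin cA nu -> vin cA nu' -> qf nu = 0 -> bf nu nu' = 1 ->
  exists b c be mu, [/\ [/\ cA c, c != 0 & cA c^-1], EP cA be, EP cm mu,
    EP Pm (cj (invmx (tt w)) be) & mu *m be *m nu = c *: bas b].
Proof.
move=> hnu hnu' qnu bnu; have [b0 ub0] := iso_pivot lr hnu hnu' qnu bnu.
pose Q b := `[< cA (co b nu)^-1 /\ co b nu != 0 >].
have Qb0 : Q b0 by apply/asboolP.
case: (@arg_minP _ _ _ b0 Q (wq w) Qb0) => b /asboolP[c'A c0] bmin.
have hsmall d : wq w d < wq w b -> cm (co d nu).
  move=> lt; case: (cA_cases lr (hnu (pos d))) => // h.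
  have Qd : Q d by apply/asboolP.
  by have := bmin d Qd; rewrite leNgt lt.
set c := co b nu in c'A c0.
have hc : cA c by apply: hnu.
pose x := c^-1 *: nu.
have hx : vin cA x by apply: vinZ.
have xb : co b x = 1 by rewrite coZ mulVf.
have qx : qf x = 0 by rewrite qfZ qnu mulr0.
have xsmall d : wq w d < wq w b -> cm (co d x).
  by move=> lt; rewrite coZ; apply: (cmM lr) => //; apply: hsmall.
(* The last coordinate has weight 0. Of [x_i] and [y_i] one has weight at most 0, below the pivot,
   so every product in the form is in [m], and so is the square of the last coordinate. *)
have xz : 0 < wq w b -> cm (cz x).
  move=> lt; apply: (cm_sqr lr); first exact: hx.
  rewrite -[_ ^+ 2]opprK -[- _ ^+ 2]add0r -{1}qx /qf addrK; apply: (cmN lr) => //.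
  apply: (cm_sum lr) => // i _.
  have [le|gt] := leP (w i) 0.
    rewrite mulrC; apply: (cmM lr); first exact: (hx (yc i)).
    by apply: (xsmall (true, i)); apply: le_lt_trans lt.
  apply: (cmM lr); first exact: (hx (xc i)).
  by apply: (xsmall (false, i)); apply: lt_trans lt; rewrite /wq /= oppr_lt0.
have nux : nu = c *: x by rewrite scalerA mulfV // scale1r.
clearbody x.
pose om := x - bas b - co (star b) x *: bas (star b).
have omb : co b om = 0.
  by rewrite !coE eqxx (eq_sym b) (negPf (star_neq b)) xb mulr0 subr0 subrr.
have oms : co (star b) om = 0.
  by rewrite !coE eqxx (negPf (star_neq b)) subr0 mulr1 subrr.
have omd d : d != b -> d != star b -> co d om = co d x.
  by move=> /negPf n1 /negPf n2; rewrite !coE n1 n2 mulr0 !subr0.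
have omz : cz om = cz x by rewrite !czE mulr0 !subr0.
have hom : vin cA om.
  apply: vinD => //; [apply: vinD => //|]; apply: vinN => //; first exact: vin_bas.
  by apply: vinZ => //; [apply: hx|apply: vin_bas].
have qom : qf om = - co (star b) x.
  apply/eqP; rewrite -addr_eq0 addrC; apply/eqP; rewrite -qx (qf_split b x) xb mul1r.
  by rewrite scale1r.
have omx : tr (bas (star b)) (- om) *m x = bas b.
  rewrite trE !(bfNl, bfNr) bf_basl starK xb scale1r scaleNr opprK qfN mulr1 qom.
  have -> : bf om x = 2 * qf om + bf om (x - om).
    by rewrite -bf_diag -bfDr addrC subrK.
  have -> : bf om (x - om) = 0.
    rewrite (_ : x - om = bas b + co (star b) x *: bas (star b)).
      by rewrite bfDr bfZr !bf_basr starK oms omb mulr0 addr0.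
    by rewrite /om; apply/matrixP => i j; rewrite !mxE; ring.
  rewrite qom /om; apply/matrixP => i j; rewrite !mxE; ring.
clearbody om.
pose sel d := wq w b <= wq w d.
pose o1 := \sum_(d | sel d) (- co d om) *: bas d + (if wq w b <= 0 then - cz om else 0) *: ev n F.
pose o2 := \sum_(d | ~~ sel d) (- co d om) *: bas d + (if wq w b <= 0 then 0 else - cz om) *: ev n F.
have c1 d : co d o1 = if sel d then - co d om else 0.
  by rewrite coD coZ co_ev mulr0 addr0 co_comb.
have c2 d : co d o2 = if sel d then 0 else - co d om.
  by rewrite coD coZ co_ev mulr0 addr0 co_comb; case: (sel d).
have z1 : cz o1 = if wq w b <= 0 then - cz om else 0.
  by rewrite czD cz_comb czZ cz_ev mulr1 add0r.
have z2 : cz o2 = if wq w b <= 0 then 0 else - cz om.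
  by rewrite czD cz_comb czZ cz_ev mulr1 add0r.
have e12 : o2 + o1 = - om.
  apply: colext => [d|].
    by rewrite coD c1 c2 coN; case: (sel d); rewrite ?add0r ?addr0.
  by rewrite czD z1 z2 czN; case: ifP; rewrite ?add0r ?addr0.
clearbody o1 o2.
have h1 : vin cA o1.
  apply: vinP => [d|].
    by rewrite c1; case: ifP => _; [apply: opA; apply: hom|apply: subrg0].
  by rewrite z1; case: ifP => _; [apply: opA; apply: hom|apply: subrg0].
have b1 : co b o1 = 0 by rewrite c1 omb oppr0 if_same.
have b2 : co b o2 = 0 by rewrite c2 omb oppr0 if_same.
exists b, c, (tr (bas (star b)) o1), (tr (bas (star b)) o2); split=> //.
- by apply: EP_tr_vin; rewrite ?starK.
- apply: EP_tr => [d||]; last by rewrite starK.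
    rewrite c2; case: ifP => nsel; first exact: (cm0 _ lr).
    apply: (cmN lr) => //; have [->|n1] := eqVneq d b; first by rewrite omb; apply: (cm0 _ lr).
    have [->|n2] := eqVneq d (star b); first by rewrite oms; apply: (cm0 _ lr).
    by rewrite omd //; apply: xsmall; rewrite ltNge; apply/negbT.
  rewrite z2; case: leP => h; first exact: (cm0 _ lr).
  by apply: (cmN lr) => //; rewrite omz; apply: xz.
- rewrite tt_inv // cj_tr; [|exact: tt_isom|exact: tt_unit].
  have wqN d : wq (fun i => - w i) d = - wq w d by rewrite /wq; case: d.1.
  rewrite tt_bas wqN wq_star opprK trZ.
  apply: EP_tr_vin; last by rewrite coZ tt_co starK b1 !mulr0.
  apply: vinP => [d|]; rewrite ?coZ ?czZ ?tt_co ?tt_cz ?wqN.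
    rewrite mulrA -expfzDr // c1; case: ifP => hsel; last by rewrite mulr0; apply: subrg0.
    apply: subrgM => //; first by apply: Tz_Pm; rewrite subr_le0.
    by apply: opm'; apply: cA_Pm; apply: hom.
  rewrite z1; case: ifP => h; last by rewrite mulr0; apply: subrg0.
  apply: subrgM => //; first exact: Tz_Pm.
  by apply: opm'; apply: cA_Pm; apply: hom.
rewrite trD ?qf_bas ?bf_basl ?starK // e12 nux -scalemxAr omx //.
Qed.

Lemma sg_transport b b' g : isom g -> g *m bas b' = bas b ->
  g *m bas (star b') = bas (star b) -> sg b *m g = g *m sg b'.
Proof.
move=> ig gb gs; apply: mx_ext => x; rewrite -!mulmxA !sgE // !mulmxDr -!scalemxAr gb gs.
have -> : co b (g *m x) = co b' x.
  by rewrite -{1}(starK b) -bf_basl -gs isom_bf // bf_basl starK.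
by have -> : co (star b) (g *m x) = co (star b') x by rewrite -bf_basl -gb isom_bf // bf_basl.
Qed.

Definition birkhoff_form g := exists a mu w c,
  [/\ EP Pp a, Nn mu, EP Pm c & g = a *m mu *m tt w *m c].

(** After splitting off its constant term [a0], [a] can be conjugated by [sg b]. The constant term
    is written [invmx p *m wy *m mu0 *m be] with [p] stabilizing the line of [bas b]: [sg b] crosses
    [invmx p] within [E(A[T])] and turns into [sg b'] behind [wy], conjugates of [mu0] and [mu] go
    into [Nn], and [be] passes [tt w] to join [c], by the choice made in [pivot_weight]. *)
Lemma birkhoff_form_sg b g : birkhoff_form g -> birkhoff_form (sg b *m g).
Proof.
move=> [a [mu [w [c [ha hmu hc ->]]]]].
have lift p : Pp p -> exists2 q, pA A q & hev iota T q = p by case=> q hq ->; exists q.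
have [G hG ea] := EP_lift lift ha.
pose a0 := map_mx (hev iota 0) G.
have ev0 p : pA A p -> cA (hev iota 0 p) by move=> hp; rewrite hev0; exists p`_0.
have ha0 : EP cA a0 by apply: EP_map hG.
have ua0 := EP_unit ha0.
have h1 : EP Pp (cj (sg b) (a *m invmx a0)).
  have := sg_conj_poly n_ge2 lr T0 b (EP1 n cA) hG.
  by rewrite cj_id ea.
have hia0 : EP cA (invmx a0) by apply: EP_inv.
have ii := EP_isom hia0.
have [b' [cc [be [mu0 [[ccA cc0 ccA'] hbe hmu0 hbem e]]]]] :
  exists b' cc be mu0, [/\ [/\ cA cc, cc != 0 & cA cc^-1], EP cA be, EP cm mu0,
    EP Pm (cj (invmx (tt w)) be) & mu0 *m be *m (invmx a0 *m bas b) = cc *: bas b'].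
  apply: (@pivot_weight w _ (invmx a0 *m bas (star b))).
  - by apply: EP_vin => //; apply: vin_bas.
  - by apply: EP_vin => //; apply: vin_bas.
  - by rewrite ii qf_bas.
  by rewrite isom_bf // bf_basl coE eqxx.
have [wy [hwy _ wb ws]] := weyl (R := F) n_ge2 scA b' b.
have hmu0A : EP cA mu0 by apply: EP_mono hmu0 => p; apply: (cm_cA lr).
pose p := wy *m mu0 *m be *m invmx a0.
have hp : EP cA p by apply: EP_mul => //; apply: EP_mul => //; apply: EP_mul.
have up := EP_unit hp.
have pb : p *m bas b = cc *: bas b.
  by rewrite /p -!mulmxA [mu0 *m _]mulmxA e -scalemxAr wb.
have hpi : EP cA (invmx p) by apply: EP_inv.
have h2 : EP Pp (cj (sg b) (invmx p)).
  apply: (@sg_parabolic _ _ _ iota A m lr T T0 b cc^-1) => //; first by rewrite invr_eq0.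
  by rewrite -{1}[bas b](scalerK cc0) -pb -scalemxAr mulKmx.
have ea0 : a0 = invmx p *m (wy *m (mu0 *m be)).
  have -> : wy *m (mu0 *m be) = p *m a0 by rewrite /p mulmxKV // -!mulmxA.
  by rewrite mulKmx.
have cAPp q : cA q -> Pp q by apply: cA_Pp.
clearbody p a0.
pose hh := sg b' *m be.
have hhE : Et hh by apply: Et_sg; apply: Et_EP.
exists (cj (sg b) (a *m invmx a0) *m cj (sg b) (invmx p) *m wy).
exists (cj (sg b') mu0 *m cj hh mu), (fun i => sgw b' i + w i).
exists (cj (invmx (tt w)) be *m c); split.
- by apply: EP_mul; [apply: EP_mul|apply: EP_mono hwy].
- apply: Nn_mul; last exact: Nn_cj.
  apply: Nn_cj; first exact: Et_sg1.
  by apply: Nn_EPm; apply: EP_mono hmu0 => q; apply: cm_Lm.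
- exact: EP_mul.
have ut : tt w \in unitmx by apply: tt_unit.
have uhh := Et_unit hhE.
have e1 : sg b *m a = cj (sg b) (a *m invmx a0) *m (sg b *m a0).
  by rewrite /cj !mulmxA mulmxKV // mulmxKV.
have e2 : sg b *m a0 = cj (sg b) (invmx p) *m (wy *m (sg b' *m (mu0 *m be))).
  rewrite {1}ea0 [LHS]mulmxA (cj_mulE (invmx p) (usg b)) -[LHS]mulmxA.
  by rewrite [sg b *m _]mulmxA (sg_transport (EP_isom hwy) wb ws) -[wy *m _ *m _]mulmxA.
have e3 : sg b' *m (mu0 *m be) *m mu = cj (sg b') mu0 *m cj hh mu *m (sg b' *m be).
  rewrite [sg b' *m _]mulmxA (cj_mulE mu0 (usg b')) -[cj _ _ *m _ *m be]mulmxA -/hh.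
  by rewrite -[LHS]mulmxA (cj_mulE mu uhh) mulmxA.
have e4 : sg b' *m be *m tt w = tt (fun i => sgw b' i + w i) *m cj (invmx (tt w)) be.
  by rewrite -tt_mul // /cj invmxK -!mulmxA mulKVmx.
have -> : sg b *m (a *m mu *m tt w *m c) = sg b *m a *m mu *m tt w *m c by rewrite !mulmxA.
rewrite e1 e2; set X := cj _ (a *m _); set Y := cj _ (invmx p).
have -> : X *m (Y *m (wy *m (sg b' *m (mu0 *m be)))) *m mu *m tt w *m c =
    X *m Y *m wy *m (sg b' *m (mu0 *m be) *m mu) *m tt w *m c by rewrite !mulmxA.
rewrite e3; set Z := cj _ mu0 *m cj hh mu.
have -> : X *m Y *m wy *m (Z *m (sg b' *m be)) *m tt w *m c =
    X *m Y *m wy *m Z *m (sg b' *m be *m tt w) *m c by rewrite !mulmxA.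
by rewrite e4 !mulmxA.
Qed.

Lemma birkhoff g : EP LR g -> birkhoff_form g.
Proof.
move/EP_LR_Et; elim=> [|t g' ht _ [a [mu [w [c [ha hmu hc ->]]]]]|b g' _ IH].
- exists 1%:M, 1%:M, (fun=> 0), 1%:M; rewrite tt0 !mulmx1; split=> //; try exact: EP1.
  exact: Nn1.
- exists (t *m a), mu, w, c; rewrite !mulmxA; split=> //.
  by apply: EPS => //; apply: egen_mono ht => p; apply: cA_Pp.
exact: birkhoff_form_sg.
Qed.

(** * Splitting the congruence subgroup, with [T] transcendental *)

Hypothesis Ttr : forall p : {poly K}, hev iota T p = 0 -> p = 0.

Lemma hev_inj p q : hev iota T p = hev iota T q -> p = q.
Proof. by move=> e; apply/eqP; rewrite -subr_eq0; apply/eqP/Ttr; rewrite rmorphB e subrr. Qed.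

Lemma Lm_coef p : Lm (hev iota T p) -> pA m p.
Proof.
move=> [k [q hq]]; rewrite -{1}(hevX iota T) -rmorphXn -rmorphM => /hev_inj e i.
by have := hq (k + i)%N; rewrite -e mulrC coefMXn ltnNge leq_addr addKn.
Qed.

(** The congruence conditions are carried along because they put constant terms in the big cell,
    which allows further conjugations. *)
Definition congr_split g := exists yp ym, [/\ EP Pp yp, cg yp, EP Pm ym, cg ym & g = yp *m ym].

(** The reversal of [p] for the degree bound [d], that is ['X^d] times [p] at the inverse of
    ['X]. *)
Definition rv d (p : {poly K}) : {poly K} := \poly_(i < d.+1) p`_(d - i).

Lemma hev_rv d (p : {poly K}) : (size p <= d.+1)%N -> hev iota T (rv d p) = T ^+ d * hev iota T^-1 p.
Proof.
move=> sz; rewrite !hevE.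
have szr : (size (map_poly iota (rv d p)) <= d.+1)%N.
  by rewrite size_map_poly size_poly.
have szp : (size (map_poly iota p) <= d.+1)%N by rewrite size_map_poly.
rewrite (horner_coef_wide _ szr) (horner_coef_wide _ szp) mulr_sumr.
rewrite (reindex_inj rev_ord_inj) /=; apply: eq_bigr => i _.
have le : (i <= d)%N by rewrite -ltnS.
rewrite !coef_map coef_poly subSS ltnS leq_subr subKn // exprVn mulrCA.
have -> : T ^+ d = T ^+ (d - i) * T ^+ i by rewrite -exprD subnK.
by rewrite mulfK // expf_neq0.
Qed.

Lemma pA_rv (B : K -> Prop) d p : B 0 -> pA B p -> pA B (rv d p).
Proof. by move=> B0 hp i; rewrite coef_poly; case: ifP. Qed.

Lemma LmV_coef p : Lm (hev iota T^-1 p) -> pA m p.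
Proof.
move=> [k [q hq e]] i.
have [lt|ge] := ltnP i (size p); last by rewrite nth_default //; apply: lr_m0 lr.
pose d := size p.
have e' : 'X^k * rv d p = 'X^d * q.
  apply: hev_inj; rewrite !rmorphM !rmorphXn !hevX hev_rv ?leqnSn // mulrCA.
  by congr (_ * _); rewrite /lk in e; rewrite e.
have le : (i <= d)%N by rewrite ltnW.
have -> : p`_i = ('X^k * rv d p)`_(k + (d - i)).
  by rewrite mulrC coefMXn ltnNge leq_addr addKn coef_poly ltnS leq_subr subKn.
by rewrite e' mulrC coefMXn; case: ifP => _ //; apply: lr_m0 lr.
Qed.

Lemma Lm_cst x : cA x -> Lm x -> cm x.
Proof.
move=> [a ha ->]; rewrite -(hevC iota T) => /Lm_coef/(_ 0%N).
by rewrite coefC eqxx hevC => hm; exists a.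
Qed.

Lemma cg_inv g : g \in unitmx -> mxin LR (invmx g) -> cg g -> cg (invmx g).
Proof.
move=> ug hi hg; rewrite /cg (_ : _ - _ = (- invmx g) *m (g - 1%:M)).
  apply: mxLm_mull => // i j; rewrite mxE; exact: (subrgN sLR).
by rewrite mulNmx mulmxBr mulVmx // mulmx1 opprB.
Qed.

Lemma EPcA_mxin (g : 'M[F]_(n + n + 1)) : EP cA g -> mxin LR g.
Proof. by move=> hg; apply: Et_mxin; apply: Et_EP. Qed.

Lemma EPcm_cg g : EP cm g -> cg g.
Proof. by move=> hg; apply: Nn_cg; apply: Nn_EPm; apply: EP_mono hg => p; apply: cm_Lm. Qed.

Lemma cg_sg b g : cg g -> cg (cj (sg b) g).
Proof.
move=> hg; apply: cg_cj => //; first exact: tt_mxin.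
by rewrite sg_inv //; apply: tt_mxin.
Qed.

(** A constant matrix congruent to 1 lies in the big cell: its product with some [u] along [star b]
    stabilizes the line of [bas b]. Under [sg b] the product becomes polynomial in [T], while
    [invmx u] acquires a factor [T^-1]. *)
Lemma cg_const_middle b g : EP cA g -> cg g ->
  exists qp qm, [/\ EP Pp qp, cg qp, EP Pm qm, cg qm & cj (sg b) g = qp *m qm].
Proof.
move=> hg cgg; have ug := EP_unit hg.
have hgi : EP cA (invmx g) by apply: EP_inv.
have cgi : cg (invmx g) by apply: cg_inv => //; apply: EPcA_mxin.
pose nu := invmx g *m bas b.
have hnu : vin cA nu by apply: EP_vin => //; apply: vin_bas.
have hbL : vin LR (bas b : 'cV[F]_(n + n + 1)) by apply: vin_bas.
have nu_b : vin cm (nu - bas b).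
  move=> i; apply: Lm_cst; last exact: (cg_vin cgi hbL i).
  by apply: vinD => //; apply: vinN => //; apply: vin_bas.
set c := co b nu; have hc : cA c by apply: hnu.
have c1 : cm (c - 1).
  by have := nu_b (pos b); rewrite -[_ (pos b) 0]/(co b _) !coE eqxx.
have [c0 hci] : c != 0 /\ cA c^-1.
  case: (cA_cases lr hc) => [cmc|[] //]; case: (cm1 lr (iota := iota)).
  by rewrite -[1](subKr c); apply: (cmD lr) => //; apply: (cmN lr).
have nud d : d != b -> cm (co d nu).
  move=> ne; have := nu_b (pos d); rewrite -[_ (pos d) 0]/(co d _) !coE (negPf ne).
  by rewrite subr0.
have nuz : cm (cz nu).
  by have := nu_b (zc n); rewrite -[_ (zc n) 0]/(cz _) !czE subr0.
have qnu : qf nu = 0 by rewrite (EP_isom hgi) qf_bas.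
have gnu : g *m nu = bas b by rewrite mulKVmx.
clearbody nu.
pose om := c^-1 *: nu - bas b - (c^-1 * co (star b) nu) *: bas (star b).
have sbb := negPf (star_neq b).
have omb : co b om = 0.
  by rewrite !coE eqxx (eq_sym b) sbb mulr0 subr0 -/c mulVf // subrr.
have oms : co (star b) om = 0 by rewrite !coE eqxx sbb subr0 mulr1 subrr.
have omd d : cm (co d om).
  have [->|n1] := eqVneq d b; first by rewrite omb; apply: (cm0 _ lr).
  have [->|n2] := eqVneq d (star b); first by rewrite oms; apply: (cm0 _ lr).
  rewrite !coE (negPf n1) (negPf n2) mulr0 !subr0; apply: (cmM lr) => //.
  exact: nud.
have omz : cm (cz om) by rewrite !czE mulr0 !subr0; apply: (cmM lr).
have qom : qf om = - (c^-1 * co (star b) nu).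
  have qx : qf (c^-1 *: nu) = 0 by rewrite qfZ qnu mulr0.
  apply/eqP; rewrite -addr_eq0 addrC; apply/eqP; rewrite -qx (qf_split b (c^-1 *: nu)).
  by rewrite !coZ -/c mulVf // mul1r scale1r.
pose u := tr (bas (star b)) om.
have hu : EP cm u by apply: EP_tr => //; rewrite starK.
have huA : EP cA u by apply: EP_mono hu => p; apply: (cm_cA lr).
have uu := EP_unit hu.
have ub : u *m bas b = c^-1 *: nu.
  rewrite trE bf_basl starK coE eqxx scale1r bf_basr oms scale0r subr0 mulr1 qom.
  by rewrite /om; apply/matrixP => i j; rewrite !mxE; ring.
have hui : EP cA (invmx u) by apply: EP_inv.
exists (cj (sg b) (g *m u)), (cj (sg b) (invmx u)); split.
- apply: (@sg_parabolic _ _ _ iota A m lr T T0 b c^-1) => //.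
  + exact: EP_mul.
  + by rewrite invr_eq0.
  by rewrite -mulmxA ub -scalemxAr gnu.
- apply: cg_sg; apply: cg_mul => //; [exact: EPcA_mxin|exact: EPcm_cg].
- rewrite /u invmx_tr ?qf_bas ?bf_basl ?starK // cj_tr //; try exact: isg.
  rewrite sg_star // sg_fix ?coN ?omb ?oms ?oppr0 // trZ.
  apply: EP_tr_vin; last by rewrite coZ starK coN omb oppr0 mulr0.
  apply: vinZ => //; first exact: Pol_tau.
  apply: vinN => //; apply: vinP => [d|]; apply: cA_Pm; exact: (cm_cA lr).
- apply: cg_sg; apply: cg_inv => //; [exact: EPcA_mxin|exact: EPcm_cg].
by rewrite -cjM // mulmxK.
Qed.

Lemma cg_ev0 tau (G : 'M[{poly K}]_(n + n + 1)) : EP (pA A) G ->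
  (forall p, Lm (hev iota tau p) -> pA m p) ->
  cg (map_mx (hev iota tau) G) -> cg (map_mx (hev iota 0) G).
Proof.
move=> hG hcoef hc i j.
have e tau' : (map_mx (hev iota tau') G - 1%:M) i j = hev iota tau' ((G - 1%:M) i j).
  by rewrite !mxE rmorphB rmorph_nat.
have := hc i j; rewrite !e => /hcoef h; rewrite hev0; apply: cm_Lm.
by exists ((G - 1%:M) i j)`_0.
Qed.

(** The constant terms of [yp] at [T = 0] and of [ym] at [1/T = 0] are moved to the middle. The
    outer factors then survive conjugation by [sg b], and the middle one is a constant matrix
    congruent to 1. *)
Lemma congr_split_sg b g : congr_split g -> congr_split (cj (sg b) g).
Proof.
move=> [yp [ym [hp cp hm cmm ->]]].
have ev0 p : pA A p -> cA (hev iota 0 p) by move=> hq; rewrite hev0; exists p`_0.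
have [G hG eG] : exists2 G, EP (pA A) G & map_mx (hev iota T) G = yp.
  by apply: EP_lift hp => p [q hq ->]; exists q.
have [H hH eH] : exists2 H, EP (pA A) H & map_mx (hev iota T^-1) H = invmx ym.
  apply: EP_lift (EP_inv opm' hm) => p [q hq ->]; by exists q.
pose a0 := map_mx (hev iota 0) G; pose i0 := map_mx (hev iota 0) H.
have ha0 : EP cA a0 by apply: EP_map hG.
have hi0 : EP cA i0 by apply: EP_map hH.
have um := EP_unit hm.
have hmL : mxin LR ym by apply: EP_mxin => //; apply: EP_mono hm => p; apply: Pm_LR.
have hmiL : mxin LR (invmx ym).
  by apply: EP_mxin => //; apply: EP_mono (EP_inv opm' hm) => p; apply: Pm_LR.
have ca0 : cg a0 by apply: (@cg_ev0 T) => //; [exact: Lm_coef|rewrite eG].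
have ci0 : cg i0.
  by apply: (@cg_ev0 T^-1) => //; [exact: LmV_coef|rewrite eH; apply: cg_inv].
have ua0 := EP_unit ha0; have ui0 := EP_unit hi0.
have hia0 : EP cA (invmx a0) by apply: EP_inv.
have hii0 : EP cA (invmx i0) by apply: EP_inv.
have cia0 : cg (invmx a0) by apply: cg_inv => //; apply: EPcA_mxin.
have cii0 : cg (invmx i0) by apply: cg_inv => //; apply: EPcA_mxin.
have h1 : EP Pp (cj (sg b) (yp *m invmx a0)).
  by have := sg_conj_poly n_ge2 lr T0 b (EP1 n cA) hG; rewrite cj_id eG.
have h2 : EP Pm (cj (sg b) (invmx ym *m invmx i0)).
  by have := sg_conj_poly n_ge2 lr T0' (star b) (EP1 n cA) hH; rewrite cj_id eH sgV.
have [qp [qm [hqp cqp hqm cqm e]]] : exists qp qm,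
    [/\ EP Pp qp, cg qp, EP Pm qm, cg qm & cj (sg b) (a0 *m invmx i0) = qp *m qm].
  apply: cg_const_middle; first exact: EP_mul.
  by apply: cg_mul => //; apply: EPcA_mxin.
have uy : invmx ym *m invmx i0 \in unitmx by rewrite unitmx_mul !unitmx_inv um.
have PmL x : EP Pm x -> mxin LR x.
  by move=> hx; apply: EP_mxin => //; apply: EP_mono hx => p; apply: Pm_LR.
have PpL x : EP Pp x -> mxin LR x.
  by move=> hx; apply: EP_mxin => //; apply: EP_mono hx => p; apply: Pp_LR.
exists (cj (sg b) (yp *m invmx a0) *m qp), (qm *m cj (sg b) (i0 *m ym)).
have ei : i0 *m ym = invmx (invmx ym *m invmx i0).
  by rewrite invmx_mul ?unitmx_inv // !invmxK.
split.
- exact: EP_mul.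
- apply: cg_mul => //; last exact: PpL.
  by apply: cg_sg; apply: cg_mul => //; apply: EPcA_mxin.
- apply: EP_mul => //; rewrite ei -cj_inv //; exact: EP_inv.
- apply: cg_mul => //.
    rewrite ei -cj_inv //; apply: PmL; exact: EP_inv.
  by apply: cg_sg; apply: cg_mul.
have -> : yp *m ym = yp *m invmx a0 *m (a0 *m invmx i0) *m (i0 *m ym).
  by rewrite !mulmxA mulmxKV // mulmxKV.
rewrite (cjM _ _ (usg b)) (cjM _ _ (usg b)) e !mulmxA //.
Qed.

Lemma congr_split_Et h g : Et h -> congr_split g -> congr_split (cj h g).
Proof.
move=> hh hg; elim: hh => [|t h' ht hh' [yp [ym [hp cp hm cmm e]]]|b h' hh' IH].
- by rewrite cj_id.
- have ut := egen_unit ht; have Et_t : EP cA t by apply: EP_egen.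
  have Eti := EP_inv opA Et_t.
  rewrite cj_mul ?(Et_unit hh') // e (cjM _ _ ut).
  exists (cj t yp), (cj t ym); split=> //.
  + by apply: cj_EP => //; apply: EP_mono Et_t => p; apply: cA_Pp.
  + by apply: cg_cj => //; apply: EPcA_mxin.
  + by apply: cj_EP => //; apply: EP_mono Et_t => p; apply: cA_Pm.
  by apply: cg_cj => //; apply: EPcA_mxin.
by rewrite cj_mul ?(Et_unit hh') //; apply: congr_split_sg.
Qed.

(** A product of two split matrices is not evidently split. But splittings are stable under
    conjugation by [Et] and under a constant factor on the left, so a new factor [cj h t] is
    introduced as [t] inside a conjugation by [h]. *)
Lemma Nn_congr_split g : Nn g -> congr_split g.
Proof.
elim=> [|h t g' hh ht hg IH].
  exists 1%:M, 1%:M; rewrite mulmx1; split=> //; by [apply: EP1|apply: cg1].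
have uh := Et_unit hh.
have -> : cj h t *m g' = cj h (t *m cj (invmx h) g') by rewrite cjM // cjVK.
apply: congr_split_Et => //.
have [yp [ym [hp cp hm cmm ->]]] := congr_split_Et (Et_inv hh) IH.
have htL : egen Lm t by apply: egen_mono ht => p; apply: cm_Lm.
exists (t *m yp), ym; rewrite mulmxA; split=> //.
  apply: EPS => //; apply: egen_mono ht => p hp'; apply: cA_Pp; exact: (cm_cA lr).
apply: cg_mul => //; first exact: egen_cg.
by apply: EP_mxin => //; apply: EP_mono hp => p; apply: Pp_LR.
Qed.

End Laurent.

Lemma hev_tr_inv (K F : fieldType) (iota : {rmorphism K -> F}) (t : F) :
  t != 0 -> (forall p, hev iota t p = 0 -> p = 0) ->
  forall p, hev iota t^-1 p = 0 -> p = 0.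
Proof.
move=> t0 ttr p e; have := hev_rv iota t0 (leqnSn (size p)).
rewrite e mulr0 => /ttr/polyP r0; apply/polyP => i; rewrite coef0.
have [lt|ge] := ltnP i (size p); last by rewrite nth_default.
have := r0 (size p - i)%N; rewrite coef0 coef_poly ltnS leq_subr subKn //.
exact: ltnW.
Qed.

Lemma loc_inv (K F : fieldType) (iota : {rmorphism K -> F}) (B : K -> Prop) (t z : F) : subrg B -> t != 0 ->
  loc (Pol iota B t) t z -> loc (Pol iota B t^-1) t^-1 z.
Proof.
move=> sB t0 [k [q hq e]]; exists (size q).
have t0' : t^-1 != 0 by rewrite invr_eq0.
have sPm := Pol_subrg iota t^-1 sB.
rewrite /lk (_ : _ * z = t^-1 ^+ k * hev iota t^-1 (rv (size q) q)).
  apply: (subrgM sPm); first by apply: (subrgX sPm); apply: Pol_tau.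
  by exists (rv (size q) q) => //; apply: pA_rv => //; apply: subrg0.
rewrite (hev_rv iota t0') ?leqnSn // invrK -e /lk mulrCA [t^-1 ^+ k * _]mulrA.
by rewrite -exprMn mulVf // expr1n mul1r.
Qed.

(** * Orbits over a local ring *)

Section Pivot.
Variables (n : nat) (F : fieldType).
Implicit Types (v : 'cV[F]_(n + n + 1)) (b d : bool * 'I_n).

(** Gaussian elimination with pivot [co b v]: the transvection with axis [bas (star b)] and this
    vector clears the coordinates in [S] and sets the last one to [z]. *)
Definition pivv (S : pred (bool * 'I_n)) b z v : 'cV[F]_(n + n + 1) :=
  locked (\sum_(d | S d) (- (co d v / co b v)) *: bas d + ((z - cz v) / co b v) *: ev n F).

Lemma pivv_co S b z v d : co d (pivv S b z v) = if S d then - (co d v / co b v) else 0.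
Proof. by rewrite /pivv -lock coD coZ co_ev mulr0 addr0 co_comb. Qed.

Lemma pivv_cz S b z v : cz (pivv S b z v) = (z - cz v) / co b v.
Proof. by rewrite /pivv -lock czD cz_comb czZ cz_ev mulr1 add0r. Qed.

Lemma pivot_co S b z v d : co b v != 0 -> ~~ S b -> d != star b ->
  co d (tr (bas (star b)) (pivv S b z v) *m v) = if S d then 0 else co d v.
Proof.
move=> c0 Sb ne; rewrite trE bf_basl starK !coE (negPf ne) !mulr0 !subr0 pivv_co.
by case: ifP => _; rewrite ?mulr0 ?addr0 // mulrN mulrC divfK // subrr.
Qed.

Lemma pivot_cz S b z v : co b v != 0 ->
  cz (tr (bas (star b)) (pivv S b z v) *m v) = z.
Proof.
move=> c0; rewrite trE bf_basl starK !czE !mulr0 !subr0 pivv_cz.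
by rewrite mulrC divfK // addrC subrK.
Qed.

Definition offb b : pred (bool * 'I_n) := fun d => (d != b) && (d != star b).

(** Once the other coordinates are cleared, the value [z ^+ 2] of the form forces the product of the
    pivot and its dual coordinate to be 0. *)
Lemma pivot_full b z v : co b v != 0 -> qf v = z ^+ 2 ->
  tr (bas (star b)) (pivv (offb b) b z v) *m v = co b v *: bas b + z *: ev n F.
Proof.
move=> c0 qv; set g := tr _ _.
have nSb : ~~ offb b b by rewrite /offb eqxx.
have bsb : b != star b by rewrite eq_sym star_neq.
have gz : cz (g *m v) = z by apply: pivot_cz.
have gd d : d != star b -> co d (g *m v) = if offb b d then 0 else co d v.
  exact: pivot_co.
have ig : isom g.
  by apply: tr_isom; rewrite ?qf_bas // bf_basl starK pivv_co (negPf nSb).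
have gs : co (star b) (g *m v) = 0.
  have := ig v; rewrite (qf_split b (g *m v)) (gd b) // (negPf nSb).
  set x := g *m v - _ - _.
  have -> : x = z *: ev n F.
    apply: colext => [d|]; last by rewrite !czE !mulr0 !subr0 gz mulr1.
    rewrite !coE mulr0; have [->|n1] := eqVneq d b.
      by rewrite (negPf bsb) mulr1 mulr0 subr0 gd // (negPf nSb) subrr.
    have [->|n2] := eqVneq d (star b); first by rewrite mulr0 subr0 mulr1 subrr.
    by rewrite !mulr0 !subr0 gd // /offb n1 n2.
  rewrite qfZ qf_ev mulr1 qv => /(congr1 (fun y => y - z ^+ 2)).
  by rewrite addrK subrr => /eqP; rewrite mulf_eq0 (negPf c0) => /eqP.
apply: colext => [d|]; last by rewrite gz !czE mulr0 add0r mulr1.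
rewrite !coE mulr0 addr0; have [->|n2] := eqVneq d (star b).
  by rewrite gs eq_sym (negPf bsb) mulr0.
rewrite gd // /offb n2 andbT; have [->|n1] := eqVneq d b; first by rewrite mulr1.
by rewrite mulr0.
Qed.

Lemma short_kill b (c z : F) : (2 : F) != 0 -> z != 0 ->
  tr (bas b) ((c / (2 * z)) *: ev n F) *m (c *: bas b + z *: ev n F) = z *: ev n F.
Proof.
move=> t0 z0; rewrite mulmxDr -!scalemxAr short_bas short_ev (negPf (star_neq b)).
rewrite !mul0r !scale0r addr0 subr0 scalerBr scalerA addrC.
rewrite (_ : z * (2 * (c / (2 * z))) = c) ?subrK //.
by field; rewrite t0 z0.
Qed.

End Pivot.

(** [X] contains no dual pair, so partial sums stay isotropic and orthogonal to the next basis
    vector, and [tr_sumvec] adds one axis at a time. *)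
Lemma EP_tr_isotropic (n : nat) (F : comUnitRingType) (P : F -> Prop)
    (X : pred (bool * 'I_n)) (c : bool * 'I_n -> F) : subrg P ->
  (forall b, X b -> ~~ X (star b)) -> (forall b, X b -> P (c b)) ->
  EP P (tr (\sum_(b | X b) c b *: bas b) (ev n F)).
Proof.
move=> sP hX hc.
have opP : oppc P by move=> p; apply: subrgN.
pose Us r : 'cV[F]_(n + n + 1) := \sum_(b <- r | X b) c b *: bas b.
suff : forall r, [/\ EP P (tr (Us r) (ev n F)), vin P (Us r), qf (Us r) = 0,
    cz (Us r) = 0 & forall d, ~~ X d -> co d (Us r) = 0].
  by move=> /(_ (index_enum _))[].
elim=> [|b r [IH1 IH2 IH3 IH4 IH5]]; rewrite /Us ?big_nil ?big_cons.
  split=> [||||d _]; rewrite ?qf0 ?cz0 ?co0 //.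
    have -> : tr 0 (ev n F) = tr 0 0 :> 'M[F]_(n + n + 1).
      apply: mx_ext => x; rewrite !trE !bf0l !scaler0 !scale0r //.
    by rewrite tr0; apply: EP1.
  by move=> i; rewrite mxE; apply: subrg0.
case: ifP => Xb; last by split.
rewrite -/(Us r); have hcb := hc b Xb.
have bU : bf (bas b) (Us r) = 0 by rewrite bf_basl IH5 // hX.
split.
- rewrite tr_sumvec ?qfZ ?qf_bas ?mulr0 ?bfZl ?bf_basl ?IH5 ?hX ?co_ev ?mulr0 //; last first.
    by rewrite bf_evr IH4 mulr0.
  apply: EP_mul; [apply: EP_mul => //|]; rewrite trZ; apply: EP_tr_vin => //.
  + by apply: vinZ => //; apply: vin_ev.
  + by rewrite coZ co_ev mulr0.
  + by rewrite qf_ev scalerA; apply: vinZ => //; apply: subrgM => //; apply: opP; apply: subrg1.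
  by rewrite qf_ev !coZ IH5 ?hX // !mulr0.
- by apply: vinD => //; apply: vinZ => //; apply: vin_bas.
- by rewrite qfD qfZ qf_bas IH3 bfZl bU !mulr0 !addr0.
- by rewrite czD czZ cz_bas IH4 mulr0 addr0.
move=> d nX; rewrite !coE IH5 // addr0; case: eqP => [e|_]; last by rewrite mulr0.
by rewrite e Xb in nX.
Qed.

Section ConstOrbit.
Variables (n : nat) (K F : fieldType) (iota : {rmorphism K -> F}) (A m : K -> Prop).
Hypotheses (n_ge2 : (2 <= n)%N) (lr : locring A m).
Local Notation cA := (cst iota A).
Local Notation cm := (cst iota m).
Let sA := lr_sub lr.
Let scA : subrg cA := cst_subrg iota sA.
Let two0 : (2 : F) != 0. Proof. exact: (two_neq0 iota lr). Qed.
Let halfA : cA 2^-1. Proof. exact: (cA_half iota lr). Qed.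

Lemma const_orbit_unit (x : 'cV[F]_(n + n + 1)) b : vin cA x -> qf x = 1 ->
  co b x != 0 -> cA (co b x)^-1 -> exists2 g, EP cA g & g *m x = ev n F.
Proof.
move=> hx qx c0 hc.
have hb : cA (co b x) by apply: hx.
exists (tr (bas b) ((co b x / (2 * 1)) *: ev n F) *m
  tr (bas (star b)) (pivv (offb b) b 1 x)).
  apply: EP_mul.
    apply/EP_egen/egen_short; rewrite mulr1; exact: subrgM.
  apply: EP_tr_vin; last by rewrite starK pivv_co /offb eqxx.
  apply: vinP => [d|]; rewrite ?pivv_co ?pivv_cz.
    by case: ifP => _; [apply: subrgN => //; apply: subrgM => //; apply: hx|apply: subrg0].
  by apply: subrgM => //; apply: subrgB => //; [apply: subrg1|apply: hx].
by rewrite -mulmxA pivot_full ?qx ?expr1n // short_kill ?oner_eq0 // scale1r.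
Qed.

(** If no isotropic coordinate is a unit, the last one is, and a short transvection adds -2 times it
    to the coordinate at [b], which becomes a unit. *)
Lemma const_orbit (x : 'cV[F]_(n + n + 1)) : vin cA x -> qf x = 1 ->
  exists2 g, EP cA g & g *m x = ev n F.
Proof.
move=> hx qx.
have [[b [c0 hc]]|no] := pselect (exists b, co b x != 0 /\ cA (co b x)^-1).
  exact: const_orbit_unit c0 hc.
have hb b : cm (co b x).
  by case: (cA_cases lr (hx (pos b))) => // -[h1 h2]; case: no; exists b.
have b : bool * 'I_n by case: (n) n_ge2 => // n' _; exact: (true, ord0).
pose g := tr (bas b) (1 *: ev n F).
have hg : EP cA g by apply/EP_egen/egen_short; apply: subrg1.
have hz : cA (cz x) by apply: hx.
have cogx : co b (g *m x) = - (2 * cz x) + (co b x - co (star b) x).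
  rewrite trE bf_basl !scale1r bf_evl qf_ev !coE eqxx /=; ring.
have hsm : cm (co b x - co (star b) x) by apply: (cmD lr) => //; apply: (cmN lr).
have hgx : vin cA (g *m x) by apply: EP_vin.
have qgx : qf (g *m x) = 1 by rewrite (EP_isom hg).
have [bad|[h1 h2]] := cA_cases lr (hgx (pos b)); last first.
  have [h hh e] := const_orbit_unit hgx qgx h2 h1.
  by exists (h *m g); [apply: EP_mul|rewrite -mulmxA].
case: (cm1 lr (iota := iota)).
have cz2 : cm (2 * cz x).
  have -> : 2 * cz x = (co b x - co (star b) x) - co b (g *m x) by rewrite cogx; ring.
  by apply: (cmD lr) => //; apply: (cmN lr).
have czm : cm (cz x) by apply: (cm_half lr).
rewrite -qx (_ : qf x = (qf x - cz x ^+ 2) + cz x ^+ 2); last by rewrite subrK.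
apply: (cmD lr); first exact: (cm_qf lr).
by rewrite expr2; apply: (cmM lr).
Qed.

End ConstOrbit.

Section LocalOrbit.
Variables (n : nat) (K F : fieldType) (iota : {rmorphism K -> F}) (A m : K -> Prop).
Hypotheses (n_ge2 : (2 <= n)%N) (lr : locring A m).
Variables (T : F).
Hypothesis T0 : T != 0.
Hypothesis Ttr : forall p : {poly K}, hev iota T p = 0 -> p = 0.

Local Notation cA := (cst iota A).
Local Notation cm := (cst iota m).
Local Notation Pp := (Pol iota A T).
Local Notation Pm := (Pol iota A T^-1).
Local Notation LR := (loc Pp T).
Local Notation Lm := (loc (Pol iota m T) T).
Local Notation tt := (@tt n F T).
Local Notation Nn := (@Nn n K F iota A m T).
Local Notation Et := (@Et n K F iota A T).
Local Notation cg := (@cg n K F iota m T).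

Let sA := lr_sub lr.
Let scA : subrg cA := cst_subrg iota sA.
Let sPp : subrg Pp := Pol_subrg iota T sA.
Let sPm : subrg Pm := Pol_subrg iota T^-1 sA.
Let Tp : Pp T. Proof. exact: Pol_tau. Qed.
Let Sm : Pm T^-1. Proof. exact: Pol_tau. Qed.
Let sLR : subrg LR := loc_subrg sPp Tp.
Let opA : oppc cA. Proof. by move=> p; apply: subrgN. Qed.
Let opp' : oppc Pp. Proof. by move=> p; apply: subrgN. Qed.
Let opm' : oppc Pm. Proof. by move=> p; apply: subrgN. Qed.
Let T0' : T^-1 != 0. Proof. by rewrite invr_eq0. Qed.
Let two0 : (2 : F) != 0. Proof. exact: (two_neq0 iota lr). Qed.
Let halfA : cA 2^-1. Proof. exact: (cA_half iota lr). Qed.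
Let lmD x y : Lm x -> Lm y -> Lm (x + y). Proof. exact: (LmD lr). Qed.
Let lmM x y : LR x -> Lm y -> Lm (x * y). Proof. exact: (LmM lr). Qed.
Let lmN x : Lm x -> Lm (- x). Proof. exact: (LmN lr). Qed.
Let lm0 : Lm 0. Proof. exact: (Lm0 _ lr). Qed.
Let lmB x y : Lm x -> Lm y -> Lm (x - y). Proof. by move=> hx hy; apply: lmD => //; apply: lmN. Qed.
Let cA_LR x : cA x -> LR x. Proof. by move=> h; apply: loc_P; apply: cst_Pol. Qed.
Let Pp_LR x : Pp x -> LR x. Proof. exact: loc_P. Qed.
Let Pm_LR x : Pm x -> LR x. Proof. exact: (Pm_LR lr). Qed.
Let cm_Lm x : cm x -> Lm x. Proof. exact: (cm_Lm lr). Qed.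
Let EPp_Et g : EP Pp g -> Et g.
Proof. by move=> hg; apply: (EP_LR_Et lr) => //; apply: EP_mono hg => p; apply: Pp_LR. Qed.

Lemma coef_bound p q (k : int) : Lm (hev iota T p - T ^ k * hev iota T^-1 q) ->
  forall l : nat, k < l%:Z -> m p`_l.
Proof.
move=> [j [s hs e]] l lt.
(* [r] and [e1] are natural numbers with [r + d = e1 + k]: after multiplication by enough powers of
   [T] both sides are polynomials, and the one coming from [q] contributes nothing beyond weight
   [k]. *)
pose d := size q; pose e1 := (d + `|k|)%N; pose r := absz (Posz (absz k) + k).
have er : T ^+ (r + d) = T ^+ e1 * T ^ k.
  by rewrite !exprnP -expfzDr //; congr (T ^ _); rewrite /r /e1; lia.
have E : p * 'X^(e1 + j) = rv d q * 'X^(j + r) + s * 'X^e1.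
  apply: (hev_inj Ttr).
  rewrite rmorphD !rmorphM !rmorphXn !hevX (hev_rv iota T0) ?leqnSn // -e /lk.
  rewrite [X in _ = X + _](_ : _ = T ^+ j * T ^+ (r + d) * hev iota T^-1 q).
    by rewrite er !exprD; ring.
  by rewrite !exprD; ring.
have := congr1 (fun x : {poly K} => x`_(e1 + j + l)) E.
rewrite coefD !coefMXn ltnNge leq_addr addKn /= => ->.
have ltd : (d < e1 + j + l - (j + r))%N by rewrite /e1 /r; lia.
have -> : (e1 + j + l < j + r)%N = false by rewrite /e1 /r; lia.
rewrite coef_poly ltnS leqNgt ltd /= add0r.
by case: ifP => _ //; apply: lr_m0 lr.
Qed.

Lemma hevT_const p q : hev iota T p = hev iota T^-1 q -> p = (p`_0)%:P.
Proof.
move=> e; pose d := size q.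
have E : 'X^d * p = rv d q.
  by apply: (hev_inj Ttr); rewrite rmorphM rmorphXn hevX (hev_rv iota T0) ?leqnSn // e.
apply/polyP => -[|i]; rewrite coefC //=.
have := congr1 (fun x : {poly K} => x`_(d + i.+1)) E.
by rewrite mulrC coefMXn ltnNge leq_addr addKn /= => ->; rewrite coef_poly ltnS leqNgt -addn1 leq_add2l.
Qed.

Lemma Pp_Pm_cst x : Pp x -> Pm x -> cA x.
Proof.
move=> [p hp ->] [q hq e]; exists p`_0; first exact: hp.
by rewrite (hevT_const e) hevC coefC.
Qed.

Definition Orb v := exists2 g, EP Pp g & g *m v = ev n F.

Lemma Orb_EP g v : EP Pp g -> Orb (g *m v) -> Orb v.
Proof. by move=> hg [h hh e]; exists (h *m g); [apply: EP_mul|rewrite -mulmxA]. Qed.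

(* The relation between [v] and [x] which is left by the Birkhoff decomposition. *)
Definition St (w : 'I_n -> int) (v x : 'cV[F]_(n + n + 1)) := [/\ vin Pp v, vin Pm x,
  qf v = 1 & exists2 mu, Nn mu & v = mu *m (tt w *m x)].

Lemma St_act w v x g h : EP Pp g -> EP Pm h -> g *m tt w = tt w *m h ->
  St w v x -> St w (g *m v) (h *m x).
Proof.
move=> hg hh e [hv hx qv [mu hmu ev]]; split.
- exact: EP_vin.
- exact: EP_vin.
- by rewrite (EP_isom hg).
exists (cj g mu); first by apply: Nn_cj => //; apply: EPp_Et.
have ug := EP_unit hg.
rewrite ev [tt w *m (h *m x)]mulmxA -e -[g *m tt w *m x]mulmxA [LHS]mulmxA.
by rewrite (cj_mulE mu ug) -mulmxA.
Qed.

Lemma St_diff w v x : St w v x -> vin Lm (v - tt w *m x).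
Proof.
move=> [hv hx qv [mu hmu ev]]; rewrite ev; apply: (cg_vin lr (A := A)).
  exact: (Nn_cg lr).
apply: (mxin_vin sLR); first exact: (tt_mxin iota lr).
by move=> i; apply: Pm_LR; apply: hx.
Qed.

Lemma St_coord w v x b : St w v x ->
  exists2 p, pA A p & co b v = hev iota T p /\ forall l : nat, wq w b < l%:Z -> m p`_l.
Proof.
move=> hst; have [hv hx _ _] := hst; have [p hp ep] := hv (pos b).
have [q hq eq] := hx (pos b); exists p => //; split=> //.
apply: (@coef_bound p q); rewrite -ep -eq.
have := St_diff hst (pos b); rewrite -[_ (pos b) 0]/(co b _) coD coN tt_co.
by [].
Qed.

Lemma St_cz w v x : St w v x ->
  exists2 p, pA A p & cz v = hev iota T p /\ forall l : nat, 0 < l%:Z -> m p`_l.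
Proof.
move=> hst; have [hv hx _ _] := hst; have [p hp ep] := hv (zc n).
have [q hq eq] := hx (zc n); exists p => //; split=> //.
apply: (@coef_bound p q); rewrite -ep -eq expr0z mul1r.
have := St_diff hst (zc n); rewrite -[_ (zc n) 0]/(cz _) czD czN tt_cz.
by [].
Qed.

(* Modulo [m], [v] is [e *: ev] plus a vector of the isotropic subspace spanned by [X]. *)
Definition near_flag (w : 'I_n -> int) v := exists (e : F) (X : pred (bool * 'I_n)),
  [/\ e = 1 \/ e = -1, forall b, X b -> ~~ X (star b), forall b, X b -> 0 <= wq w b,
      forall b, ~~ X b -> Lm (co b v) & Lm (cz v - e)].

Definition nearE (e : F) (v : 'cV[F]_(n + n + 1)) := vin Lm (v - e *: ev n F).

Lemma hev_Lm p : pA m p -> Lm (hev iota T p).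
Proof. by move=> hp; exists 0%N; rewrite /lk mul1r; exists p. Qed.

Lemma St_kill w v x : St w v x -> near_flag w v -> exists e g h,
  [/\ e = 1 \/ e = -1, EP Pp g, St w (g *m v) (h *m x), nearE e (g *m v) &
      nearE e (h *m x)].
Proof.
move=> hst [e [X [he hX wX offX ez]]].
have e2 : e * e = 1 by case: he => ->; rewrite ?mulr1 ?mulrNN ?mulr1.
have eA : cA e.
  by case: he => ->; [|apply: opA]; apply: subrg1.
have [r [hr rdiff rdeg]] : exists r : bool * 'I_n -> {poly K},
  [/\ forall b, pA A (r b), forall b, X b -> Lm (co b v - hev iota T (r b)) &
      forall b, X b -> (size (r b) <= `|wq w b|.+1)%N].
  have /choice[r hr] : forall b, exists r, [/\ pA A r, X b -> Lm (co b v - hev iota T r) &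
      X b -> (size r <= `|wq w b|.+1)%N].
    move=> b; have [p hp [ep hm]] := St_coord b hst.
    exists (take_poly `|wq w b|.+1 p); split.
    - by move=> i; rewrite coef_take_poly; case: ifP => _ //; apply: subrg0.
    - move=> Xb; rewrite ep -rmorphB; apply: hev_Lm => i.
      rewrite coefB coef_take_poly; case: ltnP => h; first by rewrite subrr; apply: lr_m0 lr.
      by rewrite subr0; apply: hm; have := wX b Xb; lia.
    by move=> _; apply: size_take_poly.
  by exists r; split=> b; case: (hr b).
(* Modulo [m] the transvection subtracts [2 * e] times [U] from [v]; since [e * e = 1], the factor
   [2^-1 * e] makes this the isotropic part. *)
pose cf b := 2^-1 * e * hev iota T (r b).
pose U := \sum_(b | X b) cf b *: bas b.
pose U' := \sum_(b | X b) (T ^ (- wq w b) * cf b) *: bas b.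
have hg : EP Pp (tr U (ev n F)).
  apply: EP_tr_isotropic => // b Xb; apply: subrgM => //; last by exists (r b).
  by apply: cst_Pol => //; apply: subrgM.
have hh : EP Pm (tr U' (ev n F)).
  apply: EP_tr_isotropic => // b Xb; rewrite /cf mulrCA; apply: subrgM => //.
    by apply: cst_Pol => //; apply: subrgM.
  have w0 := wX b Xb; have -> : - wq w b = - (`|wq w b|%N)%:Z by lia.
  rewrite -exprnN -exprVn.
  have := hev_rv iota T0' (rdeg b Xb); rewrite invrK => <-.
  by exists (rv `|wq w b| (r b)) => //; apply: pA_rv => //; apply: subrg0.
have eU : tt w *m U' = U.
  rewrite /U' mulmx_sumr; apply: eq_bigr => b _; rewrite -scalemxAr tt_bas scalerA mulrAC.
  by rewrite -expfzDr // addNr mul1r.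
have comm : tr U (ev n F) *m tt w = tt w *m tr U' (ev n F).
  by rewrite tr_conj ?eU ?tt_ev //; apply: tt_isom.
have st' := St_act hg hh comm hst.
exists e, (tr U (ev n F)), (tr U' (ev n F)).
have [hv _ _ _] := hst.
have coU b : co b U = if X b then cf b else 0 by rewrite co_comb.
have czU : cz U = 0 by rewrite cz_comb.
have bUv : Lm (bf U v).
  rewrite /bf czU mul0r mul0rn addr0; apply: (Lm_sum lr) => b _; rewrite coU.
  case: ifP => Xb; last by rewrite mul0r.
  apply: lmM; last by apply: offX; apply: hX.
  apply: Pp_LR; apply: subrgM => //; last by exists (r b).
  by apply: cst_Pol => //; apply: subrgM.
clearbody U.
have UL b : LR (co b U).
  rewrite coU; case: ifP => Xb; last by apply: subrg0.
  apply: Pp_LR; apply: subrgM => //; last by exists (r b).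
  by apply: cst_Pol => //; apply: subrgM.
have near1 : nearE e (tr U (ev n F) *m v).
  apply: vinP => [b|].
    rewrite trE qf_ev mul1r bf_evl !coE !mulr0 addr0 subr0.
    have -> : co b v - 2 * cz v * co b U - bf U v * co b U =
      (co b v - 2 * e * co b U) - (2 * co b U) * (cz v - e) - co b U * bf U v by ring.
    apply: lmB; [apply: lmB|]; [|apply: lmM|apply: lmM] => //.
      rewrite coU; case: ifP => Xb; last by rewrite mulr0 subr0; apply: offX; rewrite Xb.
      rewrite /cf (_ : 2 * e * (2^-1 * e * _) = (2 * 2^-1) * (e * e) * hev iota T (r b)); last by ring.
      by rewrite e2 mulfV // !mul1r; apply: rdiff.
    by apply: subrgM => //; apply: subrg_nat.
  rewrite trE qf_ev mul1r bf_evl !czE czU !mulr0 !subr0 !mulr1 addrAC.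
  by apply: lmD.
split=> //.
have [_ hx' _ _] := st'.
have hdiff := St_diff st'.
have : vin Lm (tt w *m (tr U' (ev n F) *m x) - e *: ev n F).
  move=> i; have := lmB (near1 i) (hdiff i); rewrite !mxE.
  by congr (Lm _); ring.
move=> hn; rewrite /nearE.
have -> : tr U' (ev n F) *m x - e *: ev n F =
    invmx (tt w) *m (tt w *m (tr U' (ev n F) *m x) - e *: ev n F).
  rewrite mulmxBr mulKmx ?tt_unit // -scalemxAr tt_inv // tt_ev //.
move=> i; rewrite mxE; apply: (Lm_sum lr) => k _; apply: lmM => //.
by rewrite tt_inv //; apply: (tt_mxin iota lr).
Qed.

(** The vector [c] is [v] at [T = 0]. By the degree bounds coordinates of weight 0 are constant
    modulo [m], and those of negative weight vanish modulo [m]. *)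
Lemma const_data w v x : St w v x -> exists2 c : 'cV[F]_(n + n + 1), vin cA c &
  [/\ qf c = 1, forall b, wq w b <= 0 -> Lm (co b v - co b c),
      forall b, wq w b < 0 -> cm (co b c) & Lm (cz v - cz c)].
Proof.
move=> hst; have [hv _ qv _] := hst.
have [V hV eV] : exists2 V : 'cV[{poly K}]_(n + n + 1), vin (pA A) V &
    v = map_mx (hev iota T) V.
  have /choice[f hf] : forall i, exists p, pA A p /\ v i 0 = hev iota T p.
    by move=> i; have [p hp e] := hv i; exists p.
  exists (\col_i f i) => [i|]; first by rewrite mxE; case: (hf i).
  by apply/colP => i; rewrite !mxE; case: (hf i).
have bound b l : wq w b < l%:Z -> m (co b V)`_l.
  have [p _ [ep hm]] := St_coord b hst; move: ep; rewrite eV co_map.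
  by move/(hev_inj Ttr) ->; apply: hm.
have boundz l : 0 < l%:Z -> m (cz V)`_l.
  have [p _ [ep hm]] := St_cz hst; move: ep; rewrite eV cz_map.
  by move/(hev_inj Ttr) ->; apply: hm.
have dif (p : {poly K}) : (forall l : nat, 0 < l%:Z -> m p`_l) ->
    Lm (hev iota T p - hev iota 0 p).
  move=> hp; rewrite hev0 -(hevC iota T) -rmorphB; apply: hev_Lm => -[|i].
    by rewrite coefB coefC subrr; apply: lr_m0 lr.
  by rewrite coefB coefC subr0; apply: hp.
exists (map_mx (hev iota 0) V).
  by move=> i; rewrite mxE hev0; exists (V i 0)`_0 => //; apply: hV.
split.
- have q1 : qf V = 1 by apply: (hev_inj Ttr); rewrite -qf_map -eV qv rmorph1.
  by rewrite qf_map q1 rmorph1.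
- move=> b hb; rewrite eV !co_map; apply: dif => l hl; apply: bound.
  exact: le_lt_trans hb hl.
- by move=> b hb; rewrite co_map hev0; exists (co b V)`_0 => //; apply: bound.
by rewrite eV !cz_map; apply: dif.
Qed.

(** If no isotropic coordinate of weight 0 is a unit, the form gives that the last coordinate has
    square 1 modulo [m], hence is 1 or -1, and [X] consists of the positive weights. Otherwise such
    a unit serves as pivot: clearing within weight 0 commutes with [tt w], makes the last coordinate
    1, and [X] gains the pivot. *)
Lemma St_near_flag w v x : St w v x -> exists g h,
  [/\ EP Pp g, St w (g *m v) (h *m x) & near_flag w (g *m v)].
Proof.
move=> hst; have [c hc [qc c1 c2 c3]] := const_data hst.
have [[b [wb [b0 hb]]]|no] :=
  pselect (exists b, wq w b = 0 /\ co b c != 0 /\ cA (co b c)^-1); last first.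
  exists 1%:M, 1%:M; rewrite !mul1mx; split=> //; first exact: EP1.
  have small b : wq w b <= 0 -> cm (co b c).
    rewrite le_eqVlt => /orP[/eqP wb|]; last exact: c2.
    by case: (cA_cases lr (hc (pos b))) => // -[h1 h2]; case: no; exists b.
  have qz : cm (cz c ^+ 2 - 1).
    rewrite -qc /qf opprD addrCA subrr addr0; apply: (cmN lr); apply: (cm_sum lr) => i _.
    have [le|gt] := leP (w i) 0.
      by rewrite mulrC; apply: (cmM lr); [apply: (hc (yc i))|apply: (small (true, i))].
    apply: (cmM lr); first exact: (hc (xc i)).
    by apply: (small (false, i)); rewrite /wq /= oppr_le0 ltW.
  have offX b : ~~ (0 < wq w b) -> Lm (co b v).
    rewrite -leNgt => hb; rewrite -[co b v](subrK (co b c)); apply: lmD; first exact: c1.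
    by apply: cm_Lm; apply: small.
  have dual b : 0 < wq w b -> ~~ (0 < wq w (star b)).
    by move=> h; rewrite wq_star -leNgt oppr_le0 ltW.
  have hz : cA (cz c) by apply: hc.
  have [h|[h h']] := cA_cases lr (subrgB scA hz (subrg1 scA)).
    exists 1, (fun b => 0 < wq w b); split=> //; first by left.
      by move=> b; apply: ltW.
    by rewrite -[cz v](subrK (cz c)) -addrA; apply: lmD => //; apply: cm_Lm.
  exists (-1), (fun b => 0 < wq w b); split=> //; first by right.
    by move=> b; apply: ltW.
  rewrite opprK -[cz v](subrK (cz c)) -addrA; apply: lmD => //; apply: cm_Lm.
  rewrite -[cz c + 1](mulKf h'); apply: (cmM lr) => //.
  by rewrite -subr_sqr expr1n.
pose S d := (wq w d == 0) && offb b d.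
pose om := pivv S b 1 c.
have ws : wq w (star b) = 0 by rewrite wq_star wb oppr0.
have omb : co b om = 0 by rewrite pivv_co /S /offb eqxx andbF.
have hom : vin cA om.
  apply: vinP => [d|]; rewrite ?pivv_co ?pivv_cz.
    by case: ifP => _; [apply: opA; apply: subrgM => //; apply: hc|apply: subrg0].
  by apply: subrgM => //; apply: subrgB => //; [apply: subrg1|apply: hc].
pose be := tr (bas (star b)) om.
have hbe : EP cA be by apply: EP_tr_vin; rewrite ?starK.
have comm : be *m tt w = tt w *m be.
  rewrite /be [RHS]tr_conj; last exact: tt_isom.
  rewrite tt_bas ws expr0z scale1r (_ : tt w *m om = om) //.
  apply: colext => [d|]; rewrite ?tt_co ?tt_cz // pivv_co /S.
  by case: eqP => [->|_] /=; rewrite ?expr0z ?mul1r ?mulr0.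
have hbp : EP Pp be by apply: EP_mono hbe => p; apply: cst_Pol.
have hbm : EP Pm be by apply: EP_mono hbe => p; apply: cst_Pol.
have st' := St_act hbp hbm comm hst.
exists be, be; split=> //.
have cb : cA (co b c) by apply: hc.
have bv : Lm (co b v - co b c) by apply: c1; rewrite wb.
have zv : Lm (cz (be *m v) - 1).
  rewrite trE bf_basl starK !czE !mulr0 !subr0 pivv_cz.
  have -> : cz v + co b v * ((1 - cz c) / co b c) - 1 =
     (cz v - cz c) + (1 - cz c) / co b c * (co b v - co b c).
    by field.
  apply: lmD => //; apply: lmM => //; apply: cA_LR; apply: subrgM => //.
  by apply: subrgB => //; [apply: subrg1|apply: hc].
have Sv d : S d -> Lm (co d (be *m v)).
  move=> Sd; have /andP[/eqP wd /andP[n1 n2]] := Sd.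
  rewrite trE bf_basl starK !coE (negPf n2) !mulr0 !subr0 pivv_co Sd.
  have -> : co d v + co b v * - (co d c / co b c) =
     (co d v - co d c) - co d c / co b c * (co b v - co b c) by field.
  apply: lmB; first by apply: c1; rewrite wd.
  by apply: lmM => //; apply: cA_LR; apply: subrgM => //; apply: hc.
have bbv : co b (be *m v) = co b v.
  by rewrite trE bf_basl starK !coE omb eq_sym (negPf (star_neq b)) !mulr0 addr0 !subr0.
clearbody be; clear om omb hom hbe hbp hbm comm.
have [c' hc' [qc' c1' c2' c3']] := const_data st'.
have Lmc y y' : cA y' -> Lm (y - y') -> Lm y -> cm y'.
  move=> hy hd hy'; apply: (Lm_cst Ttr (A := A)) => //.
  by have := lmB hy' hd; rewrite opprB addrC subrK.
have cc : cm (co b c' - co b c).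
  apply: (Lm_cst Ttr (A := A)); first by apply: subrgB => //; apply: hc'.
  have := c1' b; rewrite wb bbv => /(_ (lexx _)) h.
  have -> : co b c' - co b c = (co b v - co b c) - (co b v - co b c') by ring.
  exact: lmB.
have ucb : cA (co b c')^-1 /\ co b c' != 0.
  case: (cA_cases lr (hc' (pos b))) => // bad.
  case: (cm1 lr (iota := iota)).
  rewrite -(mulVf b0); apply: (cmM lr) => //.
  have := cmD lr bad (cmN lr cc).
  by rewrite -[c' (pos b) 0]/(co b c') opprB addrC subrK.
have Sc d : S d -> cm (co d c').
  move=> Sd; apply: (Lmc (co d (be *m v))); [exact: hc'| |exact: Sv].
  by apply: c1'; have /andP[/eqP -> _] := Sd.
have zc' : cm (cz c' - 1).
  apply: (Lm_cst Ttr (A := A)); first by apply: subrgB => //; [apply: hc'|apply: subrg1].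
  have -> : cz c' - 1 = (cz (be *m v) - 1) - (cz (be *m v) - cz c') by ring.
  exact: lmB.
(* The remaining products in the form lie in [m]: for a non-zero weight one factor has negative
   weight, and for weight 0 the factors were cleared. The form and the last coordinate being 1
   modulo [m], the product with the unit at [b] is in [m] too. *)
have sc : cm (co (star b) c').
  rewrite -[co (star b) c'](mulKf ucb.2); apply: (cmM lr); first exact: ucb.1.
  have e : co b c' * co (star b) c' = c' (xc b.2) 0 * c' (yc b.2) 0.
    by case: (b) => -[] i; rewrite /co /pos /star /= // mulrC.
  have -> : co b c' * co (star b) c' =
      - (\sum_(i < n | i != b.2) c' (xc i) 0 * c' (yc i) 0) - (cz c' + 1) * (cz c' - 1).
    have := qc'; rewrite /qf (bigD1 b.2) //= e.
    set s := \sum_(i < n | _) _; set t := _ * _; move=> h.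
    have -> : t = 1 - s - cz c' ^+ 2 by rewrite -h; ring.
    ring.
  apply: (cmD lr); apply: (cmN lr); last first.
    by apply: (cmM lr) => //; apply: subrgD => //; [apply: hc'|apply: subrg1].
  apply: (cm_sum lr) => i ne.
  have [lt|gt|e0] := ltgtP (w i) 0.
  - by rewrite mulrC; apply: (cmM lr); [apply: (hc' (yc i))|apply: (c2' (true, i))].
  - apply: (cmM lr); first exact: (hc' (xc i)).
    by apply: (c2' (false, i)); rewrite /wq /= oppr_lt0.
  apply: (cmM lr); first exact: (hc' (xc i)).
  apply: (Sc (false, i)); rewrite /S /wq /= e0 oppr0 eqxx /offb /star !pair_neq /= (negPf ne).
  by rewrite !andbF.
have dbig d : wq w d <= 0 -> cm (co d c') -> Lm (co d (be *m v)).
  move=> wd hd; rewrite -[co d _](subrK (co d c')); apply: lmD; first exact: c1'.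
  exact: cm_Lm.
exists 1, (fun d => (0 < wq w d) || (d == b)); split=> //.
- by left.
- move=> d /orP[h|/eqP ->].
    rewrite wq_star negb_or -leNgt oppr_le0 (ltW h) /=; apply/eqP => e.
    by move: h; rewrite -[d]starK e ws ltxx.
  by rewrite ws ltxx (negPf (star_neq b)).
- by move=> d /orP[/ltW //|/eqP ->]; rewrite wb.
move=> d; rewrite negb_or -leNgt => /andP[wd n1].
have [e|n2] := eqVneq d (star b); first by rewrite e; apply: dbig; rewrite ?ws.
move: wd; rewrite le_eqVlt => /orP[/eqP w0|lt].
  by apply: Sv; rewrite /S w0 eqxx /offb n1 n2.
by apply: dbig; [apply: ltW|apply: c2'].
Qed.

Lemma Pm_Lm_ideal z : Pm z -> Lm z -> Pol iota m T^-1 z.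
Proof. by move=> [p hp ->] /(LmV_coef lr T0 Ttr) hm; exists p. Qed.

(** * Denominators congruent to 1 modulo the maximal ideal *)

Section Denominator.
Variable d0 : {poly K}.
Hypotheses (hd0 : pA A d0) (d01 : pA m (d0 - 1)).
Local Notation d := (hev iota T^-1 d0).
Local Notation I := (Pol iota m T^-1).

Lemma den_neq0 : d != 0.
Proof.
apply/eqP => e0.
have h1 : Lm (d - 1).
  by rewrite -(rmorph1 (hev iota T^-1)) -rmorphB; apply: (Polm_Lm lr) => //; exists (d0 - 1).
case: (cm1 lr (iota := iota)); apply: (Lm_cst Ttr (A := A)); first exact: subrg1.
by have := lmN h1; rewrite e0 sub0r opprK.
Qed.

(** The constant term of [d0] is a unit of [A], so [d] is invertible modulo [1/T]. *)
Lemma den_bezout : exists u w, [/\ Pm u, Pm w & u * T^-1 + w * d = 1].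
Proof.
have hA : A d0`_0 by apply: hd0.
have hi : A (d0`_0)^-1 /\ d0`_0 != 0.
  have nm : ~ m d0`_0.
    move=> hm; apply: (lr_m1 lr); rewrite -[1](subKr d0`_0); apply: (lr_mD lr) => //.
    rewrite -mulN1r; apply: (lr_mM lr); first by apply: subrgN => //; apply: subrg1.
    by have := d01 0%N; rewrite coefB coef1.
  split; first by case: (lr_inv lr hA).
  by apply/eqP => e0; apply: nm; rewrite e0; apply: lr_m0 lr.
pose c := iota d0`_0; pose e1 := hev iota T^-1 (drop_poly 1 d0).
have c0 : c != 0 by rewrite fmorph_eq0; case: hi.
have hci : Pm c^-1.
  by apply: cst_Pol => //; exists (d0`_0)^-1; [case: hi|rewrite fmorphV].
have he1 : Pm e1 by exists (drop_poly 1 d0) => // i; rewrite coef_drop_poly.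
have ed : d = c + e1 * T^-1.
  rewrite -{1}(poly_take_drop 1 d0) rmorphD rmorphM expr1 hevX; congr (_ + _).
  rewrite (_ : take_poly 1 d0 = (d0`_0)%:P) ?hevC //.
  by apply/polyP => -[|i]; rewrite coef_take_poly coefC.
exists (- (c^-1 * e1)), c^-1; split=> //.
  by apply: opm'; apply: subrgM.
by rewrite ed; field; rewrite T0 c0.
Qed.

Lemma den_Pm : Pm d. Proof. by exists d0. Qed.

(** The element is cleared both by a power of [d] and by a power of [1/T], and these are comaximal
    in [A[1/T]]. *)
Lemma loc_LR_Pm z : loc Pm d z -> LR z -> Pm z.
Proof.
move=> [k hk] /(loc_inv sA T0)[j hj]; have [u [w [hu hw e]]] := den_bezout.
have [U [W [hU hW E]]] := bezout_pow sPm Sm den_Pm hu hw e j k.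
rewrite -[z]mul1r -E mulrDl -!mulrA; apply: subrgD => //; exact: subrgM.
Qed.

Lemma TzS (z : int) : Pm (T^-1 ^+ `|z| * T ^ z).
Proof.
rewrite exprVn exprnN -expfzDr //; apply: (Tz_Pm iota lr); lia.
Qed.

Lemma locI_div z y : I y -> loc I (T^-1 * d) (T ^ z * (y / d)).
Proof.
move=> hy; exists (`|z|.+1)%N; rewrite /lk exprMn.
have -> : T^-1 ^+ `|z|.+1 * d ^+ `|z|.+1 * (T ^ z * (y / d)) =
    (T^-1 * (T^-1 ^+ `|z| * T ^ z) * d ^+ `|z|) * y.
  by rewrite !exprS; field; rewrite T0 den_neq0.
apply: (Pol_idealM lr) => //; apply: subrgM => //; last by apply: subrgX => //; apply: den_Pm.
by apply: subrgM => //; apply: TzS.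
Qed.

End Denominator.

(* The coordinate [d] of the transformed [x] is a unit at [T = oo], so [x] is
   elementary equivalent to [e *: ev] over [A[1/T]] localized at [d], with parameters
   in [m]; the parts of these parameters that are divisible by a high power of
   [1/T] are moved to the right. *)
Lemma near_orbit w v x e : e = 1 \/ e = -1 -> St w v x -> nearE e x -> Orb v.
Proof.
move=> he hst hn; have [hv hx qv [mu hmu ev_]] := hst.
have e2 : e * e = 1 by case: he => ->; rewrite ?mulr1 ?mulrNN ?mulr1.
have e0 : e != 0 by case: he => ->; rewrite ?oppr_eq0 oner_eq0.
have eA : cA e by case: he => ->; [|apply: opA]; apply: subrg1.
have EtT := Nn_Et lr T0 hmu.
have qx : qf x = 1.
  by rewrite -qv ev_ (Et_isom T0 EtT) tt_isom.
have b : bool * 'I_n by case: (n) n_ge2 => // n' _; exact: (true, ord0).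
(* Chosen so that [de] sends [e *: ev] to [e *: ev + bas b]: the coordinate of [y] at [b] is
   congruent to 1 and can be used as a pivot. *)
pose lam := - (2^-1 * e).
have hlam : cA lam by apply: opA; apply: subrgM.
pose de := tr (bas b) (lam *: ev n F).
have hde : EP cA de by apply/EP_egen/egen_short.
have ude := EP_unit hde.
have dee : de *m (e *: ev n F) = e *: ev n F + bas b.
  rewrite -scalemxAr short_ev scalerBr scalerA -scaleNr.
  rewrite (_ : - (e * (2 * lam)) = (2 * 2^-1) * (e * e)); last by rewrite /lam; ring.
  by rewrite e2 mulfV // mulr1 scale1r.
pose y := de *m x.
have hdeM : mxin LR de by apply: (EPcA_mxin lr).
have hy : vin Pm y.
  by apply: EP_vin => //; apply: EP_mono hde => p; apply: cst_Pol.
have qy : qf y = 1 by rewrite (EP_isom hde).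
have ny : vin Lm (y - (e *: ev n F + bas b)).
  rewrite -dee /y -mulmxBr => i; rewrite mxE; apply: (Lm_sum lr) => k _.
  by apply: lmM.
have eyx : x = invmx de *m y by rewrite mulKmx.
clearbody y.
have [d0 hd0 ed] := hy (pos b); rewrite -[y (pos b) 0]/(co b y) in ed.
have Ld1 : Lm (co b y - 1).
  by have := ny (pos b); rewrite -[_ (pos b) 0]/(co b _) !coE eqxx mulr0 add0r.
have d01 : pA m (d0 - 1).
  by apply: (LmV_coef lr T0 Ttr); rewrite rmorphB rmorph1 -ed.
have dn0 := den_neq0 d01.
have Iy i : i != b -> Pol iota m T^-1 (co i y).
  move=> ne; apply: Pm_Lm_ideal; first exact: hy.
  by have := ny (pos i); rewrite -[_ (pos i) 0]/(co i _) !coE (negPf ne) mulr0 addr0 subr0.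
have Iz : Pol iota m T^-1 (e - cz y).
  apply: Pm_Lm_ideal; first by apply: subrgB => //; [apply: cst_Pol|apply: hy].
  by have := lmN (ny (zc n)); rewrite -[_ (zc n) 0]/(cz _) !czE mulr1 addr0 opprB.
have Id : Pol iota m T^-1 (co b y - 1).
  apply: Pm_Lm_ideal => //; apply: subrgB => //; [exact: hy|exact: subrg1].
set d := hev iota T^-1 d0 in ed dn0.
pose om := pivv (offb b) b e y.
have omb : co b om = 0 by rewrite pivv_co /offb eqxx.
pose g1 := tr (bas (star b)) om.
(* Only the excess [d - 1] of the pivot is removed, which keeps the parameter in the ideal generated
   by [m]; the target is [de *m (e *: ev)] and not [e *: ev]. *)
pose lam' := (d - 1) / (2 * e).
pose g2 := tr (bas b) (lam' *: ev n F).
have u1 : g1 \in unitmx by apply: tr_unit; rewrite ?qf_bas ?bf_basl ?starK.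
have u2 : g2 \in unitmx by apply: tr_unit; rewrite ?qf_bas ?short_orth.
have eg : g2 *m (g1 *m y) = de *m (e *: ev n F).
  rewrite /g1 pivot_full ?ed ?qy //.
  rewrite -(subrK (1 : F) d) scalerDl addrAC mulmxDr short_kill // scale1r short_bas.
  by rewrite (negPf (star_neq b)) !mul0r !scale0r addr0 subr0 dee.
pose Gin := invmx g1 *m invmx g2.
have exx : x = invmx de *m (Gin *m (de *m (e *: ev n F))).
  by rewrite -eg /Gin -!mulmxA mulKmx // mulKmx.
have ut : tt w \in unitmx by apply: tt_unit.
pose G := cj (tt w) Gin.
have it := tt_isom T0 w.
have hG : EP (loc (Pol iota m T^-1) (T^-1 * d)) G.
  rewrite /G /Gin cjM //; apply: EP_mul.
    rewrite /g1 invmx_tr ?qf_bas ?bf_basl ?starK // cj_tr // tt_bas trZ.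
    have lz : loc (Pol iota m T^-1) (T^-1 * d) 0.
      exists 0%N; rewrite /lk mulr0; exists 0; rewrite ?rmorph0 // => i.
      by rewrite coef0; apply: lr_m0 lr.
    apply: EP_tr => [i||].
    - rewrite coZ tt_co coN pivv_co; case: ifP => h; last by rewrite oppr0 !mulr0.
      rewrite opprK mulrA -expfzDr // ed; apply: locI_div => //; apply: Iy.
      by case/andP: h.
    - rewrite czZ tt_cz czN pivv_cz ed -mulNr; apply: locI_div => //.
      by rewrite -mulN1r; apply: (Pol_idealM lr) => //; apply: opm'; apply: subrg1.
    by rewrite coZ tt_co coN starK omb oppr0 !mulr0.
  rewrite /g2 invmx_tr ?qf_bas ?short_orth // cj_tr // tt_bas trZ mulmxN -scalemxAr tt_ev.
  rewrite -scaleNr scalerA; apply/EP_egen/egen_short.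
  have -> : T ^ wq w b * - lam' = T ^ wq w b * ((- (2^-1 * e) * d * (d - 1)) / d).
    rewrite /lam' -[in LHS](mulr1 (d - 1)) -e2; field.
    by rewrite two0 e0 dn0.
  apply: locI_div => //; rewrite -ed; apply: (Pol_idealM lr) => //.
  by apply: subrgM => //; [apply: cst_Pol|apply: hy].
pose dt := cj (tt w) de.
have edt : dt = tr (bas b) ((T ^ wq w b * lam) *: ev n F).
  by rewrite /dt cj_tr // tt_bas -scalemxAr tt_ev trZ scalerA.
have udt : dt \in unitmx by rewrite edt; apply: tr_unit; rewrite ?qf_bas ?short_orth.
have sPd : subrg (loc Pm d) by apply: loc_subrg => //; apply: den_Pm.
have hdti (P' : F -> Prop) : P' (- (T ^ wq w b * lam)) -> EP P' (invmx dt).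
  move=> hP'; rewrite edt invmx_tr ?qf_bas ?short_orth // -scaleNr.
  exact/EP_egen/egen_short.
have hdt1 : EP (loc (loc Pm d) T^-1) (invmx dt).
  apply: hdti; exists `|wq w b|%N; rewrite /lk mulrN mulrA -mulrN; apply: loc_P.
  by apply: subrgM => //; [apply: TzS|apply: opm'; apply: cst_Pol].
have hdt2 : EP LR (invmx dt).
  apply: hdti; rewrite -mulrN; apply: subrgM => //; first exact: (TzLR iota lr).
  by apply: cA_LR; apply: opA.
have hdtE : Et (invmx dt) by apply: (EP_LR_Et lr).
have half1 : loc Pm d 2^-1 by apply: loc_P; apply: cst_Pol.
have h22 : 2^-1 * 2 = 1 :> F by rewrite mulVf.
(* The power of [1/T] used up by conjugation with [invmx dt], which has a power of [T] as
   denominator; it must be known before [G] is split. *)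
have [M hM] := dilation n_ge2 sPd (loc_P d Sm) half1 h22 0 hdt1.
have [bu [bw [hbu hbw ebz]]] := den_bezout hd0 d01.
have half2 : Pm 2^-1 by apply: cst_Pol.
have IPm z : Pol iota m T^-1 z -> Pm z.
  by apply: Pol_mono => a; apply: lr_mA lr a.
have IMm c z : Pm c -> Pol iota m T^-1 z -> Pol iota m T^-1 (c * z).
  exact: (Pol_idealM lr).
have [a [bb [ha hbb eG]]] := coprime_split n_ge2 sPm Sm (den_Pm hd0) half2 h22 hbu hbw ebz IPm IMm M hG.
(* The left factor [a] has parameters in [m] over [A[T, 1/T]], so its conjugate joins the normal
   closure; the right factor stays over [A[1/T]] localized at [d]. *)
pose mu2 := mu *m cj (invmx dt) a.
have hmu2 : Nn mu2.
  apply: Nn_mul => //; apply: Nn_cj => //; apply: Nn_EPm => //; apply: EP_mono ha => z [k hk].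
  have -> : z = T ^+ k * (T^-1 ^+ k * z) by rewrite mulrA -exprMn mulfV // expr1n mul1r.
  apply: lmM; first by apply: subrgX => //; apply: Pp_LR.
  exact: (Polm_Lm lr).
pose w3 := cj (invmx dt) bb *m (e *: ev n F).
have hw3 : vin (loc Pm d) w3.
  apply: EP_vin => //.
    by apply: EP_mono (hM _ hbb) => z [z' hz' ->]; rewrite expr0 mul1r.
  by apply: vinZ => //; [apply: loc_P; apply: cst_Pol|apply: vin_ev].
have evw3 : v = mu2 *m w3.
  rewrite ev_ exx /mu2 /w3 -[mu *m _ *m _]mulmxA; congr (_ *m _).
  have -> : tt w *m (invmx de *m (Gin *m (de *m (e *: ev n F)))) =
     cj (tt w) (invmx de) *m (G *m (dt *m (tt w *m (e *: ev n F)))).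
    by rewrite /G /dt /cj !mulmxA !mulmxKV.
  have -> : cj (tt w) (invmx de) = invmx dt by rewrite /dt cj_inv.
  have cjs (D X Y : 'M[F]_(n + n + 1)) (z : 'cV[F]_(n + n + 1)) : D \in unitmx ->
      invmx D *m ((X *m Y) *m (D *m z)) = cj (invmx D) X *m (cj (invmx D) Y *m z).
    by move=> uD; rewrite /cj invmxK -!mulmxA (mulKVmx uD).
  by rewrite -scalemxAr tt_ev eG cjs.
have hmu2E := Nn_Et lr T0 hmu2.
have umu2 := Nn_unit T0 hmu2.
have hw3' : vin Pm w3.
  move=> i; apply: (loc_LR_Pm hd0 d01); first exact: hw3.
  have -> : w3 = invmx mu2 *m v by rewrite evw3 mulKmx.
  apply: (mxin_vin sLR); first by apply: (Et_mxin lr) => //; apply: (Et_inv lr).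
  by move=> k; apply: Pp_LR.
have [yp [ym [hyp _ hym _ emu]]] := Nn_congr_split n_ge2 lr T0 Ttr hmu2.
have uyp := EP_unit hyp.
(* Its entries are polynomial in [T] by this formula and in [1/T] by [ym *m w3], hence constant. *)
pose z := invmx yp *m v.
have ez : z = ym *m w3 by rewrite /z evw3 emu -mulmxA mulKmx.
have hz : vin cA z.
  move=> i; apply: Pp_Pm_cst; first by apply: EP_vin => //; apply: EP_inv.
  by rewrite ez; apply: EP_vin.
have qz : qf z = 1.
  by rewrite /z (EP_isom (EP_inv opp' hyp)).
have [h hh eh] := const_orbit n_ge2 lr hz qz.
exists (h *m invmx yp); last by rewrite -mulmxA.
by apply: EP_mul; [apply: EP_mono hh => p; apply: cst_Pol|apply: EP_inv].
Qed.

Lemma local_orbit_frac v x a : vin Pp v -> vin Pm x -> qf v = 1 -> EP LR a -> v = a *m x ->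
  Orb v.
Proof.
move=> hv hx qv ha ev_; have [ap [mu [w [c [hap hmu hc ea]]]]] := birkhoff n_ge2 lr T0 ha.
have uap := EP_unit hap; have hapi := EP_inv opp' hap.
have st : St w (invmx ap *m v) (c *m x).
  split; [exact: EP_vin|exact: EP_vin|by rewrite (EP_isom hapi)|exists mu => //].
  by rewrite ev_ ea -!mulmxA mulKmx.
apply: (Orb_EP hapi); have [g [h [hg st1 fc]]] := St_near_flag st.
apply: (Orb_EP hg); have [e [g' [h' [he hg' st2 _ nx]]]] := St_kill st1 fc.
by apply: (Orb_EP hg'); apply: near_orbit he st2 nx.
Qed.

Theorem local_orbit (v x : 'cV[{poly K}]_(n + n + 1)) a : vin (pA A) v -> vin (pA A) x ->
  qf v = 1 -> EP LR a -> map_mx (hev iota T) v = a *m map_mx (hev iota T^-1) x ->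
  exists2 g, EP (pA A) g & g *m v = ev n {poly K}.
Proof.
move=> hv hx qv ha e.
have [g hg eg] : Orb (map_mx (hev iota T) v).
  apply: local_orbit_frac ha e => [i|i|]; first by rewrite mxE; exists (v i 0).
    by rewrite mxE; exists (x i 0).
  by rewrite qf_map qv rmorph1.
have [g0 hg0 eg0] : exists2 g0, EP (pA A) g0 & map_mx (hev iota T) g0 = g.
  by apply: EP_lift hg => p [q hq ->]; exists q.
exists g0 => //; move: eg; rewrite -eg0 -map_mxM -(map_ev n (hev iota T)) => eg.
apply/colP => i; apply: (hev_inj Ttr).
by move/colP: eg => /(_ i); rewrite !mxE.
Qed.

End LocalOrbit.

(** * Local-global principle *)

Lemma egen_diff (n : nat) (R : comNzRingType) (R' : comUnitRingType)
    (phi psi : {rmorphism R -> R'}) (P : R -> Prop) (Q : R' -> Prop) (t : 'M[R]_(n + n + 1)) :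
  (forall p, P p -> Q (phi p - psi p)) -> egen P t ->
  egen Q (map_mx phi t *m invmx (map_mx psi t)).
Proof.
move=> h [b b' p /h hp h1 h2|b p /h hp]; rewrite !map_tr !map_mxZ ?map_bas ?map_ev.
  rewrite invmx_tr ?qf_bas ?long_orth // -scaleNr trD ?qf_bas ?long_orth // -scalerDl.
  exact: egen_long.
rewrite invmx_tr ?qf_bas ?short_orth // -scaleNr trD ?qf_bas ?short_orth // -scalerDl.
exact: egen_short.
Qed.

Section Substitution.
Variables (K : fieldType) (A : K -> Prop).
Hypothesis sA : subrg A.
Let sP : subrg (pA A) := pA_subrg sA.

Lemma pA_CA c : A c -> pA A c%:P.
Proof. by apply: pA_C; apply: subrg0. Qed.

Lemma pA_comp p a : pA A p -> pA A a -> pA A (p \Po a).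
Proof.
move=> hp ha; rewrite comp_polyE; apply: (subrg_sum sP) => i _; rewrite -mul_polyC.
by apply: (subrgM sP); [apply: pA_CA|apply: (subrgX sP)].
Qed.

Lemma pA_comp_diff p a c : pA A p -> pA A a -> pA A c ->
  exists2 r, pA A r & (p \Po (a + c)) - (p \Po a) = c * r.
Proof.
move=> hp ha hc; rewrite !comp_polyE -sumrB.
elim: (size p) => [|k [r hr e]].
  by exists 0; [apply: (subrg0 sP)|rewrite big_ord0 mulr0].
rewrite big_ord_recr /= e.
have [q hq eq] : exists2 q, pA A q & (a + c) ^+ k - a ^+ k = c * q.
  elim: (k) => [|j [q hq ej]].
    by exists 0; [apply: (subrg0 sP)|rewrite !expr0 subrr mulr0].
  exists ((a + c) ^+ j + a * q).
    apply: (subrgD sP); first by apply: (subrgX sP); apply: (subrgD sP).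
    exact: (subrgM sP).
  by rewrite !exprS mulrDr [c * (a * q)]mulrCA -ej; ring.
exists (r + (p`_k)%:P * q).
  by apply: (subrgD sP) => //; apply: (subrgM sP) => //; apply: pA_CA.
by rewrite -scalerBr eq -mul_polyC; ring.
Qed.

End Substitution.

Section LocalGlobal.
Variables (n : nat) (K : fieldType) (A : K -> Prop).
Hypotheses (n_ge2 : (2 <= n)%N) (sA : subrg A) (hA : A 2^-1) (two0 : (2 : K) != 0).
Let sP : subrg (pA A) := pA_subrg sA.
Local Notation P := (pA A).
Implicit Types (a b : {poly K}) (s : K).

(* The bound [M0] must not depend on [a] and [b]. *)
Lemma subst_close s g N : A s -> s != 0 -> EP (loc P s%:P) g ->
  exists M0, forall M, (M0 <= M)%N -> forall a b, P a -> P b ->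
  EP (scl P s%:P N)
    (map_mx (comp_poly (a + s%:P ^+ M * b)) g *m invmx (map_mx (comp_poly a) g) : 'M_(n + n + 1)).
Proof.
move=> hs s0 hg; have Ps : P s%:P by apply: pA_CA.
elim: hg N => [|t g' ht hg' IH] N.
  by exists 0%N => M _ a b _ _; rewrite !map_mx1 invmx1 mulmx1; apply: EP1.
have [k htk] : exists k, egen (lk P s%:P k) t.
  by case: ht => [b b' p [k hk] h1 h2|b p [k hk]]; exists k;
    [apply: egen_long|apply: egen_short].
have h22 : (2^-1)%:P * 2 = 1 :> {poly K}.
  by rewrite -[2]/(2%:R) -polyC_natr -polyCM mulVf.
have [M1 hM1] := gen_conj n_ge2 sP Ps (pA_CA sA hA) h22 k N.
have [M2 hM2] := IH M1.
(* [M2] serves the remaining factors; [N + k] serves the difference of the two substitutions in [t],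
   whose denominator is at most [s ^+ k]. *)
exists (maxn M2 (N + k)) => M; rewrite geq_max => /andP[le1 le2] a b Pa Pb.
set a' := a + _; have Pa' : P a'.
  by apply: (subrgD sP) => //; apply: (subrgM sP) => //; apply: (subrgX sP).
have sub_lk c p : P c -> lk P s%:P k p -> lk P s%:P k (p \Po c).
  move=> Pc hp; have := pA_comp sA hp Pc.
  by rewrite /lk rmorphM rmorphXn /= comp_polyC.
have ht' c : P c -> egen (lk P s%:P k) (map_mx (comp_poly c) t).
  by move=> Pc; apply: egen_map htk => p; apply: sub_lk.
have ut c : P c -> map_mx (comp_poly c) t \in unitmx by move=> /ht'/egen_unit.
have ug c : map_mx (comp_poly c) g' \in unitmx.
  by apply: (@EP_unit _ _ setT); apply: EP_map hg'.
rewrite !map_mxM invmx_mul; [|exact: ut|exact: ug].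
set t1 := map_mx _ t; set t0 := map_mx (comp_poly a) t; set X := map_mx _ g'; set Y := invmx _.
have -> : t1 *m X *m (Y *m invmx t0) = cj t1 (X *m Y) *m (t1 *m invmx t0).
  by rewrite /cj !mulmxA mulmxKV // ut.
apply: EP_mul; first by apply: hM1; [apply: ht'|apply: hM2].
apply: EP_egen; apply: egen_diff htk => p hp /=.
have [r hr er] := pA_comp_diff sA hp Pa (subrgM sP (subrgX sP M Ps) Pb).
exists (s%:P ^+ (M - (N + k)) * b * r).
  by apply: (subrgM sP) => //; apply: (subrgM sP) => //; apply: (subrgX sP).
apply: (@mulfI _ (s%:P ^+ k)); first by rewrite expf_neq0 // polyC_eq0.
move: er; rewrite !rmorphM !rmorphXn /= !comp_polyC -/a' -mulrBr => ->.
by rewrite -{1}(subnKC le2) !exprD; ring.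
Qed.

(** Membership in Quillen's ideal of [v]. The base point [a] and the direction [b] are arbitrary so
    that two increments can be performed in succession, which gives closure under sums. *)
Definition same_subst (v : 'cV[{poly K}]_(n + n + 1)) s := A s /\ forall a b, P a -> P b ->
  exists2 g, EP P g & g *m map_mx (comp_poly (a + s%:P * b)) v = map_mx (comp_poly a) v.

(** Write [v] as [h] applied to [ev]. As [ev] is constant, the quotient of two substitution
    instances of [h] relates those of [v], and [subst_close] removes its denominators when the
    substitutions agree modulo a high power of [s]. *)
Lemma same_subst_loc v s g : A s -> s != 0 -> EP (loc P s%:P) g -> g *m v = ev n {poly K} ->
  exists M, same_subst v (s ^+ M).
Proof.
move=> hs s0 hg e; have Ps : P s%:P by apply: pA_CA.
have ug := EP_unit hg.
have ol : oppc (loc P s%:P) by move=> p hp; apply: (subrgN (loc_subrg sP Ps)).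
have op : oppc P by move=> p hp; apply: (subrgN sP).
have [M hM] := subst_close 0 hs s0 (EP_inv ol hg).
exists M; split; first exact: subrgX.
move=> a b Pa Pb; rewrite polyC_exp.
have := hM M (leqnn _) a b Pa Pb; set a' := a + _; set h := invmx g => hh.
have ev' : v = h *m ev n {poly K} by rewrite -e mulKmx.
have uh c : map_mx (comp_poly c) h \in unitmx.
  by apply: (@EP_unit _ _ setT); apply: EP_map (EP_inv ol hg).
have {}hh := EP_mono (@scl_P _ _ _ sP Ps 0) hh.
exists (invmx (map_mx (comp_poly a') h *m invmx (map_mx (comp_poly a) h))).
  exact: EP_inv.
rewrite invmx_mul ?unitmx_inv ?uh // invmxK ev' !map_mxM !map_ev -!mulmxA.
by rewrite mulKmx // uh.
Qed.

Lemma same_substD v s s' : same_subst v s -> same_subst v s' -> same_subst v (s + s').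
Proof.
move=> [hs h] [hs' h']; split; first exact: subrgD.
move=> a b Pa Pb.
have Pc : P (a + s%:P * b) by apply: (subrgD sP) => //; apply: (subrgM sP) => //; apply: pA_CA.
have [g hg eg] := h a b Pa Pb; have [g' hg' eg'] := h' _ b Pc Pb.
exists (g *m g'); first exact: EP_mul.
by rewrite polyCD mulrDl addrA -mulmxA eg' eg.
Qed.

Lemma same_substM v c s : A c -> same_subst v s -> same_subst v (c * s).
Proof.
move=> hc [hs h]; split; first exact: subrgM.
move=> a b Pa Pb; rewrite (mulrC c) polyCM -mulrA; apply: h => //.
by apply: (subrgM sP) => //; apply: pA_CA.
Qed.

Lemma same_subst0 v : same_subst v 0.
Proof.
split; first exact: subrg0.
by move=> a b _ _; exists 1%:M; rewrite ?mul0r ?addr0 ?mul1mx //; apply: EP1.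
Qed.

(** * Maximal ideals of [A] and localization at them *)

Section MaximalIdeal.
Variable J : K -> Prop.
Hypotheses (J0 : J 0) (JA : forall x, J x -> A x).
Hypotheses (JD : forall x y, J x -> J y -> J (x + y)) (JM : forall c x, A c -> J x -> J (c * x)).
Hypothesis J1 : ~ J 1.

Lemma exists_maximal_ideal : exists p : K -> Prop,
  [/\ p 0 /\ (forall x, J x -> p x), forall x, p x -> A x,
      (forall x y, p x -> p y -> p (x + y)) /\ (forall c x, A c -> p x -> p (c * x)), ~ p 1 &
      forall x, A x -> ~ p x -> exists y z, [/\ A y, p z & y * x + z = 1]].
Proof.
pose ideal (X : set K) := [/\ forall x, X x -> A x, forall x y, X x -> X y -> X (x + y),
  forall c x, A c -> X x -> X (c * x) & ~ X 1].
pose Q (X : set K) := ideal X /\ ((exists x, X x) -> forall x, J x -> X x).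
have [F FQ Ft|p [[[pA' pD pM p1] pJ] pmax]] := @Zorn_bigcup K Q.
  split; last first.
    move=> [x [X FX Xx]] y Jy; exists X => //.
    by have [_ h] := FQ _ FX; apply: h Jy; exists x.
  split=> [x [X FX Xx]|x y [X FX Xx] [Y FY Yy]|c x hc [X FX Xx]|[X FX Xx]].
  - by have [[h _ _ _] _] := FQ _ FX; apply: h.
  - case: (Ft _ _ FX FY) => h.
      by exists Y => //; have [[_ hD _ _] _] := FQ _ FY; apply: hD => //; apply: h.
    by exists X => //; have [[_ hD _ _] _] := FQ _ FX; apply: hD => //; apply: h.
  - by exists X => //; have [[_ _ hM _] _] := FQ _ FX; apply: hM.
  by have [[_ _ _ h1] _] := FQ _ FX; apply: h1.
have pne : exists x, p x.
  apply: contrapT => np; apply: (pmax J); last by split.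
  split=> [x px|sub]; first by case: np; exists x.
  by apply: np; exists 0; apply: sub.
have p0 : p 0 by apply: pJ.
exists p; split=> //; first by split=> //; apply: pJ.
move=> x Ax npx; apply: contrapT => no.
pose X (r : K) := exists y z, [/\ A y, p z & r = y * x + z].
apply: (pmax X).
  split=> [z pz|]; first by exists 0, z; split=> //; [apply: subrg0|rewrite mul0r add0r].
  move=> sub; apply: npx; apply: sub; exists 1, 0; split=> //; first exact: subrg1.
  by rewrite mul1r addr0.
split; last first.
  by move=> _ z Jz; exists 0, z; split; [apply: subrg0|apply: pJ|rewrite mul0r add0r].
split.
- by move=> _ [y [z [hy hz ->]]]; apply: subrgD => //; [apply: subrgM|apply: pA'].
- move=> _ _ [y [z [hy hz ->]]] [y' [z' [hy' hz' ->]]]; exists (y + y'), (z + z').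
  by split; [apply: subrgD|apply: pD|ring].
- move=> c _ hc [y [z [hy hz ->]]]; exists (c * y), (c * z).
  by split; [apply: subrgM|apply: pM|ring].
by move=> [y [z [hy hz e]]]; apply: no; exists y, z.
Qed.

End MaximalIdeal.

Section AtMaximal.
Variable p : K -> Prop.
Hypotheses (p0 : p 0) (pA' : forall x, p x -> A x).
Hypotheses (pD : forall x y, p x -> p y -> p (x + y)) (pM : forall c x, A c -> p x -> p (c * x)).
Hypothesis p1 : ~ p 1.
Hypothesis pmax : forall x, A x -> ~ p x -> exists y z, [/\ A y, p z & y * x + z = 1].

Definition at_max x := exists a b : K, [/\ A a, A b, ~ p b & x = a / b].
Definition in_max x := exists a b : K, [/\ p a, A b, ~ p b & x = a / b].

Lemma compl_mul (a b : K) : A a -> A b -> ~ p a -> ~ p b -> ~ p (a * b).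
Proof.
move=> ha hb /(pmax ha)[y [z [hy hz e]]] nb h; apply: nb.
rewrite -[b]mul1r -e mulrDl -mulrA; apply: pD; first exact: pM.
by rewrite mulrC; apply: pM.
Qed.

Lemma compl_neq0 (b : K) : ~ p b -> b != 0.
Proof. by move=> nb; apply/eqP => e; apply: nb; rewrite e. Qed.

Lemma at_max_locring : locring at_max in_max.
Proof.
have in1 : A 1 by apply: subrg1.
split=> //.
- split.
  + by exists 1, 1; split; rewrite ?divr1.
  + move=> _ _ [a [b [ha hb nb ->]]] [c [d [hc hd nd ->]]].
    exists (a * d - c * b), (b * d); split; [|exact: subrgM|exact: compl_mul|].
      by apply: subrgB => //; apply: subrgM.
    by field; rewrite !compl_neq0.
  + move=> _ _ [a [b [ha hb nb ->]]] [c [d [hc hd nd ->]]].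
    exists (a * c), (b * d); split; [exact: subrgM|exact: subrgM|exact: compl_mul|].
    by field; rewrite !compl_neq0.
- by exists 2^-1, 1; split; rewrite ?divr1.
- by move=> _ [a [b [/pA' ha hb nb ->]]]; exists a, b.
- by exists 0, 1; split; rewrite ?mul0r.
- move=> _ _ [a [b [ha hb nb ->]]] [c [d [hc hd nd ->]]].
  exists (d * a + b * c), (b * d); split; [|exact: subrgM|exact: compl_mul|].
    by apply: pD; apply: pM.
  by field; rewrite !compl_neq0.
- move=> _ _ [a [b [ha hb nb ->]]] [c [d [hc hd nd ->]]].
  exists (a * c), (b * d); split; [exact: pM|exact: subrgM|exact: compl_mul|].
  by field; rewrite !compl_neq0.
- move=> [a [b [ha hb nb /esym/(canRL (divfK (compl_neq0 nb)))]]].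
  by rewrite mul1r => e; apply: nb; rewrite -e.
move=> _ [a [b [ha hb nb ->]]].
have [pa|npa] := pselect (p a); first by left; exists a, b.
by right; exists b, a; rewrite invf_div.
Qed.

Lemma A_at_max x : A x -> at_max x.
Proof. by move=> hx; exists x, 1; rewrite divr1; split=> //; apply: subrg1. Qed.

Lemma pA_denominator (q : {poly K}) : pA at_max q ->
  exists s, [/\ A s, ~ p s & P (s%:P * q)].
Proof.
elim/poly_ind: q => [_|q c IH hq].
  by exists 1; split=> //; [apply: subrg1|rewrite mulr0; apply: (subrg0 sP)].
have hq' : pA at_max q.
  by move=> i; have := hq i.+1; rewrite coefD coefMX coefC addr0.
have [a [b [ha hb nb ec]]] : at_max c.
  by have := hq 0%N; rewrite coefD coefMX coefC add0r.
have [s [hs ns hsq]] := IH hq'.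
exists (s * b); split; [exact: subrgM|exact: compl_mul|].
rewrite mulrDr mulrA; apply: (subrgD sP).
  apply: (subrgM sP); last exact: pA_X.
  by rewrite (mulrC s) polyCM -mulrA; apply: (subrgM sP) => //; apply: pA_CA.
rewrite -polyCM; apply: pA_CA => //.
by rewrite ec -mulrA [b * _]mulrC divfK ?compl_neq0 //; apply: subrgM.
Qed.

Lemma EP_denominator (g : 'M[{poly K}]_(n + n + 1)) : EP (pA at_max) g ->
  exists s, [/\ A s, ~ p s & EP (loc P s%:P) g].
Proof.
elim=> [|t g' ht _ [s [hs ns hg]]].
  by exists 1; split=> //; [apply: subrg1|apply: EP1].
have [s' [hs' ns' ht']] : exists s', [/\ A s', ~ p s' & egen (loc P s'%:P) t].
  case: ht => [b b' q /pA_denominator[s' [hs' ns' hq]] h1 h2|b q /pA_denominator[s' [hs' ns' hq]]];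
    exists s'; split=> //; [apply: egen_long|apply: egen_short] => //; exists 1%N;
    by rewrite /lk expr1.
have locM x y z : A y -> loc P x%:P z -> loc P (x * y)%:P z.
  move=> hy [k hk]; exists k; rewrite /lk polyCM exprMn mulrAC mulrC.
  by apply: (subrgM sP) => //; apply: (subrgX sP); apply: pA_CA.
exists (s' * s); split; [exact: subrgM|exact: compl_mul|apply: EPS].
  by apply: egen_mono ht' => z; apply: locM.
by apply: EP_mono hg => z; rewrite mulrC; apply: locM.
Qed.

End AtMaximal.

(** Were Quillen's ideal proper, it would lie in a maximal ideal [p]. The matrix found over the
    localization at [p] involves finitely many denominators, so it exists over [A] with some [s]
    outside [p] inverted, and then a power of [s] belongs to the ideal, although [p] is prime. *)
Theorem local_global (v : 'cV[{poly K}]_(n + n + 1)) :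
  (forall A' m, locring A' m -> (forall x, A x -> A' x) ->
     exists2 g, EP (pA A') g & g *m v = ev n {poly K}) ->
  exists2 g, EP P g & g *m v = map_mx (comp_poly 0) v.
Proof.
move=> loc_orb.
have [[_ h1]|n1] := pselect (same_subst v 1).
  have [g hg e] := h1 0 'X (subrg0 sP) (pA_X sA).
  exists g => //; rewrite -[RHS]e add0r mul1r; congr (_ *m _).
  by apply/matrixP => i j; rewrite mxE comp_polyXr.
have [p [[p0 Jp] pA' [pD pM] p1 pmax]] := exists_maximal_ideal (same_subst0 v) (fun x h => h.1)
  (@same_substD v) (@same_substM v) n1.
have [g hg e] := loc_orb _ _ (at_max_locring p0 pA' pD pM p1 pmax) (A_at_max p1).
have [s [hs ns hgs]] := EP_denominator p0 pD pM p1 pmax hg.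
have [M /Jp pM'] := same_subst_loc hs (compl_neq0 p0 ns) hgs e.
case: p1; elim: M pM' => [//|M IH]; rewrite exprS => h; apply: IH.
by apply: contrapT => nM; apply: (compl_mul pD pM pmax hs (subrgX sA M hs) ns nM).
Qed.

End LocalGlobal.

(** * Specialization and the global theorem over a subring of a field *)

Section Specialization.
Variables (n : nat) (K F : fieldType) (iota : {rmorphism K -> F}) (A : K -> Prop) (tau : F) (pt : K).
Hypotheses (sA : subrg A) (Apt : A pt).
Hypothesis tau_tr : forall p : {poly K}, hev iota tau p = 0 -> p = 0.
Let sP : subrg (pA A) := pA_subrg sA.
Local Notation hev := (hev iota tau).

Lemma pA_horner p : pA A p -> A p.[pt].
Proof.
move=> hp; rewrite horner_coef; apply: subrg_sum => // i _.
by apply: subrgM => //; apply: subrgX.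
Qed.

(* The graph of the specialization [tau := pt], on fractions whose denominator takes
   the value 1 at [pt]. *)
Definition spec (z : F * K) := exists d q,
  [/\ pA A d, pA A q, d.[pt] = 1, z.1 * hev d = hev q & z.2 = q.[pt]].

Lemma spec_subrg : subrg spec.
Proof.
split=> [|x y|x y].
- by exists 1, 1; split; rewrite ?hornerC ?rmorph1 ?mulr1 //; apply: (subrg1 sP).
- move=> [d [q [hd hq e1 e2 e3]]] [d' [q' [hd' hq' e1' e2' e3']]].
  exists (d * d'), (q * d' - q' * d); split.
  + exact: (subrgM sP).
  + by apply: (subrgB sP); apply: (subrgM sP).
  + by rewrite hornerM e1 e1' mulr1.
  + by rewrite (rmorphB hev) !(rmorphM hev) -e2 -e2' /=; ring.
  by rewrite !hornerE e1 e1' !mulr1 /= e3 e3'.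
move=> [d [q [hd hq e1 e2 e3]]] [d' [q' [hd' hq' e1' e2' e3']]].
exists (d * d'), (q * q'); split.
- exact: (subrgM sP).
- exact: (subrgM sP).
- by rewrite hornerM e1 e1' mulr1.
- by rewrite !(rmorphM hev) -e2 -e2' /=; ring.
by rewrite hornerM /= e3 e3'.
Qed.

Lemma spec_fun r c c' : spec (r, c) -> spec (r, c') -> c = c'.
Proof.
move=> [d [q [_ _ e1 e2 ec]]] [d' [q' [_ _ e1' e2' ec']]].
rewrite -[c]/(r, c).2 -[c']/(r, c').2 ec ec'.
have /(hev_inj tau_tr) e : hev (q * d') = hev (q' * d).
  by rewrite !(rmorphM hev) -e2 -e2' /=; ring.
by have := congr1 (horner^~ pt) e; rewrite /= !hornerM e1 e1' !mulr1.
Qed.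

Lemma spec_A z : spec z -> A z.2.
Proof. by move=> [d [q [_ hq _ _ ->]]]; apply: pA_horner. Qed.

Lemma spec_poly q : pA A q -> spec (hev q, q.[pt]).
Proof.
by exists 1, q; rewrite rmorph1 mulr1 hornerC; split=> //; apply: (subrg1 sP).
Qed.

Lemma spec_loc d z : pA A d -> d.[pt] = 1 -> loc (Pol iota A tau) (hev d) z ->
  exists c, spec (z, c).
Proof.
move=> hd e [k [q hq e']]; exists q.[pt], (d ^+ k), q; split=> //.
- exact: (subrgX sP).
- by rewrite horner_exp e expr1n.
by rewrite rmorphXn mulrC.
Qed.

(** The parameters of [g] are paired with their specializations, which lifts [g] to the product ring
    [F * K]. The graph [spec] is a subring there, so the action stays in it; since the graph is
    single valued, projection to [K] gives the specialized equation. *)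
Lemma specialize_orbit (Q : F -> Prop) g (u u' : 'cV[F]_(n + n + 1)) (c c' : 'cV[K]_(n + n + 1)) :
  (forall z, Q z -> exists a, spec (z, a)) -> EP Q g -> g *m u = u' ->
  (forall i, spec (u i 0, c i 0)) -> (forall i, spec (u' i 0, c' i 0)) ->
  exists2 h, EP A h & h *m c = c'.
Proof.
move=> Qs hg e su su'.
have [g2 hg2 eg2] : exists2 g2, EP spec g2 & map_mx (fst : {rmorphism F * K -> F}) g2 = g.
  by apply: EP_lift hg => z /Qs[a ha]; exists (z, a).
exists (map_mx (snd : {rmorphism F * K -> K}) g2); first by apply: EP_map hg2 => z /spec_A.
pose uc : 'cV[F * K]_(n + n + 1) := \col_i (u i 0, c i 0).
have e1 : map_mx (fst : {rmorphism F * K -> F}) uc = u by apply/colP => i; rewrite !mxE.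
have e2 : map_mx (snd : {rmorphism F * K -> K}) uc = c by apply/colP => i; rewrite !mxE.
have huc : vin spec uc by move=> i; rewrite mxE.
have := EP_vin spec_subrg hg2 huc => hr.
rewrite -e2 -map_mxM; apply/colP => i; rewrite mxE.
apply: (spec_fun (r := u' i 0)); last exact: su'.
have -> : u' i 0 = ((g2 *m uc) i 0).1 by rewrite -e -eg2 -e1 -map_mxM mxE.
by have := hr i; case: ((g2 *m uc) i 0).
Qed.

End Specialization.

Lemma rv_horner1 (K : fieldType) (q : {poly K}) : (rv (size q) q).[1] = q.[1].
Proof.
have h p : hev (idfun : {rmorphism K -> K}) 1 p = p.[1] by rewrite hevE map_poly_id.
have := hev_rv (idfun : {rmorphism K -> K}) (oner_neq0 K) (leqnSn (size q)).
by rewrite invr1 !h expr1n mul1r.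
Qed.

(** * Gluing the two affine lines *)

Section GlobalOrbit.
Variables (n : nat) (K F : fieldType) (iota : {rmorphism K -> F}) (A : K -> Prop).
Hypotheses (n_ge2 : (2 <= n)%N) (sA : subrg A) (hA : A 2^-1) (two0 : (2 : K) != 0).
Let sP : subrg (pA A) := pA_subrg sA.
Local Notation P := (pA A).
Local Notation hev := (hev iota).

Definition same_orbit (u u' : 'cV[{poly K}]_(n + n + 1)) := exists2 g, EP P g & g *m u = u'.
Definition const_vec (c : K) (u : 'cV[{poly K}]_(n + n + 1)) : 'cV[K]_(n + n + 1) :=
  \col_i (u i 0).[c].

Let oP : oppc P. Proof. by move=> p hp; apply: (subrgN sP). Qed.

Lemma same_orbit_trans u u' u'' : same_orbit u u' -> same_orbit u' u'' -> same_orbit u u''.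
Proof.
move=> [g hg e] [h hh e']; exists (h *m g); first exact: EP_mul.
by rewrite -mulmxA e.
Qed.

Lemma same_orbit_sym u u' : same_orbit u u' -> same_orbit u' u.
Proof.
move=> [g hg <-]; exists (invmx g); first exact: EP_inv.
by rewrite mulKmx // (EP_unit hg).
Qed.

Lemma same_orbit_const (x y : 'cV[K]_(n + n + 1)) : (exists2 h, EP A h & h *m x = y) ->
  same_orbit (map_mx polyC x) (map_mx polyC y).
Proof.
move=> [h hh <-]; exists (map_mx polyC h); first by apply: EP_map hh => p; apply: pA_CA.
by rewrite map_mxM.
Qed.

Lemma same_orbit_points u c : A c ->
  same_orbit u (map_mx (comp_poly 0) u) ->
  same_orbit (map_mx polyC (const_vec 0 u)) (map_mx polyC (const_vec c u)).
Proof.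
move=> hc [g hg e]; apply: same_orbit_sym.
exists (map_mx (comp_poly c%:P) g).
  by apply: EP_map hg => p hp; apply: pA_comp => //; apply: pA_CA.
have -> : map_mx polyC (const_vec c u) = map_mx (comp_poly c%:P) u.
  by apply/colP => i; rewrite !mxE comp_polyCr.
rewrite -map_mxM e; apply/colP => i.
by rewrite !mxE /= comp_poly0r comp_polyC horner_coef0.
Qed.

Lemma const_vec0 u : map_mx (comp_poly 0) u = map_mx polyC (const_vec 0 u).
Proof. by apply/colP => i; rewrite !mxE comp_poly0r horner_coef0. Qed.

Variable T : F.
Hypotheses (T0 : T != 0) (Ttr : forall p, hev T p = 0 -> p = 0).
Local Notation S := T^-1.

Theorem monic_orbit (v : 'cV[{poly K}]_(n + n + 1)) f g : vin P v -> qf v = 1 ->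
  P f -> f \is monic -> EP (loc (Pol iota A T) (hev T f)) g ->
  g *m map_mx (hev T) v = ev n F -> same_orbit v (ev n {poly K}).
Proof.
move=> hv qv hf fmon hg eg.
have S0 : S != 0 by rewrite invr_eq0.
have Str := hev_tr_inv T0 Ttr.
have sPm := Pol_subrg iota S sA; have Sm : Pol iota A S S by apply: Pol_tau.
pose fs := rv (size f).-1 f; pose D := hev S fs.
have szf : (size f <= (size f).-1.+1)%N by rewrite leqSpred.
have hfs : P fs by apply: pA_rv => //; apply: subrg0.
have fs0 : fs.[0] = 1.
  by rewrite horner_coef0 coef_poly subn0; have := monicP fmon.
have eD : D = S ^+ (size f).-1 * hev T f by rewrite /D (hev_rv iota S0) // invrK.
have hD : Pol iota A S D by exists fs.
have locTS z : loc (Pol iota A T) (hev T f) z -> loc (Pol iota A S) (S * D) z.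
  move=> [k hk].
  have [j hj] : loc (Pol iota A S) S (hev T f ^+ k * z).
    by apply: loc_inv => //; apply: loc_P.
  exists (j + k)%N; rewrite /lk.
  have -> : (S * D) ^+ (j + k) * z =
      S ^+ k * D ^+ j * S ^+ ((size f).-1 * k) * (S ^+ j * (hev T f ^+ k * z)).
    rewrite exprMn !exprD [in D ^+ k]eD exprMn exprM.
    by set a := (S ^+ _) ^+ k; ring.
  by do !apply: (subrgM sPm) => //; apply: (subrgX sPm).
have half : Pol iota A S 2^-1.
  by apply: cst_Pol => //; exists 2^-1; rewrite ?fmorphV ?rmorph_nat.
have h22 : 2^-1 * 2 = 1 :> F by rewrite mulVf // -(rmorph_nat iota 2) fmorph_eq0.
have [e1 he1 ebz] : exists2 e1, Pol iota A S e1 & - e1 * S + 1 * D = 1.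
  exists (hev S (drop_poly 1 fs)).
    by exists (drop_poly 1 fs) => // i; rewrite coef_drop_poly.
  rewrite /D -{2}(poly_take_drop 1 fs) rmorphD rmorphM expr1 hevX.
  rewrite (_ : take_poly 1 fs = 1) ?rmorph1; first by ring.
  apply/polyP => -[|i]; rewrite coef_take_poly coef1 //.
  by rewrite -fs0 horner_coef0.
have og : oppc (loc (Pol iota A T) (hev T f)).
  by move=> p hp; apply: (subrgN (loc_subrg (Pol_subrg iota T sA) _)) => //; exists f.
have hgi := EP_mono locTS (EP_inv og hg).
have he1N : Pol iota A S (- e1) by apply: (subrgN sPm).
have [a [b [ha hb eab]]] := coprime_split n_ge2 sPm Sm hD half h22 he1N (subrg1 sPm) ebz
  (fun _ h => h) (fun c z => subrgM sPm (x := c) (y := z)) 0 hgi.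
have {}hb : EP (loc (Pol iota A S) D) b.
  by apply: EP_mono hb => z [z' hz' ->]; rewrite expr0 mul1r.
have ua := EP_unit ha.
pose w0 := b *m ev n F.
have evw : map_mx (hev T) v = a *m w0.
  by rewrite mulmxA -eab -eg mulKmx // (EP_unit hg).
have oS : oppc (loc (Pol iota A S) S).
  by move=> p hp; apply: (subrgN (loc_subrg sPm Sm)).
have hai := EP_inv oS ha.
have locSD z : loc (Pol iota A S) S z -> loc (Pol iota A S) D z -> Pol iota A S z.
  move=> [j hj] [k hk].
  have [U [W [hU hW E]]] := bezout_pow sPm Sm hD he1N (subrg1 sPm) ebz j k.
  rewrite -[z]mul1r -E mulrDl -!mulrA; apply: (subrgD sPm); exact: (subrgM sPm).
(* As [b *m ev] the vector [w0] has denominators in [D], as [invmx a *m v] in [S]; these are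
   comaximal. *)
have hw0 i : exists2 q, P q & w0 i 0 = hev S q.
  apply: locSD; last first.
    apply: (EP_vin (loc_subrg sPm hD) hb); apply: vin_ev; exact: loc_subrg.
  have -> : w0 = invmx a *m map_mx (hev T) v by rewrite evw mulKmx.
  apply: (EP_vin (loc_subrg sPm Sm) hai) => k; rewrite mxE.
  by apply: loc_inv => //; apply: loc_P; exists (v k 0).
have [w_ hw_ ew_] := fin_all_exists2 hw0.
pose w : 'cV[{poly K}]_(n + n + 1) := \col_i w_ i.
have ew : map_mx (hev S) w = w0 by apply/colP => i; rewrite ew_ !mxE.
have ewi i : w0 i 0 = hev S (w i 0) by rewrite -ew mxE.
have hw : vin P w by move=> i; rewrite mxE.
have qw : qf w = 1.
  apply: (hev_inj Str); rewrite -qf_map ew rmorph1 /w0 (EP_isom hb).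
  by rewrite !(qfE, czE) ?expr1n.
have aLR (B : K -> Prop) z : (forall x, A x -> B x) -> loc (Pol iota A S) S z ->
    loc (Pol iota B S) S z.
  by move=> AB [k [q hq e]]; exists k; exists q => // i; apply: AB.
have vv0 : same_orbit v (map_mx (comp_poly 0) v).
  apply: local_global => // A' m lr AA'.
  apply: (local_orbit n_ge2 lr T0 Ttr (x := w) (a := a)) => //.
  - by move=> i; move: (hv i) => h j; apply: AA'.
  - by move=> i; move: (hw i) => h j; apply: AA'.
  - apply: EP_mono ha => z /(aLR _ _ AA') hz; rewrite -[T]invrK; apply: loc_inv => //.
    exact: lr_sub lr.
  by rewrite ew.
have ww0 : same_orbit w (map_mx (comp_poly 0) w).
  apply: local_global => // A' m lr AA'.
  apply: (local_orbit n_ge2 lr S0 Str (x := v) (a := invmx a)) => //.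
  - by move=> i; move: (hw i) => h j; apply: AA'.
  - by move=> i; move: (hv i) => h j; apply: AA'.
  - by apply: EP_mono hai => z /(aLR _ _ AA').
  by rewrite invrK ew evw mulKmx.
have A1 : A 1 by apply: subrg1.
have A0 : A 0 by apply: subrg0.
apply: (same_orbit_trans vv0); rewrite const_vec0.
apply: (same_orbit_trans (same_orbit_points A1 vv0)).
apply: (same_orbit_trans (u' := map_mx polyC (const_vec 1 w))).
  apply/same_orbit_sym/same_orbit_const.
  (* The denominators of [a] are powers of [S], which take the value 1 at the point 1. *)
  apply: (specialize_orbit sA A1 Str (g := a) (u := w0) (u' := map_mx (hev T) v) _ ha) => //.
  - move=> z hz; apply: (spec_loc sA (d := 'X)); rewrite ?hornerX ?hevX //.
    exact: pA_X.
  - by move=> i; rewrite ewi [const_vec _ _ _ _]mxE; apply: spec_poly.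
  (* As a fraction in [S], an entry of [v] is its reversal divided by a power of [S], and reversal
     preserves the value at 1. *)
  move=> i; rewrite !mxE; exists ('X ^+ size (v i 0)), (rv (size (v i 0)) (v i 0)); split.
  - by apply: (subrgX sP); apply: pA_X.
  - by apply: pA_rv.
  - by rewrite horner_exp hornerX expr1n.
  - by rewrite (rmorphXn (hev S)) hevX (hev_rv iota S0) ?leqnSn // invrK [RHS]mulrC.
  by rewrite rv_horner1.
apply: (same_orbit_trans (same_orbit_sym (same_orbit_points A1 ww0))).
have -> : ev n {poly K} = map_mx polyC (ev n K) by rewrite map_ev.
apply/same_orbit_sym/same_orbit_const.
(* The denominators of [b] are powers of [D], and [fs] takes the value 1 at 0. *)
apply: (specialize_orbit sA A0 Str (g := b) (u := ev n F) (u' := w0) _ hb) => //.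
- by move=> z hz; apply: (spec_loc sA (d := fs)).
- move=> i; rewrite -(map_ev n (hev S)).
  have -> : ev n K i 0 = (ev n {poly K} i 0).[0] by rewrite !mxE -polyC_natr hornerC.
  by rewrite [map_mx _ _ i 0]mxE; apply: spec_poly => //; apply: vin_ev.
by move=> i; rewrite ewi [const_vec _ _ _ _]mxE; apply: spec_poly.
Qed.

End GlobalOrbit.
Local Open Scope quotient_scope.

(** * Comparison with the generators of EO *)

Section Generators.
Variables (n : nat) (R : comNzRingType).
Implicit Types (b : bool * 'I_n) (p : R).

Lemma delta_mul (i j : 'I_(n + n + 1)) (x : 'cV[R]_(n + n + 1)) : delta_mx i j *m x = x j 0 *: delta_mx i 0.
Proof.
apply/colP => k; rewrite !mxE (bigD1 j) //= big1 => [|l ne]; rewrite !mxE ?eqxx ?andbT.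
  by rewrite addr0 mulrC.
by rewrite (negPf ne) andbF mul0r.
Qed.

Lemma tr_long b b' p : b' != star b -> tr (bas b) (p *: bas b') =
  1%:M + p *: delta_mx (pos b') (pos (star b)) - p *: delta_mx (pos b) (pos (star b')).
Proof.
move=> ne; apply: mx_ext => x; rewrite trE !(qfE, bfE) !(mulmxDl, mulNmx) mul1mx -!scalemxAl.
rewrite !delta_mul -/(co _ x) mulr0 mul0r scale0r subr0 !scalerA.
by rewrite (mulrC _ p).
Qed.

Lemma tr_short b p : tr (bas b) (p *: ev n R) =
  1%:M + (2 * - p) *: delta_mx (pos b) (zc n) - (- p) ^+ 2 *: delta_mx (pos b) (pos (star b))
  + p *: delta_mx (zc n) (pos (star b)).
Proof.
apply: mx_ext => x; rewrite trE !(qfE, bfE) !(mulmxDl, mulNmx) mul1mx -!scalemxAl.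
rewrite !delta_mul -/(co _ x) -/(cz x) -/(Qbase n R) -/(ev n R) -/(bas b).
by apply/matrixP => i j; rewrite !mxE; ring.
Qed.

Lemma egen_EO (t : 'M[R]_(n + n + 1)) : egen setT t -> EO_generator t.
Proof.
case=> [b b' p _ n1 n2|b p _]; last first.
  rewrite tr_short.
  (* The short generators of [EO] are short transvections with the opposite parameter. *)
  have -> : p *: delta_mx (zc n) (pos (star b)) = - ((- p) *: delta_mx (zc n) (pos (star b))).
    by rewrite scaleNr opprK.
  case: b => -[] i.
    exact: EO_gen4.
  exact: EO_gen5.
rewrite tr_long //; case: b b' n1 n2 => [[] j] [[] i]; rewrite /star !xpair_eqE /= ?andbT => n1 n2.
- exact: EO_gen2.
- rewrite addrAC -scaleNr (_ : p *: _ = - (- p *: delta_mx (yc i) (yc j))).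
    by apply: EO_gen1; rewrite eq_sym.
  by rewrite scaleNr opprK.
- exact: EO_gen1.
- exact: EO_gen3.
Qed.

Lemma EP_EO (g : 'M[R]_(n + n + 1)) : EP setT g -> EO g.
Proof.
by elim=> [|t h /egen_EO ht _ hh]; [apply: EO_one|apply: EO_mul => //; apply: EO_base].
Qed.

End Generators.

(** A localization is a ring that may be zero, where transvections are not defined; the comparison
    is therefore made after mapping to [R']. *)
Lemma EO_generator_map n (R : comPzRingType) (R' : comNzRingType) (phi : {rmorphism R -> R'})
    (P : R' -> Prop) (g : 'M[R]_(n + n + 1)) : (forall l, P (phi l)) ->
  EO_generator g -> egen P (map_mx phi g).
Proof.
move=> hP; have long b b' l : b' != b -> b' != star b ->
  egen P (1%:M + phi l *: delta_mx (pos b') (pos (star b))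
    - phi l *: delta_mx (pos b) (pos (star b')) : 'M_(n + n + 1)).
  by move=> h1 h2; rewrite -tr_long //; apply: egen_long.
have short b l : egen P (1%:M + (2 * phi l) *: delta_mx (pos b) (zc n)
    - phi l ^+ 2 *: delta_mx (pos b) (pos (star b))
    - phi l *: delta_mx (zc n) (pos (star b)) : 'M_(n + n + 1)).
  rewrite (_ : _ - _ = tr (bas b) (- phi l *: ev n R')); last first.
    by rewrite tr_short opprK; congr (_ + _); rewrite scaleNr.
  by apply: egen_short; rewrite -rmorphN.
case=> [i j l ne|i j l ne|i j l ne|i l|i l];
  rewrite !(map_mxD, map_mxN, map_mxZ, map_mx1, map_delta_mx) ?rmorphM ?rmorphXn ?rmorph_nat.
- by apply: (long (false, j) (true, i)); rewrite ?xpair_eqE //= (negPf ne).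
- by apply: (long (true, j) (true, i)); rewrite ?xpair_eqE //= (negPf ne).
- by apply: (long (false, j) (false, i)); rewrite ?xpair_eqE //= (negPf ne).
- exact: (short (true, i)).
- exact: (short (false, i)).
Qed.

Lemma EO_map n (R : comPzRingType) (R' : comUnitRingType) (phi : {rmorphism R -> R'})
    (P : R' -> Prop) (g : 'M[R]_(n + n + 1)) : oppc P -> (forall l, P (phi l)) ->
  EO g -> EP P (map_mx phi g).
Proof.
move=> oP hP; elim=> [h hh||h h' _ IH _ IH'|h h' _ IH e _].
- by apply: EP_egen; apply: EO_generator_map hh.
- by rewrite map_mx1; apply: EP1.
- by rewrite map_mxM; apply: EP_mul.
have := congr1 (map_mx phi) e; rewrite map_mxM map_mx1 => /invmx_eq <-.
exact: EP_inv.
Qed.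

(** * The universal property of localization, with values in a field *)

Section LocalizationLift.
Variables (R : comPzRingType) (S : mulrClosed R) (F : fieldType) (psi : {rmorphism R -> F}).
Hypothesis psiS : forall s, s \in S -> psi s != 0.
Import Localization.

Definition loc_lift (x : localization S) : F := psi (num (repr x)) / psi (den (repr x)).

Lemma loc_lift_pi (y : frac S) : loc_lift (\pi_(localization S) y) = psi (num y) / psi (den y).
Proof.
have [u uS /(congr1 psi)] := repr_loc y; rewrite !rmorphM => /(mulfI (psiS uS)) e.
apply/eqP; rewrite /loc_lift eqr_div ?psiS ?den_in //; exact/eqP.
Qed.

Lemma loc_lift_zmod : zmod_morphism loc_lift.
Proof.
elim/quotW=> x; elim/quotW=> y.
rewrite -[_ - _]/(add (\pi x) (opp (\pi y))) -(pi_opp y) -(pi_add x) !loc_lift_pi.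
rewrite !(num_mk, den_mk) rmorphD !rmorphM rmorphN.
by field; rewrite !psiS ?den_in.
Qed.

Lemma loc_lift_monoid : monoid_morphism loc_lift.
Proof.
split.
  have -> : 1 = \pi_(localization S) (embf S 1) by rewrite -[1]/(emb S 1) !piE.
  by rewrite loc_lift_pi !(num_mk, den_mk) rmorph1 divr1.
elim/quotW=> x; elim/quotW=> y.
rewrite -[_ * _]/(mul (\pi x) (\pi y)) -(pi_mul x) !loc_lift_pi !(num_mk, den_mk) !rmorphM.
by field; rewrite !psiS ?den_in.
Qed.

HB.instance Definition _ := GRing.isZmodMorphism.Build _ _ loc_lift loc_lift_zmod.
HB.instance Definition _ := GRing.isMonoidMorphism.Build _ _ loc_lift loc_lift_monoid.

Definition loc_hom : {rmorphism localization S -> F} := loc_lift.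

Lemma loc_hom_map a : loc_hom (loc_map S a) = psi a.
Proof.
rewrite -[loc_map S a]/(emb S a) !piE -[LHS]/(loc_lift _) loc_lift_pi.
by rewrite !(num_mk, den_mk) rmorph1 divr1.
Qed.

Lemma loc_hom_den x : exists2 s, s \in S & exists a, psi s * loc_hom x = psi a.
Proof.
exists (den (repr x)); first exact: den_in.
by exists (num (repr x)); rewrite mulrC divfK // psiS ?den_in.
Qed.

End LocalizationLift.

(** * Realisation inside the fraction field of the polynomial ring over the fraction field of [A] *)

Section FractionModel.
Variables (A : idomainType).
Local Notation K := {fraction A}.
Local Notation F := {fraction {poly K}}.
Local Notation toK := (@tofrac A : {rmorphism A -> K}).
Local Notation toF := (@tofrac {poly K} : {rmorphism {poly K} -> F}).

Definition coef_frac : {rmorphism K -> F} := toF \o polyC.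
Definition in_base (x : K) := exists a, x = toK a.
Definition poly_frac : {rmorphism {poly A} -> {poly K}} := map_poly toK.

Lemma hev_frac p : hev coef_frac (toF 'X) p = toF p.
Proof.
elim/poly_ind: p => [|p c IH]; first by rewrite !rmorph0.
by rewrite !rmorphD !rmorphM IH hevX hevC.
Qed.

Lemma frac_tr p : hev coef_frac (toF 'X) p = 0 -> p = 0.
Proof. by rewrite hev_frac => /eqP; rewrite tofrac_eq0 => /eqP. Qed.

Lemma in_base_subrg : subrg in_base.
Proof.
split=> [|_ _ [a ->] [b ->]|_ _ [a ->] [b ->]].
- by exists 1; rewrite rmorph1.
- by exists (a - b); rewrite rmorphB.
by exists (a * b); rewrite rmorphM.
Qed.

Lemma poly_frac_inj : injective poly_frac.
Proof.
apply: map_inj_poly; last by rewrite rmorph0.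
by move=> a b /eqP; rewrite tofrac_eq => /eqP.
Qed.

Lemma poly_frac_pA p : pA in_base (poly_frac p).
Proof. by move=> i; rewrite coef_map; exists p`_i. Qed.

Lemma pA_poly_frac q : pA in_base q -> exists p, poly_frac p = q.
Proof.
move=> /choice[c hc]; exists (\poly_(i < size q) c i); apply/polyP => i.
rewrite coef_map coef_poly; case: ltnP => h; first by rewrite hc.
by rewrite nth_default //; apply: tofrac0.
Qed.

(** Only the image of [A[T]_f] in the field is used. The matrix obtained there has parameters coming
    from [A[T]], so it lifts, and the equation descends because [poly_frac] is injective. *)
Theorem EO_orbit_monic (half : A) n (v : 'cV[{poly A}]_(n + n + 1)) (f : {poly A}) :
  half * 2 = 1 -> (2 <= n)%N -> Qprime v -> f \is monic ->
  EO_same_orbit (map_mx (loc_away_map f) v) (Qbase n (loc_away f)) ->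
  EO_same_orbit v (Qbase n {poly A}).
Proof.
move=> half2 n_ge2 v_in f_monic [g hg eg].
pose T : F := tofrac 'X; pose ci := coef_frac.
have two0K : (2 : K) != 0.
  rewrite -(rmorph_nat toK) tofrac_eq0.
  by apply: contra_eq_neq half2 => ->; rewrite mulr0 eq_sym oner_eq0.
have hK : in_base 2^-1.
  exists half; apply: (mulIf two0K); rewrite mulVf //.
  by rewrite -(rmorph_nat toK) -rmorphM half2 rmorph1.
have T0 : T != 0 by rewrite tofrac_eq0 polyX_eq0.
pose psi : {rmorphism {poly A} -> F} := hev ci T \o poly_frac.
have fmon : poly_frac f \is monic by apply: monic_map.
have f0 : psi f != 0.
  by apply/eqP => /frac_tr e; have := monic_neq0 fmon; rewrite e eqxx.
have psiS s : s \in powers_of f -> psi s != 0.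
  by move=> /asboolP[j ->]; rewrite rmorphXn expf_neq0.
pose th : {rmorphism loc_away f -> F} := loc_hom psiS.
pose P := Pol ci in_base T.
have sP : subrg P by apply/Pol_subrg/in_base_subrg.
have Pf : P (psi f) by exists (poly_frac f) => //; apply: poly_frac_pA.
have hth l : loc P (psi f) (th l).
  have [s /asboolP[j es] [a ea]] := loc_hom_den psiS l.
  by exists j; rewrite /lk -rmorphXn -es ea; exists (poly_frac a) => //; apply: poly_frac_pA.
have oP : oppc (loc P (psi f)) by move=> z hz; apply: (subrgN (loc_subrg sP Pf)).
have hgF := EO_map oP hth hg.
have egF : map_mx th g *m map_mx (hev ci T) (map_mx poly_frac v) = ev n F.
  rewrite -[RHS](map_delta_mx th) -[delta_mx _ _]/(Qbase n (loc_away f)) -eg map_mxM; congr (_ *m _).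
  by apply/colP => i; rewrite !mxE; rewrite /th loc_hom_map.
have qv : qf (map_mx poly_frac v) = 1.
  by rewrite qf_map; move/QprimeE: v_in => ->; rewrite rmorph1.
have hv : vin (pA in_base) (map_mx poly_frac v).
  by move=> i; rewrite mxE; apply: poly_frac_pA.
have [h hh eh] := monic_orbit n_ge2 in_base_subrg hK two0K T0 frac_tr hv qv
  (poly_frac_pA f) fmon hgF egF.
have [h' hh' eh'] : exists2 h', EP setT h' & map_mx poly_frac h' = h.
  by apply: EP_lift hh => p /pA_poly_frac[q eq]; exists q.
exists h'; first exact: EP_EO.
move: eh; rewrite -eh' -map_mxM -(map_ev n poly_frac) => /colP e.
by apply/colP => i; apply: poly_frac_inj; have := e i; rewrite !mxE.
Qed.

End FractionModel.

Theorem theorem1p9 (k : fieldType) (k_perfect : perfect_field k)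
    (k_char : 2%N \notin [pchar k])
    (A : idomainType) (A_regular : regular_ring A) (iota : {rmorphism k -> A})
    (n : nat) (n_ge2 : (2 <= n)%N)
    (v : 'cV[{poly A}]_(n + n + 1)) (v_in : Qprime v)
    (f : {poly A}) (f_monic : f \is monic) :
  EO_same_orbit (map_mx (loc_away_map f) v) (Qbase n (loc_away f)) ->
  EO_same_orbit v (Qbase n {poly A}).
Proof.
have two0 : (2 : k) != 0.
  by apply: contraNneq k_char => e; rewrite inE /= e eqxx.
apply: (@EO_orbit_monic A (iota 2^-1)) => //.
by rewrite -(rmorph_nat iota 2) -rmorphM mulVf // rmorph1.
Qed.
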